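(* There exist absolute constants $c_0,\eta_0>0$ such that the following holds. Let $t\ge 3$ be an integer, and let $a,b,c,g$ be elements of $\mathbb{Z}/2^t\mathbb{Z}$, identified with integers in the least residue system modulo $2^t$, with $\gcd(g,2)=\gcd(a,2)=1$ and $b\equiv 0 \bmod 2$. Let $\tau$ be the multiplicative order of $g$ modulo $2^t$, and write $$g^2=1+w_\beta 2^\beta,\qquad \gcd(w_\beta,2)=1,$$ with integers $\beta$ and $w_\beta$. Let the sequence $(u_n)_{n\ge 0}$ in $\mathbb{Z}/2^t\mathbb{Z}$ be given by $$u_n=\frac{a}{g^n-b}+c .$$ Then for every integer $L\ge 0$ and every integer $N$ with $2^{32\beta}<N\le\tau$, the discrepancy $D(L,N)$ of the points $u_L/2^t,u_{L+1}/2^t,\ldots,u_{L+N-1}/2^t\in[0,1)$ satisfies $$D(L,N)\le c_0\,N^{-\eta_0\rho^2},\qquad\text{where } \rho=\frac{\log N}{t}.$$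
   Context: $\log$ is the natural logarithm. The division in the definition of $u_n$ is in the ring $\mathbb{Z}/2^t\mathbb{Z}$; it makes sense since $g^n-b$ is odd, hence a unit. Each $u_n$ is identified with its representative in the least residue system $\{0,1,\ldots,2^t-1\}$, so that $u_n/2^t\in[0,1)$. The discrepancy is $$D(L,N)=\sup_{J\subset[0,1)}\left|\frac{A(J,N)}{N}-|J|\right|,$$ where the supremum is over all subintervals $J$ of $[0,1)$, $A(J,N)$ is the number of integers $n$ with $L\le n<L+N$ and $u_n/2^t\in J$, and $|J|$ is the length of $J$. *)

(* Defs.v *)
From HB Require Import structures.
From mathcomp Require Import all_boot all_order all_algebra.
From mathcomp Require Import all_classical all_reals all_analysis.

Set Implicit Arguments.
Unset Strict Implicit.
Unset Printing Implicit Defensive.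

Import Order.TTheory GRing.Theory Num.Theory.

Local Open Scope classical_set_scope.
Local Open Scope ring_scope.

(* The quotient is the one of the ring Z/2^t; in MathComp it is the genuine
   quotient only when g ^+ n - b is a unit, i.e. when its residue is odd. *)
Definition inversive_seq (t : nat) (a b c g : 'Z_(2 ^ t)%N) (n : nat)
    : 'Z_(2 ^ t)%N :=
  a / (g ^+ n - b) + c.

(* x / 2^t, where x stands for its least nonnegative residue; for t >= 1, since
   'Z_1 is Z/2Z in MathComp. *)
Definition residue_point (R : realType) (t : nat) (x : 'Z_(2 ^ t)%N) : R :=
  (nat_of_ord x)%:R / 2%:R ^+ t.

Definition count_in (R : realType) (x : nat -> R) (L N : nat) (J : interval R)
    : nat :=
  count (fun n => x n \in J) (index_iota L (L + N)).

(* J ranges over all intervals included in [0, 1[, whatever the type of their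
   bounds (and possibly empty); the set is nonempty and, for N > 0, bounded by
   1, so that sup is its least upper bound. *)
Definition discrepancy (R : realType) (x : nat -> R) (L N : nat) : R :=
  sup [set `| (count_in x L N J)%:R / N%:R
              - fine (lebesgue_measure [set` J]) |
      | J in [set J : interval R | [set` J] `<=` `[0, 1[ ]].

(* Main.v *)
Require Import Defs.
From HB Require Import structures.
From mathcomp Require Import all_boot all_order all_fingroup all_algebra.
From mathcomp Require Import all_classical all_reals all_analysis.
From mathcomp Require Import complex.
From mathcomp Require Import zify ring lra.

Set Implicit Arguments.
Unset Strict Implicit.
Unset Printing Implicit Defensive.

Import Order.TTheory GRing.Theory Num.Theory.

(* The Korobov-Vinogradov method, carried out 2-adically.

   Take 2^(8 kap) <= N < 2^(8 kap + 8) and D = t / kap, which is of size 1 / rho.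
   For a suitable m, g^(2^m) = 1 + 2^kap w with w odd, and n + 2^m z substituted
   in the sequence gives a polynomial of degree D in z. The coefficient of z^i
   is an odd multiple of 2^(kap i) / i! for every i: the j-th coefficient of
   a / (g^n (1 + q)^z - b) in Newton's basis is q^j times an odd number, and here
   it matters that the prime is 2 and that b is even. Averaging over z = x y with
   x, y < 2^kap and applying Hoelder's inequality twice bounds the exponential
   sum by Vinogradov's mean value of degree D in 2 * 5 D^2 variables times linear
   sums; as all the coefficients are known 2-adically, these are complete sums
   for j > D / 2 and save 2^(kap (D - j)) each. The resulting bound for the sum
   is N 2^(- c kap / D^2), and smoothing followed by a Fourier expansion turns it
   into a bound for the discrepancy.

   The mean value is bounded by Linnik's p-adic argument. For p = 2 the variables
   cannot be distinct modulo p; they are taken distinct modulo 2^(4 D), at the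
   cost of a factor 2^O(D^3) per step, which is harmless because a root of order
   100 D^4 is taken at the end. Hoelder's inequality for the mean values is
   proved by counting solutions, without exponential sums. *)

(** * Energies of maps between finite types *)

(** Why the exponents balance: in coordinate j the box of power-sum differences has length about
    2^(kap j), and the coefficient of z^j has valuation about kap j in a ring where 2^t = 0, with t
    close to kap D. A linear sum over the box therefore runs over whole periods as soon as 2 j > D.
    The gains kap (D - j) over these j add up to about kap D^2 / 8. Against them stands the distance
    of the mean value from its optimal exponent, counted twice. Each Linnik step multiplies this
    defect by 1 - 1 / D, so 4 D steps of D variables each, starting from D^2 variables, bring the
    double defect down to kap D (D + 1) / 16: hence the 5 D^2. A frequency divisible by a high power
    of 2 would destroy the gains; the smoothing is arranged so that only frequencies of valuation at
    most 2 w, small against kap, need a nontrivial bound. When kap <= D^2 the final estimate is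
    trivial, and kap > D^2 is also what keeps the factorials harmless: the valuation of j! stays
    below kap for j <= D. *)

Section Energy.
Context {V : eqType}.

Definition cross (U U' : finType) (P : pred U) (f : U -> V) (Q : pred U')
    (g : U' -> V) : nat :=
  \sum_(u | P u) \sum_(v | Q v) (f u == g v).

Definition energy (U : finType) (P : pred U) (f : U -> V) := cross P f P f.

Definition fiber (U : finType) (P : pred U) (f : U -> V) (z : V) : nat :=
  \sum_(u | P u) (f u == z).

Lemma cross_fiber (U U' : finType) (P : pred U) (f : U -> V) (Q : pred U')
    (g : U' -> V) (s : seq V) : uniq s -> (forall u, P u -> f u \in s) ->
  cross P f Q g = \sum_(z <- s) fiber P f z * fiber Q g z.
Proof.
move=> us fs; rewrite /cross /fiber.
under [RHS]eq_bigr => z _ do rewrite big_distrl /=.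
rewrite [RHS]exchange_big; apply: eq_bigr => u Pu /=.
under [RHS]eq_bigr => z _ do rewrite big_distrr /=.
rewrite [RHS]exchange_big; apply: eq_bigr => v Qv /=.
rewrite (bigD1_seq (f u)) ?fs //= eqxx mul1n big1 ?addn0 1?eq_sym //.
by move=> z zf; rewrite [f u == z]eq_sym (negbTE zf) mul0n.
Qed.

(** A value taken [m] times by [f] and [n] times by [g] contributes [2 m n] on the left and
    [m ^ 2 + n ^ 2] on the right. *)
Lemma cross_le (U U' : finType) (P : pred U) (f : U -> V) (Q : pred U')
    (g : U' -> V) :
  2 * cross P f Q g <= energy P f + energy Q g.
Proof.
pose s := undup (codom f ++ codom g).
have us : uniq s by exact: undup_uniq.
have fs u : f u \in s by rewrite mem_undup mem_cat codom_f.
have gs u : g u \in s by rewrite mem_undup mem_cat codom_f orbT.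
rewrite /energy !(@cross_fiber _ _ _ _ _ _ s) // -big_split big_distrr /=.
apply: leq_sum => z _; rewrite !mulnn; exact: nat_Cauchy.
Qed.

Lemma cross_max (U U' : finType) (P : pred U) (f : U -> V) (Q : pred U')
    (g : U' -> V) (B : nat) :
  energy P f <= B -> energy Q g <= B -> cross P f Q g <= B.
Proof. by move=> h1 h2; have := cross_le P f Q g; lia. Qed.

(** Cauchy-Schwarz for a cover: pairs of elements of [P] are distributed over pairs of pieces, and
    each cross term is at most the mean of two energies. Overlaps of the pieces only increase the
    right-hand side. *)
Lemma energy_cover (I U U' : finType) (P : pred U) (f : U -> V)
    (Q : I -> pred U') (th : I -> U' -> U) :
  (forall u, P u -> exists i u', Q i u' /\ th i u' = u) ->
  energy P f <= #|I| * \sum_i energy (Q i) (f \o th i).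
Proof.
move=> cov.
have step (F : U -> nat) :
    \sum_(u | P u) F u <= \sum_i \sum_(u' | Q i u') F (th i u').
  rewrite pair_big_dep /=.
  under [X in _ <= X]eq_bigl => p do rewrite -(andTb (Q _ _)).
  rewrite [X in _ <= X](partition_big (fun p => th p.1 p.2) predT) //=.
  rewrite big_mkcond /=; apply: leq_sum => u _.
  case: ifP => // /cov [i [u' [Qu <-]]].
  by rewrite (bigD1 (i, u')) /= ?Qu ?eqxx // leq_addr.
have : energy P f <= \sum_i \sum_j cross (Q i) (f \o th i) (Q j) (f \o th j).
  rewrite /energy /cross.
  apply: leq_trans (step _) _; apply: leq_sum => i _.
  rewrite [X in _ <= X]exchange_big /=; apply: leq_sum => u' Qu'.
  exact: leq_trans (step (fun v => nat_of_bool (f (th i u') == f v))) _.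
move=> h; apply: leq_trans h _.
rewrite -(leq_pmul2l (isT : 0 < 2)) big_distrr /=.
under eq_bigr => i _ do rewrite big_distrr /=.
apply: (@leq_trans (\sum_i \sum_j (energy (Q i) (f \o th i) +
   energy (Q j) (f \o th j)))).
  by apply: leq_sum => i _; apply: leq_sum => j _; exact: cross_le.
under eq_bigr => i _ do rewrite big_split sum_nat_const /=.
by rewrite big_split /= sum_nat_const -big_distrr /= addnn mul2n.
Qed.

Lemma energy_cover_max (I U U' : finType) (P : pred U) (f : U -> V)
    (Q : I -> pred U') (th : I -> U' -> U) (B : nat) :
  (forall u, P u -> exists i u', Q i u' /\ th i u' = u) ->
  (forall i, energy (Q i) (f \o th i) <= B) ->
  energy P f <= #|I| ^ 2 * B.
Proof.
move=> cov hB; apply: leq_trans (energy_cover f cov) _.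
rewrite -mulnn -mulnA leq_mul2l; apply/orP; right.
rewrite -sum_nat_const; exact: leq_sum.
Qed.

Lemma energyU (U : finType) (P P' : pred U) (f : U -> V) :
  (forall u, P u || P' u) ->
  energy predT f <= 2 * (energy P f + energy P' f).
Proof.
move=> h.
have := @energy_cover bool U U predT f (fun b => if b then P else P') (fun _ => id).
rewrite card_bool big_bool; apply => u _.
case: (boolP (P u)) => [Pu|Pu]; first by exists true, u.
by exists false, u; split=> //; have := h u; rewrite (negbTE Pu).
Qed.

End Energy.

Lemma energy_le (V V' : eqType) (U : finType) (P : pred U) (f : U -> V)
   (g : U -> V') : (forall u v, P u -> P v -> f u = f v -> g u = g v) ->
  energy P f <= energy P g.
Proof.
move=> h; apply: leq_sum => u Pu; apply: leq_sum => v Pv.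
by case: eqP => // /(h _ _ Pu Pv) ->; rewrite eqxx.
Qed.

Lemma energy_card (V : eqType) (U : finType) (P : pred U) (f : U -> V) :
  energy P f <= #|P| ^ 2.
Proof.
rewrite -mulnn -!sum1_card /energy /cross big_distrl /=.
apply: leq_sum => u Pu; rewrite mul1n; apply: leq_sum => v _.
exact: leq_b1.
Qed.

Lemma cross_pair (V : eqType) (U U' : finType) (P : pred U) (f : U -> V) (Q : pred U')
    (g : U' -> V) :
  cross P f Q g = \sum_(p : U * U' | P p.1 && Q p.2) (f p.1 == g p.2).
Proof. by rewrite /cross pair_big. Qed.

(** * Hoelder's inequality by exchanging variables *)

Section Holder.
Context {V : zmodType} {W X C : finType}.
Variables (PW : pred W) (F : W -> V) (f : C -> X -> V) (n : nat).
Local Open Scope ring_scope.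

Let WX : finType := (W * {ffun 'I_n -> X})%type.
Let PWX : pred WX := fun wx => PW wx.1.

Definition slots (c : {ffun 'I_n -> C}) (wx : WX) : V :=
  F wx.1 + \sum_i f (c i) (wx.2 i).

Lemma slots_const (a : C) (wx : WX) :
  slots [ffun=> a] wx = F wx.1 + \sum_i f a (wx.2 i).
Proof. by congr (_ + _); apply: eq_bigr => i _; rewrite ffunE. Qed.

Definition update (T : Type) (x : {ffun 'I_n -> T}) (j : 'I_n) (v : T) :
  {ffun 'I_n -> T} := [ffun l => if l == j then v else x l].

Let swap (i j : 'I_n) (p : WX * WX) : WX * WX :=
  ((p.1.1, update p.1.2 j (p.2.2 i)), (p.2.1, update p.2.2 i (p.1.2 j))).

Let swapK i j : involutive (swap i j).
Proof.
move=> [[w x] [w' x']]; rewrite /swap /=; congr ((_, _), (_, _)).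
  by apply/ffunP => l; rewrite !ffunE eqxx; case: eqP => // ->.
by apply/ffunP => l; rewrite !ffunE eqxx; case: eqP => // ->.
Qed.

Let rest (c : {ffun 'I_n -> C}) (i j : 'I_n) (wx : WX) : V :=
  F wx.1 + \sum_(l | (l != i) && (l != j)) f (c l) (wx.2 l).

Let slotsE c i j wx : i != j ->
  slots c wx = rest c i j wx + f (c i) (wx.2 i) + f (c j) (wx.2 j).
Proof.
move=> ij; rewrite /slots (bigD1 i) //= (bigD1 j) 1?eq_sym //=.
by rewrite /rest [LHS](AC (1*(1*(1*1))) (((1*4)*2)*3)).
Qed.

Let restx c i j (wx : WX) i' y : (i' == i) || (i' == j) ->
  rest c i j (wx.1, update wx.2 i' y) = rest c i j wx.
Proof.
move=> hi; congr (_ + _); apply: eq_bigr => l' /andP[li lj].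
rewrite !ffunE; case: eqP => e' //; move: hi.
by rewrite -e' (negbTE li) (negbTE lj).
Qed.

Let restc c i j (wx : WX) l d : (l == i) || (l == j) ->
  rest (update c l d) i j wx = rest c i j wx.
Proof.
move=> hi; congr (_ + _); apply: eq_bigr => l' /andP[li lj].
rewrite !ffunE; case: eqP => e' //; move: hi.
by rewrite -e' (negbTE li) (negbTE lj).
Qed.

Let eq_shift (a b a' b' : V) : a - b = a' - b' -> (a == b) = (a' == b').
Proof. by move=> h; rewrite -subr_eq0 h subr_eq0. Qed.

(** In an equation between two tuples, the variable in slot [j] on the left and the one in slot [i]
    on the right are exchanged and sent to the other side. In these two slots the left side [phi]
    then involves [c i] only, and the right side [psi] involves [c j] only. The same move with equal
    slot numbers identifies the energies of [phi] and [psi] with those of the two updated patterns,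
    and [cross_le] concludes. *)
Lemma slots_swap c i j : i != j ->
  (2 * energy PWX (slots c) <= energy PWX (slots (update c j (c i))) +
                         energy PWX (slots (update c i (c j))))%N.
Proof.
move=> ij; have ji : j != i by rewrite eq_sym.
pose phi wx := rest c i j wx + f (c i) (wx.2 i) - f (c i) (wx.2 j).
pose psi wx := rest c i j wx + f (c j) (wx.2 j) - f (c j) (wx.2 i).
have e1 : energy PWX (slots c) = cross PWX phi PWX psi.
  rewrite /energy !cross_pair (reindex_inj (inv_inj (@swapK i j))) /=.
  apply: eq_bigr => -[[w x] [w' x']] _; congr nat_of_bool.
  rewrite /phi /psi !(slotsE _ _ ij) !(@restx _ _ _ (w, x)) ?(@restx _ _ _ (w', x')) ?eqxx ?orbT //=.
  rewrite !ffunE eqxx (negbTE ij) (negbTE ji) eqxx.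
  by apply: eq_shift;
    rewrite !opprD !opprK [LHS](AC (3*3) (1*2*5*4*6*3)) [RHS](AC (3*3) (1*2*3*4*5*6)).
have e2 : energy PWX (slots (update c j (c i))) = energy PWX phi.
  rewrite /energy !cross_pair (reindex_inj (inv_inj (@swapK j j))) /=.
  apply: eq_bigr => -[[w x] [w' x']] _; congr nat_of_bool.
  rewrite /phi !(slotsE _ _ ij) !restc ?(@restx _ _ _ (w, x)) ?(@restx _ _ _ (w', x')) ?eqxx ?orbT //=.
  rewrite !ffunE eqxx (negbTE ij).
  by apply: eq_shift;
    rewrite !opprD !opprK [LHS](AC (3*3) (1*2*3*4*5*6)) [RHS](AC (3*3) (1*2*6*4*5*3)).
have e3 : energy PWX (slots (update c i (c j))) = energy PWX psi.
  rewrite /energy !cross_pair (reindex_inj (inv_inj (@swapK i i))) /=.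
  apply: eq_bigr => -[[w x] [w' x']] _; congr nat_of_bool.
  rewrite /psi !(slotsE _ _ ij) !restc ?(@restx _ _ _ (w, x)) ?(@restx _ _ _ (w', x')) ?eqxx ?orbT //=.
  rewrite !ffunE eqxx (negbTE ji).
  by apply: eq_shift;
    rewrite !opprD !opprK [LHS](AC (3*3) (1*2*3*4*5*6)) [RHS](AC (3*3) (1*6*2*4*3*5)).
by rewrite e1 e2 e3; exact: cross_le.
Qed.

(* Hoelder's inequality for energies: a pattern maximising the energy can be
   made constant one slot at a time, since [slots_swap] keeps it maximal. *)
Lemma energy_slots_le (B : nat) : (0 < n)%N ->
  (forall a : C, energy PWX (slots [ffun=> a]) <= B)%N ->
  forall c, (energy PWX (slots c) <= B)%N.
Proof.
move=> n0 hB c0.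
pose i0 := Ordinal n0.
pose M := (\max_c energy PWX (slots c))%N.
have leM c : (energy PWX (slots c) <= M)%N by exact: (leq_bigmax c).
suff h m : (m <= n)%N -> exists2 c, energy PWX (slots c) = M &
    forall i : 'I_n, (i < m)%N -> c i = c i0.
  have [c cM ce] := h n (leqnn n).
  apply: leq_trans (leM c0) _; rewrite -cM.
  suff -> : c = [ffun=> c i0] by exact: hB.
  by apply/ffunP => i; rewrite ffunE ce.
elim: m => [_|m IH mn].
  have [|c cM] := @bigop.eq_bigmax {ffun 'I_n -> C} (fun c => energy PWX (slots c)).
    by apply/card_gt0P; exists c0.
  by exists c.
have [c cM ce] := IH (ltnW mn).
pose j := Ordinal mn.
have [ij|ij] := eqVneq i0 j.
  exists c => // i; rewrite ltnS => im; congr (c _); apply: val_inj => /=.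
  by move/(congr1 val): ij => /=; lia.
exists (update c j (c i0)).
  (* Both updated patterns have energy at most [M], and the two energies sum to at least [2 * M];
     hence both equal [M]. *)
  have := slots_swap c ij; rewrite cM.
  by have := leM (update c j (c i0)); have := leM (update c i0 (c j)); lia.
move=> i im; rewrite !ffunE (negbTE ij).
case: eqP => // /eqP ne; rewrite ce //.
by move: ne; rewrite -val_eqE /=; lia.
Qed.

End Holder.

(** * Newton's identities *)

Lemma fact_dvd (m n : nat) : m <= n -> m`! %| n`!.
Proof.
move=> mn; have := ffact_fact (leq_subr m n); rewrite subKn // => <-.
exact: dvdn_mull.
Qed.

Section Newton.
Local Open Scope ring_scope.

Lemma deriv_prod_seq (R : comNzRingType) (I : eqType) (r : seq I) (F : I -> {poly R}) :
  uniq r -> (\prod_(i <- r) F i)^`() =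
  \sum_(i <- r) (F i)^`() * \prod_(j <- r | j != i) F j.
Proof.
elim: r => [|a r IH] /=; first by rewrite !big_nil -[1]/(1%:P) derivC.
case/andP=> ar ur; rewrite !big_cons derivM IH // eqxx /=.
have -> : \prod_(j <- r | j != a) F j = \prod_(j <- r) F j.
  rewrite big_seq_cond [RHS]big_seq; apply: eq_bigl => j.
  by case: (boolP (j \in r)) => //= jr; apply/eqP => e; rewrite -e jr in ar.
congr (_ + _); rewrite big_distrr /= big_seq [RHS]big_seq.
apply: eq_bigr => i ir; rewrite big_cons.
have -> : a != i by apply/eqP => e; rewrite e ir in ar.
by rewrite mulrCA.
Qed.

(** Newton's identities in a single formula, the power sum of exponent 0 being the term [l = 0].
    Both sides are the coefficient of degree [c] in X P': the derivative of P is the sum of the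
    quotients [Q i] of P by X - x i, and synthetic division gives the coefficients of X times a
    quotient as the telescoping sums in [tel]. *)
Lemma newton_coef (R : comNzRingType) (k : nat) (x : 'I_k -> R) (c : nat) :
  let P := \prod_i ('X - (x i)%:P) in
  P`_c *+ c = \sum_(l < k.+1) (\sum_i x i ^+ l) * P`_(c + l).
Proof.
move=> P.
pose Q i := \prod_(j | j != i) ('X - (x j)%:P).
have PQ i : P = ('X - (x i)%:P) * Q i by rewrite /P (bigD1 i).
have sQ i : (size (Q i) <= k)%N.
  apply: leq_trans (size_poly_prod_leq _ _) _.
  rewrite (eq_bigr (fun=> 2%N)) => [|j _]; last by rewrite size_XsubC.
  rewrite sum_nat_const.
  have -> : #|[pred j : 'I_k | j != i]| = k.-1 by rewrite cardC1 card_ord.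
  by have := ltn_ord i; lia.
have coefP i m : P`_m = ('X * Q i)`_m - x i * (Q i)`_m.
  by rewrite (PQ i) mulrBl coefB coefCM.
have tel i m : \sum_(l < m.+1) x i ^+ l * P`_(c + l) =
    ('X * Q i)`_c - x i ^+ m.+1 * (Q i)`_(c + m).
  elim: m => [|m IH]; first by rewrite big_ord1 expr0 mul1r addn0 expr1 (coefP i).
  rewrite big_ord_recr /= IH (coefP i) addnS [X in x i ^+ m.+1 * (X - _)]coefXM /=.
  rewrite !exprS;
    move: (x i ^+ m) (Q i)`_(c + m) (Q i)`_((c + m).+1) ('X * Q i)`_c => a b d e; ring.
rewrite (eq_bigr (fun l : 'I_k.+1 => \sum_i x i ^+ l * P`_(c + l))); last first.
  by move=> l _; rewrite big_distrl.
rewrite exchange_big /= (eq_bigr (fun i => ('X * Q i)`_c)); last first.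
  move=> i _; rewrite tel [(Q i)`_(c + k)]nth_default ?mulr0 ?subr0 //.
  by apply: leq_trans (sQ i) _; rewrite leq_addl.
have dP : P^`() = \sum_i Q i.
  rewrite /P deriv_prod_seq ?index_enum_uniq //; apply: eq_bigr => i _.
  by rewrite derivXsubC mul1r.
rewrite -coef_sum -big_distrr -dP coefXM.
by case: c {tel} => [|c] /=; rewrite ?mulr0n // coef_deriv.
Qed.

Lemma size_prod_XsubC_ord (R : idomainType) (k : nat) (x : 'I_k -> R) :
  size (\prod_i ('X - (x i)%:P)) = k.+1.
Proof.
rewrite size_prod => [|i _]; last by rewrite polyXsubC_eq0.
under eq_bigr => i _ do rewrite size_XsubC.
by rewrite sum_nat_const card_ord; lia.
Qed.

(** Recovering the coefficient of degree [k - j] from Newton's identities requires a division by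
    [j]. Carrying the factor j! along replaces these divisions, so that the argument works modulo
    any [q]. *)
Lemma power_sums_prod (k : nat) (q : int) (x y : 'I_k -> int) :
  (forall l, (0 < l <= k)%N -> (q %| \sum_i x i ^+ l - \sum_i y i ^+ l)%Z) ->
  forall z, (q %| (k`!)%:Z * (\prod_i (z - x i) - \prod_i (z - y i)))%Z.
Proof.
move=> hp z.
pose P := \prod_i ('X - (x i)%:P); pose Q := \prod_i ('X - (y i)%:P).
have sP : size P = k.+1 by exact: size_prod_XsubC_ord.
have sQ : size Q = k.+1 by exact: size_prod_XsubC_ord.
have Pk : P`_k = 1.
  by have := monic_prod_XsubC (index_enum 'I_k) predT x => /monicP;
    rewrite lead_coefE -/P sP.
have Qk : Q`_k = 1.
  by have := monic_prod_XsubC (index_enum 'I_k) predT y => /monicP;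
    rewrite lead_coefE -/Q sQ.
have d0 c : (k <= c)%N -> P`_c - Q`_c = 0.
  rewrite leq_eqVlt => /predU1P[<-|kc]; first by rewrite Pk Qk subrr.
  by rewrite !nth_default ?subrr ?sP ?sQ.
have rec j : (j <= k)%N -> (q %| (j`!)%:Z * (P`_(k - j) - Q`_(k - j)))%Z.
  elim/ltn_ind: j => j IH jk.
  case: j => [|j] in IH jk *; first by rewrite subn0 Pk Qk subrr mulr0 dvdz0.
  set c := (k - j.+1)%N.
  have E : (j.+1)%:Z * (P`_c - Q`_c) =
      - \sum_(l < k) ((\sum_i x i ^+ l.+1) * (P`_(c + l.+1) - Q`_(c + l.+1)) +
      (\sum_i x i ^+ l.+1 - \sum_i y i ^+ l.+1) * Q`_(c + l.+1)).
    have := newton_coef x c; have := newton_coef y c.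
    cbv zeta; rewrite -/P -/Q !big_ord_recl /= !addn0.
    have S0 (u : 'I_k -> int) : \sum_i u i ^+ 0 = k%:Z.
      by under eq_bigr => i _ do rewrite expr0; rewrite sumr_const card_ord -natz.
    rewrite !S0.
    have -> : \sum_(l < k) ((\sum_i x i ^+ l.+1) * (P`_(c + l.+1) - Q`_(c + l.+1)) +
      (\sum_i x i ^+ l.+1 - \sum_i y i ^+ l.+1) * Q`_(c + l.+1)) =
      \sum_(l < k) (\sum_i x i ^+ l.+1) * P`_(c + l.+1) -
      \sum_(l < k) (\sum_i y i ^+ l.+1) * Q`_(c + l.+1).
      by rewrite -sumrB; apply: eq_bigr => l _; ring.
    have B0 (u : 'I_k -> int) (v : {poly int}) :
        \sum_(i < k) (\sum_i0 u i0 ^+ bump 0 i) * v`_(c + bump 0 i) =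
        \sum_(l < k) (\sum_i u i ^+ l.+1) * v`_(c + l.+1).
      by apply: eq_bigr => l _; rewrite /bump leq0n add1n.
    have M (u : int) (m : nat) : u *+ m = m%:Z * u by rewrite -mulr_natl natz.
    rewrite !B0 !M => e1 e2.
    have kc : k%:Z = c%:Z + (j.+1)%:Z by rewrite -PoszD /c subnK.
    move: e1 e2; rewrite kc.
    move: (\sum_(l < k) _ * P`_(c + l.+1)) (\sum_(l < k) _ * Q`_(c + l.+1)) => a b.
    move: P`_c Q`_c c%:Z (j.+1)%:Z => u v m n e1 e2.
    have -> : n * (u - v) = (m + n) * u - m * u - ((m + n) * v - m * v) by ring.
    by rewrite e1 e2; ring.
  have -> : (j.+1)`!%:Z * (P`_c - Q`_c) = (j`!)%:Z * ((j.+1)%:Z * (P`_c - Q`_c)).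
    by rewrite factS PoszM; move: (Posz j`!) (Posz j.+1) => a b; ring.
  rewrite E mulrN rpredN big_distrr /=.
  apply: rpred_sum => l _; rewrite mulrDr; apply: rpredD; last first.
    by rewrite dvdz_mull // dvdz_mulr // hp //= ltn_ord.
  rewrite mulrCA dvdz_mull //.
  have [lj|lj] := leqP l j; last by rewrite d0 ?mulr0 ?dvdz0 // /c; lia.
  have -> : (c + l.+1 = k - (j - l))%N by rewrite /c; lia.
  have := IH (j - l)%N; rewrite ltnS leq_subr => /(_ isT) H.
  have /dvdnP[m ->] := fact_dvd (leq_subr l j).
  by rewrite PoszM -mulrA dvdz_mull // H //; lia.
have recc c : (q %| (k`!)%:Z * (P`_c - Q`_c))%Z.
  have [kc|ck] := leqP k c; first by rewrite d0 // mulr0 dvdz0.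
  have := rec (k - c)%N; rewrite leq_subr subKn; last exact: ltnW.
  have /dvdnP[m ->] := fact_dvd (leq_subr c k).
  by move=> /(_ isT) H; rewrite PoszM -mulrA dvdz_mull.
have -> : \prod_i (z - x i) = P.[z].
  by rewrite /P horner_prod; apply: eq_bigr => i _; rewrite !hornerE.
have -> : \prod_i (z - y i) = Q.[z].
  by rewrite /Q horner_prod; apply: eq_bigr => i _; rewrite !hornerE.
rewrite !horner_coef sP sQ -sumrB big_distrr /=; apply: rpred_sum => i _.
by rewrite -mulrBl mulrA dvdz_mulr.
Qed.

End Newton.

Lemma logn_prod (p : nat) (I : Type) (r : seq I) (P : pred I) (F : I -> nat) :
  (forall i, P i -> 0 < F i) ->
  logn p (\prod_(i <- r | P i) F i) = \sum_(i <- r | P i) logn p (F i).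
Proof.
move=> F0; apply: (@big_morph_in _ _ (mem [pred m | 0 < m])) => //.
- by move=> m n; rewrite !inE muln_gt0 => -> ->.
- by move=> m n; rewrite !inE => m0 n0; exact: lognM.
- exact: logn1.
Qed.

Lemma logn2_fact (k : nat) : logn 2 k`! <= k * k.
Proof.
elim: k => [|k IH]; first by rewrite fact0 logn1.
by rewrite factS lognM ?fact_gt0 //; have := @ltn_logl 2 k.+1 isT; lia.
Qed.

(** Modulo 2^n, the product of k! and all the [x l - y i] vanishes. At most one factor has valuation
    above [h], since two of them would make two of the [y] congruent modulo 2^h. The factor of
    largest valuation thus carries everything except (k - 1) h and the valuation of k!, which is at
    most [k * k]. *)
Lemma close_root (k n h : nat) (x y : 'I_k -> int) :
  (forall l, 0 < l <= k ->
     ((2 ^ n)%N%:Z %| (\sum_i x i ^+ l - \sum_i y i ^+ l)%R)%Z) ->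
  (forall i j, ((2 ^ h)%N%:Z %| (y i - y j)%R)%Z -> i = j) ->
  forall l, exists i, ((2 ^ (n - (k * k + (k.-1) * h)))%N%:Z %| (x l - y i)%R)%Z.
Proof.
move=> hp hy l.
pose z i := `|(x l - y i)%R|%N.
(* An exact root is set apart because [logn] is 0 at 0 by convention. *)
have [/existsP[i /eqP e]|/existsPn ne] := boolP [exists i, x l == y i].
  by exists i; rewrite e subrr dvdz0.
have z0 i : 0 < z i by rewrite absz_gt0 subr_eq0.
have := power_sums_prod hp (x l).
have -> : (\prod_i (x l - x i) = 0)%R.
  by apply/eqP; rewrite prodf_seq_eq0; apply/hasP; exists l;
    rewrite ?mem_index_enum ?subrr.
rewrite sub0r mulrN rpredN dvdzE abszM.
have -> : `|(\prod_i (x l - y i))%R|%N = \prod_i z i.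
  by apply: (big_morph absz abszM).
rewrite pfactor_dvdn // ?muln_gt0 ?fact_gt0 ?prodn_gt0 //.
rewrite lognM ?fact_gt0 ?prodn_gt0 //.
rewrite logn_prod // => hn.
case: (arg_maxnP (fun i => logn 2 (z i)) (isT : xpredT l)) => i _ imax.
exists i; rewrite dvdzE pfactor_dvdn ?z0 //.
have small j : j != i -> logn 2 (z j) <= h.
  move=> ji; rewrite leqNgt; apply/negP => hj.
  have hd m : h < logn 2 (z m) -> ((2 ^ h)%N%:Z %| (x l - y m)%R)%Z.
    by move=> hm; rewrite dvdzE pfactor_dvdn ?z0 // ltnW.
  have hi := leq_trans hj (imax j isT).
  move/eqP: ji; apply; apply: hy.
  have -> : (y j - y i = (x l - y i) - (x l - y j))%R by ring.
  by apply: rpredB; apply: hd.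
have : \sum_i logn 2 (z i) <= logn 2 (z i) + k.-1 * h.
  rewrite (bigD1 i) //= leq_add2l.
  apply: (@leq_trans (\sum_(j | j != i) h)); first exact: leq_sum.
  by rewrite sum_nat_const cardC1 card_ord.
move=> hs; rewrite -/(z i) leq_subLR; apply: leq_trans hn _.
by rewrite -addnA [_ * h + _]addnC; apply: leq_add => //; exact: logn2_fact.
Qed.

(** * Vinogradov's mean value theorem *)

Lemma energy_inj (V V' : eqType) (U U' : finType) (P : pred U) (Q : pred U')
   (f : U -> V) (g : U' -> V') (phi : U -> U') :
  injective phi -> (forall u, P u -> Q (phi u)) ->
  (forall u v, P u -> P v -> f u = f v -> g (phi u) = g (phi v)) ->
  energy P f <= energy Q g.
Proof.
move=> inj PQ fg.
have step (F : U' -> nat) : \sum_(u | P u) F (phi u) <= \sum_(u | Q u) F u.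
  rewrite [X in _ <= X](big_mkcond) /= -(big_imset F (h := phi) (A := P)) /=;
    last first.
    by move=> u v _ _; exact: inj.
  rewrite [X in X <= _]big_mkcond /=; apply: leq_sum => u _.
  by case: imsetP => // -[v /= Pv ->]; rewrite PQ.
apply: leq_trans (step (fun u' => \sum_(v | Q v) (g u' == g v))).
apply: leq_sum => u Pu.
apply: leq_trans (step (fun v' => nat_of_bool (g (phi u) == g v'))).
apply: leq_sum => v Pv; case: eqP => // /(fg _ _ Pu Pv) ->.
by rewrite eqxx.
Qed.

Lemma card_family_prod (aT rT : finType) (F : aT -> pred rT) :
  #|family F| = \prod_x #|F x|.
Proof.
rewrite -sum1_card; under [RHS]eq_bigr => x _ do rewrite -sum1_card.
by rewrite bigA_distr_big_dep; apply: eq_bigr => f _; rewrite big1.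
Qed.

Lemma card_residue (X m M c : nat) : 0 < m -> X <= m * M ->
  #|[pred v : 'I_X | v == c %[mod m]]| <= M.
Proof.
move=> m0 XM.
have lt (v : 'I_X) : v %/ m < M by rewrite ltn_divLR // mulnC; have := ltn_ord v; lia.
rewrite -[M in X in _ <= X]card_ord.
rewrite -(@card_in_imset _ _ (fun v => Ordinal (lt v))) ?max_card //.
move=> u v; rewrite !inE => /eqP uc /eqP vc /(congr1 val) /= e.
by apply: val_inj; rewrite /= (divn_eq u m) (divn_eq v m) e uc vc.
Qed.

(** * Power sums and their invariance under affine maps *)

Section PowerSums.
Variable k : nat.
Local Open Scope ring_scope.

Definition powers (x : int) : {ffun 'I_k -> int} := [ffun j : 'I_k => x ^+ j.+1].

Lemma sum_powersE (I : finType) (x : I -> int) (j : 'I_k) :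
  (\sum_i powers (x i)) j = \sum_i x i ^+ j.+1.
Proof. by rewrite sum_ffunE; apply: eq_bigr => i _; rewrite ffunE. Qed.

(** Translation-dilation invariance of Vinogradov's system: the binomial expansion involves only
    power sums of exponents up to [k], and those of exponent 0 agree because both families have the
    same index set. *)
Lemma sum_powers_affine (I : finType) (x y : I -> int) (a b : int) :
  \sum_i powers (x i) = \sum_i powers (y i) ->
  \sum_i powers (a * x i + b) = \sum_i powers (a * y i + b).
Proof.
move=> e.
have E m : (m <= k)%N -> \sum_i x i ^+ m = \sum_i y i ^+ m.
  case: m => [_|m mk]; first by apply: eq_bigr => i _; rewrite !expr0.
  by have := congr1 (fun f : {ffun 'I_k -> int} => f (Ordinal mk)) e;
    rewrite !sum_powersE.
apply/ffunP => j; rewrite !sum_powersE.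
under eq_bigr => i _ do rewrite exprDn.
under [RHS]eq_bigr => i _ do rewrite exprDn.
rewrite exchange_big [RHS]exchange_big; apply: eq_bigr => m _ /=.
have mk : (j.+1 - m <= k)%N by have := ltn_ord j; lia.
rewrite !sumrMnl; congr (_ *+ _); rewrite -!big_distrl /=; congr (_ * _).
under eq_bigr => i _ do rewrite exprMn.
under [RHS]eq_bigr => i _ do rewrite exprMn.
by rewrite -!big_distrr /= E.
Qed.

Lemma sum_powers_scale (I : finType) (x y : I -> int) (a b : int) : a != 0 ->
  \sum_i powers (a * x i + b) = \sum_i powers (a * y i + b) ->
  \sum_i powers (x i) = \sum_i powers (y i).
Proof.
move=> a0 /(@sum_powers_affine _ _ _ 1 (- b)).
under eq_bigr => i _ do rewrite mul1r addrK.
under [RHS]eq_bigr => i _ do rewrite mul1r addrK.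
move=> e; apply/ffunP => j; have := congr1 (fun f : {ffun 'I_k -> int} => f j) e.
rewrite !sum_powersE.
under eq_bigr => i _ do rewrite exprMn.
under [RHS]eq_bigr => i _ do rewrite exprMn.
by rewrite -!big_distrr /= => /mulfI -> //; rewrite expf_neq0.
Qed.

End PowerSums.

(* The number of solutions of Vinogradov's system of degree k in 2s variables
   ranging over [0, X). *)
Definition vinogradov (k s X : nat) : nat :=
  energy predT (fun x : {ffun 'I_s -> 'I_X} => (\sum_i powers k (x i)%:Z)%R).

(** * Tuples meeting few or many residue classes *)

Lemma ltn_mix (H X : nat) (c : 'I_H) (u : 'I_X) : H * u + c < H * X.
Proof. by have := ltn_ord c; have := ltn_ord u; nia. Qed.

Definition mix (H X : nat) (c : 'I_H) (u : 'I_X) : 'I_(H * X) :=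
  Ordinal (ltn_mix c u).

Lemma mix_ffun_surj (n H X : nat) (x : {ffun 'I_n -> 'I_(H * X)}) :
  exists (c : {ffun 'I_n -> 'I_H}) (u : {ffun 'I_n -> 'I_X}),
    [ffun i => mix (c i) (u i)] = x.
Proof.
have H0 (i : 'I_n) : 0 < H by case: H x => [|//] x; have := ltn_ord (x i).
have h (i : 'I_n) : {cu : 'I_H * 'I_X | mix cu.1 cu.2 = x i}.
  have cH : x i %% H < H by rewrite ltn_mod (H0 i).
  have uX : x i %/ H < X by rewrite ltn_divLR ?(H0 i) // [X * H]mulnC.
  exists (Ordinal cH, Ordinal uX); apply: val_inj => /=.
  by rewrite mulnC -divn_eq.
exists [ffun i => (sval (h i)).1], [ffun i => (sval (h i)).2].
by apply/ffunP => i; rewrite !ffunE; case: (h i).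
Qed.

Lemma vinogradov_class (k n p X : nat) (c : int) : 0 < p ->
  energy predT (fun u : {ffun 'I_n -> 'I_X} => (\sum_i powers k (p%:Z * (u i)%:Z + c))%R)
  <= vinogradov k n X.
Proof.
move=> p0; apply: energy_le => u v _ _; apply: sum_powers_scale.
by case: p p0.
Qed.

(** Choosing the classes [d] and the assignment [e] of a class to each variable costs
    [H ^ k * k ^ n], squared by [energy_cover_max]. For fixed classes, [energy_slots_le] reduces to
    all variables lying in one class, where the affine invariance gives back the same system on the
    range [X]. *)
Lemma energy_few_classes (k n H X : nat) : 0 < H -> 0 < n ->
  energy (fun x : {ffun 'I_n -> 'I_(H * X)} =>
      [exists d : {ffun 'I_k -> 'I_H}, exists e : {ffun 'I_n -> 'I_k},
         [forall i, (x i %% H == d (e i))%N]])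
    (fun x => (\sum_i powers k (x i)%:Z)%R)
  <= (H ^ k * k ^ n) ^ 2 * vinogradov k n X.
Proof.
move=> H0 n0.
pose I : finType := ({ffun 'I_k -> 'I_H} * {ffun 'I_n -> 'I_k})%type.
have -> : H ^ k * k ^ n = #|I| by rewrite card_prod !card_ffun !card_ord.
apply: (@energy_cover_max _ I _ {ffun 'I_n -> 'I_X} _ _ (fun _ => predT)
  (fun de u => [ffun i => mix (de.1 (de.2 i)) (u i)])).
  move=> x /existsP[d /existsP[e /forallP h]].
  have [c [u xE]] := mix_ffun_surj x.
  exists (d, e), u; split=> //; rewrite -xE; apply/ffunP => i; rewrite !ffunE /=.
  have := h i; rewrite -xE ffunE /= mulnC modnMDl modn_small ?ltn_ord // => /eqP ci.
  by congr mix; exact: val_inj.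
move=> [d e] /=.
pose f (c : 'I_H) (u : 'I_X) : {ffun 'I_k -> int} := powers k (H%:Z * u%:Z + c%:Z)%R.
have hc a : energy (fun wx : unit * {ffun 'I_n -> 'I_X} => true)
    (slots (fun _ : unit => 0%R) f [ffun=> a]) <= vinogradov k n X.
  apply: leq_trans (vinogradov_class k n X a%:Z H0).
  apply: (energy_inj (phi := snd)) => // [[[] u] [[] v] /= -> //|].
  move=> [[] u] [[] v] _ _; rewrite /slots /= !add0r.
  by under eq_bigr do rewrite ffunE; under [in X in _ = X -> _]eq_bigr do rewrite ffunE.
have := energy_slots_le (PW := predT) (F := fun _ : unit => 0%R) n0 hc [ffun i => d (e i)].
apply: leq_trans.
apply: (energy_inj (phi := fun u => (tt, u))) => // [u v [] //|].
move=> u v _ _; rewrite /slots /= !add0r.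
suff E (w : {ffun 'I_n -> 'I_X}) :
  (\sum_i powers k (nat_of_ord ([ffun i0 => mix (d (e i0)) (w i0)] i))%:Z =
   \sum_i f ([ffun i0 => d (e i0)] i) (w i))%R by rewrite !E.
by apply: eq_bigr => i _; rewrite !ffunE /f /= PoszD PoszM.
Qed.

Definition spaced (k H X : nat) (w : {ffun 'I_k -> 'I_X}) : bool :=
  [forall i, forall j, (w i == w j %[mod H]) ==> (i == j)].

Definition few_classes (k n H X : nat) (x : {ffun 'I_n -> 'I_X}) : bool :=
  [exists d : {ffun 'I_k -> 'I_H}, exists e : {ffun 'I_n -> 'I_k},
         [forall i, (x i %% H == d (e i))%N]].

(** The permutation brings [k] pairwise incongruent entries to the front, where Linnik's lemma can
    be applied to them. *)
Definition many_classes (k s H X : nat) (x : {ffun 'I_(k + s) -> 'I_X}) : bool :=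
  [exists sg : 'S_(k + s), spaced H [ffun i => x (sg (lshift s i))]].

Lemma few_or_many (k s H X : nat) (x : {ffun 'I_(k + s) -> 'I_X}) : 0 < H ->
  few_classes k H x || many_classes H x.
Proof.
move=> H0; pose t := [tuple (x i %% H)%N | i < k + s].
have xt i : (x i %% H \in undup t)%N.
  by rewrite mem_undup; apply/tnthP; exists i; rewrite tnth_mktuple.
have [sk|ks] := leqP (size (undup t)) k; apply/orP; [left|right].
  have ei i : index (x i %% H)%N (undup t) < k.
    by apply: leq_trans sk; rewrite index_mem.
  have di (a : 'I_k) : nth 0 (undup t) a %% H < H by rewrite ltn_mod.
  apply/existsP; exists [ffun a => Ordinal (di a)].
  apply/existsP; exists [ffun i => Ordinal (ei i)].
  by apply/forallP => i; rewrite !ffunE /= nth_index // modn_mod.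
have : subseq (take k (undup t)) t by apply: subseq_trans (take_subseq _ _) (undup_subseq t).
case/perm_to_subseq => s3 pe.
have su : size (take k (undup t)) = k by rewrite size_takel // ltnW.
have sz : size (take k (undup t) ++ s3) == k + s.
  by rewrite -(perm_size pe) size_tuple.
have /tuple_permP[sg e] : perm_eq (Tuple sz) t by rewrite perm_sym.
apply/existsP; exists sg; apply/forallP => i; apply/forallP => j; apply/implyP.
have E (a : 'I_k) : (x (sg (lshift s a)) %% H = nth 0 (take k (undup t)) a)%N.
  have := congr1 (fun l => nth 0 l a) e; rewrite /= nth_cat su ltn_ord => ->.
  rewrite (_ : (a : nat) = lshift s a :> nat) //.
  by rewrite nth_mktuple tnth_mktuple.
rewrite !ffunE !E nth_uniq ?su ?take_uniq ?undup_uniq //.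
Qed.

Lemma energy_many_classes (k s H X : nat) :
  energy (@many_classes k s H X) (fun x => (\sum_i powers k (x i)%:Z)%R) <=
  ((k + s)`!) ^ 2 *
  energy (fun wu : {ffun 'I_k -> 'I_X} * {ffun 'I_s -> 'I_X} => spaced H wu.1)
    (fun wu => (\sum_i powers k (wu.1 i)%:Z + \sum_i powers k (wu.2 i)%:Z)%R).
Proof.
have -> : (k + s)`! = #|{perm 'I_(k + s)}| by rewrite card_Sn.
pose th (sg : 'S_(k + s)) (wu : {ffun 'I_k -> 'I_X} * {ffun 'I_s -> 'I_X}) :=
  [ffun i => match fintype.split ((sg^-1)%g i) with inl a => wu.1 a | inr b => wu.2 b end].
apply: (@energy_cover_max _ _ _ _ _ _ (fun _ wu => spaced H wu.1) th).
  move=> x /existsP[sg sp].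
  exists sg, ([ffun i => x (sg (lshift s i))], [ffun i => x (sg (rshift k i))]).
  split=> //; apply/ffunP => i; rewrite ffunE.
  have {2}-> : i = sg (unsplit (fintype.split ((sg^-1)%g i))) by rewrite splitK permKV.
  by case: (fintype.split _) => a; rewrite /= ffunE.
move=> sg; apply: energy_le => -[w u] [w' u'] _ _.
suff E (v : {ffun 'I_k -> 'I_X}) (y : {ffun 'I_s -> 'I_X}) :
  (\sum_i powers k (th sg (v, y) i)%:Z = \sum_i powers k (v i)%:Z + \sum_i powers k (y i)%:Z)%R.
  by rewrite /= !E.
rewrite (reindex_perm sg) big_split_ord /=; congr (_ + _)%R; apply: eq_bigr => i _.
  by rewrite ffunE permK (unsplitK (inl i)).
by rewrite ffunE permK (unsplitK (inr i)).
Qed.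

Lemma big_fst (A B : finType) (P : pred A) (G : A * B -> nat) :
  \sum_(p : A * B | P p.1) G p = \sum_(a | P a) \sum_b G (a, b).
Proof. by rewrite pair_big /=; apply: eq_big => [[a b]|[a b]] //=; rewrite ?andbT. Qed.

Section Spaced.
Variables k s H p X Lin : nat.
Hypotheses (p0 : 0 < p) (s0 : 0 < s).
Let W : finType := {ffun 'I_k -> 'I_(p * X)}.

Definition congruent (d : int) (lam : {ffun 'I_k -> int}) (w : W) : bool :=
  [forall j : 'I_k,
    ((p%:Z ^+ j.+1)%R %| (\sum_i ((w i)%:Z - d) ^+ j.+1 - lam j)%R)%Z].

Hypothesis LinP : forall d lam,
  #|[pred w : W | spaced H w && congruent d lam w]| <= Lin.

(** Subtracting [a] from all variables turns the last [s] of them into multiples of [p], so the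
    power sums of degree j + 1 of the first [k] variables on the two sides are congruent modulo
    p^(j+1). Each [w'] therefore admits at most [Lin] values of [w]. For a fixed pair, what remains
    is a shifted Vinogradov system in [u] and [u'], which [cross_max] bounds by the unshifted
    one. *)
Lemma energy_spaced_class (a : 'I_p) :
  energy (fun wx : W * {ffun 'I_s -> 'I_X} => spaced H wx.1)
    (slots (fun w : W => (\sum_i powers k (w i)%:Z)%R)
       (fun (c : 'I_p) (u : 'I_X) => powers k (p%:Z * u%:Z + c%:Z)%R) [ffun=> a])
  <= (p * X) ^ k * Lin * vinogradov k s X.
Proof.
rewrite /energy /cross big_fst.
apply: (@leq_trans (\sum_(w : W | spaced H w) \sum_(w' : W | spaced H w')
  congruent (Posz a) [ffun j : 'I_k => (\sum_i ((w' i)%:Z - a%:Z) ^+ j.+1)%R] w * vinogradov k s X)).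
  apply: leq_sum => w _.
  under eq_bigr => u _ do rewrite big_fst.
  rewrite exchange_big /=; apply: leq_sum => w' _.
  pose dl : {ffun 'I_k -> int} := (\sum_i powers k ((w' i)%:Z - a%:Z)%R -
    \sum_i powers k ((w i)%:Z - a%:Z)%R)%R.
  pose g (u : {ffun 'I_s -> 'I_X}) : {ffun 'I_k -> int} :=
    (\sum_i powers k (p%:Z * (u i)%:Z))%R.
  pose g' u := (g u + dl)%R.
  have Eg : energy predT g <= vinogradov k s X.
    apply: leq_trans (vinogradov_class k s X 0 p0).
    by apply: energy_le => u v _ _; under [in X in _ -> X]eq_bigr do rewrite addr0;
       under [in X in _ -> _ = X]eq_bigr do rewrite addr0.
  have Eg' : energy predT g' <= vinogradov k s X.
    by apply: leq_trans Eg; apply: energy_le => u v _ _ /addIr.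
  have key u u' : slots (fun w : W => (\sum_i powers k (w i)%:Z)%R)
       (fun (c : 'I_p) (u : 'I_X) => powers k (p%:Z * u%:Z + c%:Z)%R) [ffun=> a] (w, u) =
     slots (fun w : W => (\sum_i powers k (w i)%:Z)%R)
       (fun (c : 'I_p) (u : 'I_X) => powers k (p%:Z * u%:Z + c%:Z)%R) [ffun=> a] (w', u') ->
     g u = g' u'.
    rewrite !slots_const /= => e.
    pose y (w : W) (u : {ffun 'I_s -> 'I_X}) (l : 'I_k + 'I_s) : int :=
      match l with inl i => Posz (w i) | inr i => (p%:Z * (u i)%:Z + a%:Z)%R end.
    have : (\sum_l powers k (y w u l) = \sum_l powers k (y w' u' l))%R.
      by rewrite !big_sumType.
    move/(@sum_powers_affine _ _ _ _ 1 (- a%:Z)%R); rewrite !big_sumType /= .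
    have m1 (v : W) : (\sum_i powers k (1 * (v i)%:Z - a%:Z) = \sum_i powers k ((v i)%:Z - a%:Z))%R.
      by under eq_bigr do rewrite mul1r.
    have m2 (v : {ffun 'I_s -> 'I_X}) : (\sum_i powers k (1 * (p%:Z * (v i)%:Z + a%:Z) - a%:Z) =
        \sum_i powers k (p%:Z * (v i)%:Z))%R.
      by under eq_bigr do rewrite mul1r addrK.
    rewrite !m1 !m2 /g' /dl /g => E; rewrite addrA [X in (_ = X - _)%R]addrC -E.
    by rewrite addrAC subrr add0r.
  apply: (@leq_trans (congruent (Posz a) [ffun j : 'I_k => (\sum_i ((w' i)%:Z - a%:Z) ^+ j.+1)%R] w
     * cross predT g predT g')); last first.
    by rewrite leq_mul2l cross_max ?orbT.
  rewrite /cross big_distrr; apply: leq_sum => u _.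
  rewrite big_distrr; apply: leq_sum => u' _ /=.
  case: eqP => // /key e; rewrite e eqxx muln1.
  suff -> : congruent (Posz a) [ffun j : 'I_k => (\sum_i ((w' i)%:Z - a%:Z) ^+ j.+1)%R] w by [].
  apply/forallP => j; rewrite ffunE.
  have := congr1 (fun f : {ffun 'I_k -> int} => f j) e; rewrite /g' /dl /g.
  rewrite !ffunE !sum_powersE.
  under eq_bigr => i _ do rewrite exprMn.
  under [X in (_ = X + _)%R -> _]eq_bigr => i _ do rewrite exprMn.
  rewrite -!big_distrr /=.
  set A := (\sum_i (_ - _) ^+ _)%R; set B := (\sum_i (_ - _) ^+ _)%R.
  move=> E';
    have -> : (B - A = p%:Z ^+ j.+1 * (\sum_i (u' i)%:Z ^+ j.+1 - \sum_i (u i)%:Z ^+ j.+1))%R.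
    by rewrite mulrBr E'; ring.
  by rewrite dvdz_mulr.
rewrite exchange_big /=.
apply: (@leq_trans (\sum_(w' : W | spaced H w') Lin * vinogradov k s X)).
  apply: leq_sum => w' _; rewrite -big_distrl /= leq_mul2r; apply/orP; right.
  rewrite -big_mkcondr /= sum1_card.
  exact: LinP.
rewrite sum_nat_const -mulnA leq_mul2r; apply/orP; right.
by apply: leq_trans (max_card _) _; rewrite card_ffun !card_ord.
Qed.

Lemma energy_spaced :
  energy (fun wu : W * {ffun 'I_s -> 'I_(p * X)} => spaced H wu.1)
    (fun wu => (\sum_i powers k (wu.1 i)%:Z + \sum_i powers k (wu.2 i)%:Z)%R)
  <= (p ^ s) ^ 2 * ((p * X) ^ k * Lin * vinogradov k s X).
Proof.
have -> : p ^ s = #|{ffun 'I_s -> 'I_p}| by rewrite card_ffun !card_ord.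
pose th (c : {ffun 'I_s -> 'I_p}) (wu : W * {ffun 'I_s -> 'I_X}) :
  W * {ffun 'I_s -> 'I_(p * X)} := (wu.1, [ffun i => mix (c i) (wu.2 i)]).
apply: (@energy_cover_max _ _ _ _ _ _ (fun _ wu => spaced H wu.1) th).
  move=> [w x] /= sw; have [c [u xE]] := mix_ffun_surj x.
  by exists c, (w, u); rewrite /th xE.
move=> c.
have := energy_slots_le (PW := @spaced k H _) s0 energy_spaced_class c.
apply: leq_trans.
apply: energy_le => -[w u] [w' u'] _ _.
suff E v y : ((fun wu : W * {ffun 'I_s -> 'I_(p * X)} =>
    \sum_i powers k (wu.1 i)%:Z + \sum_i powers k (wu.2 i)%:Z) (th c (v, y)) =
  slots (fun w : W => \sum_i powers k (w i)%:Z)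
       (fun (c : 'I_p) (u : 'I_X) => powers k (p%:Z * u%:Z + c%:Z)) c (v, y))%R.
  by rewrite /= in E; rewrite /= !E.
rewrite /slots /=; congr (_ + _)%R; apply: eq_bigr => i _.
by rewrite ffunE /= PoszD PoszM.
Qed.

End Spaced.

(** * Linnik's lemma *)

Lemma card_fibers (A B : finType) (P : pred A) (Q : pred B) (phi : A -> B) (M : nat) :
  (forall a, P a -> Q (phi a)) ->
  (forall a0, P a0 -> #|[pred a | P a && (phi a == phi a0)]| <= M) ->
  #|P| <= #|Q| * M.
Proof.
move=> PQ fib; rewrite -sum1_card (partition_big phi Q) //= -sum_nat_const.
apply: leq_sum => b _.
have [/existsP[a0 /andP[Pa0 /eqP <-]]|/existsPn none] :=
  boolP [exists a0, P a0 && (phi a0 == b)].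
  by apply: leq_trans (fib a0 Pa0); rewrite sum1_card.
by rewrite big_pred0 // => a; apply/negbTE/none.
Qed.

Lemma card_ord_lt (N m : nat) : #|[pred v : 'I_N | v < m]| <= m.
Proof.
rewrite cardE -(size_map val) -[m in X in _ <= X](size_iota 0).
apply: uniq_leq_size; first by rewrite (map_inj_uniq val_inj) enum_uniq.
by move=> x /mapP[v]; rewrite mem_enum inE => vm ->; rewrite mem_iota.
Qed.

Lemma card_exists_le (I T : finType) (Q : I -> pred T) :
  #|[pred v | [exists i, Q i v]]| <= \sum_i #|Q i|.
Proof.
rewrite -sum1_card big_mkcond /=.
under [X in _ <= X]eq_bigr => i _ do rewrite -sum1_card big_mkcond /=.
rewrite exchange_big /=; apply: leq_sum => v _.
by rewrite inE; case: existsP => // -[i Qi]; rewrite (bigD1 i) //= unfold_in Qi.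
Qed.

Lemma leq_exp2rW (e m n : nat) : m <= n -> m ^ e <= n ^ e.
Proof. by case: e => // e mn; rewrite leq_exp2r. Qed.

(* Linnik's lemma for the prime 2, with spacing modulo 2^h instead of
   distinctness modulo the prime. *)
Lemma linnik (k rho h X : nat) (d : int) (lam : {ffun 'I_k -> int}) :
  2 ^ rho * X <= 2 ^ (rho * k) ->
  #|[pred w : {ffun 'I_k -> 'I_(2 ^ rho * X)} |
      spaced (2 ^ h) w && congruent d lam w]|
  <= 2 ^ (rho * \sum_(j < k) (k - j.+1)) * (k * 2 ^ (k * k + k.-1 * h)) ^ k.
Proof.
move=> XM; pose W : finType := {ffun 'I_k -> 'I_(2 ^ rho * X)}.
pose p := 2 ^ rho.
pose S (w : W) (j : 'I_k) : int := (\sum_i ((w i)%:Z - d) ^+ j.+1 - lam j)%R.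
(* The hypothesis determines the power sum of degree j + 1 only modulo p^(j+1). The residue [q w j],
   which takes p^(k-j-1) values, is the missing information modulo p^k; counting these residues
   gives the first factor of the bound. *)
pose q (w : W) (j : 'I_k) : int := modz (divz (S w j) (Posz (p ^ j.+1))) (Posz (p ^ (k - j.+1))).
have pp m : (Posz (p ^ m) != 0)%R by rewrite eqz_nat expn_eq0 expn_eq0.
have pgt m : (0 < Posz (p ^ m))%R by rewrite ltz_nat !expn_gt0.
have q0 w j : (0 <= q w j)%R by rewrite modz_ge0.
have qlt w j : (q w j < Posz (p ^ (k - j.+1)))%R by rewrite ltz_pmod.
pose phi (w : W) : {ffun 'I_k -> 'I_(p ^ k).+1} := [ffun j => inord `|q w j|%N].
have phiE w j : phi w j = `|q w j|%N :> nat.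
  rewrite ffunE inordK // ltnS ltnW //.
  have : `|q w j| < p ^ (k - j.+1) by rewrite -ltz_nat gez0_abs.
  by move=> /leq_trans; apply; rewrite leq_pexp2l ?expn_gt0 // leq_subr.
pose F (j : 'I_k) : pred 'I_(p ^ k).+1 := [pred v : 'I_(p ^ k).+1 | v < p ^ (k - j.+1)].
apply: leq_trans (card_fibers (Q := family F) (phi := phi)
   (M := (k * 2 ^ (k * k + k.-1 * h)) ^ k) _ _) _.
- move=> w _; apply/familyP => j; rewrite inE phiE -ltz_nat gez0_abs //.
(* In one fiber of [phi] all power sums agree modulo 2^(rho k), so by [close_root] every entry of
   [w] is congruent modulo 2^n0 to one of the [k] entries of [w0]. As the range has at most 2^(rho
   k) elements, each such class contains at most 2^(k k + (k - 1) h) of them. *)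
- move=> w0 /andP[sp0 co0].
  pose n0 := rho * k - (k * k + k.-1 * h).
  pose B : pred 'I_(p * X) := [pred v : 'I_(p * X) | [exists i, v == w0 i %[mod 2 ^ n0]]].
  apply: (@leq_trans #|(ffun_on B : pred W)|).
    apply: subset_leq_card; apply/fintype.subsetP => w /andP[/andP[sp co] /eqP ph].
    apply/ffun_onP => l; rewrite inE; apply/existsP.
    have hp m : 0 < m <= k -> (Posz (2 ^ (rho * k)) %|
       (\sum_i ((w i)%:Z - d) ^+ m - \sum_i ((w0 i)%:Z - d) ^+ m)%R)%Z.
      case: m => // j /= jk; pose j' := Ordinal jk.
      have e : q w j' = q w0 j'.
        by apply/eqP;
          rewrite -(gez0_abs (q0 w j')) -(gez0_abs (q0 w0 j')) eqz_nat -!phiE ph.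
      have /eqP := e; rewrite eqz_mod_dvd => /dvdzP[c ce].
      have pe : ((Posz p) ^+ j.+1 = Posz (p ^ j.+1)%N)%R by rewrite -!natz natrX.
      have D1 := divzK (forallP co j'); have D2 := divzK (forallP co0 j').
      rewrite /= -/p pe -!/(S _ j') in D1 D2.
      apply/dvdzP; exists c.
      have -> : (\sum_i ((w i)%:Z - d) ^+ j.+1 - \sum_i ((w0 i)%:Z - d) ^+ j.+1 =
         S w j' - S w0 j')%R by rewrite /S /=; ring.
      rewrite -D1 -D2 -mulrBl ce -mulrA; congr (_ * _)%R.
      by rewrite -PoszM -expnD expnM -/p; congr (Posz (_ ^ _)); rewrite subnK.
    have hy i j : (Posz (2 ^ h) %| (((w0 i)%:Z - d) - ((w0 j)%:Z - d))%R)%Z -> i = j.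
      move=> hd; apply/eqP; move/forallP: sp0 => /(_ i)/forallP/(_ j)/implyP; apply.
      by rewrite -eqz_nat -!modz_nat eqz_mod_dvd; move: hd; rewrite opprB addrA subrK.
    have [i hi] := close_root hp hy l.
    exists i; rewrite -eqz_nat -!modz_nat eqz_mod_dvd.
    by move: hi; rewrite opprB addrA subrK.
  rewrite card_ffun_on card_ord; apply: leq_exp2rW.
  apply: (@leq_trans (\sum_(i < k) #|[pred v : 'I_(p * X) | v == w0 i %[mod 2 ^ n0]]|)).
    exact: card_exists_le.
  rewrite -[k in X in _ <= X]card_ord -sum_nat_const; apply: leq_sum => i _.
  apply: card_residue; first by rewrite expn_gt0.
  by apply: leq_trans XM _;
    rewrite -expnD leq_exp2l // /n0 [_ - _ + _]addnC -leq_subLR !card_ord.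
rewrite leq_mul2r; apply/orP; right.
apply: leq_trans (eq_leq (card_family_prod F)) _.
apply: (@leq_trans (\prod_(j < k) p ^ (k - j.+1))).
  by apply: leq_prod => j _; exact: card_ord_lt.
by rewrite -expn_sum /p -expnM.
Qed.

(** * A recursive inequality for the mean value *)

Lemma vinogradov_trivial (k s X : nat) : vinogradov k s X <= X ^ (2 * s).
Proof.
apply: leq_trans (energy_card _ _) _.
by rewrite mulnC expnM leq_exp2rW // (leq_trans (max_card _)) // card_ffun !card_ord.
Qed.

Lemma vinogradov_step_aux (k s rho h X X1 X2 : nat) :
  0 < k -> 0 < s -> X = 2 ^ h * X1 -> X = 2 ^ rho * X2 -> X <= 2 ^ (rho * k) ->
  vinogradov k (k + s) X <=
  2 * (((2 ^ h) ^ k * k ^ (k + s)) ^ 2 * vinogradov k (k + s) X1 +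
       (k + s)`! ^ 2 * (((2 ^ rho) ^ s) ^ 2 *
         (X ^ k * (2 ^ (rho * \sum_(j < k) (k - j.+1)) * (k * 2 ^ (k * k + k.-1 * h)) ^ k)
           * vinogradov k s X2))).
Proof.
move=> k0 s0 e1 e2 XM.
have h0 : 0 < 2 ^ h by rewrite expn_gt0.
apply: leq_trans (energyU _ (fun x => few_or_many x h0)) _.
rewrite leq_mul2l; apply/orP; right; apply: leq_add.
  clear e2 XM; subst X.
  by apply: energy_few_classes => //; rewrite addn_gt0 k0.
apply: leq_trans (energy_many_classes _ _ _ _) _.
rewrite leq_mul2l; apply/orP; right.
clear e1; subst X.
by apply: energy_spaced => // [|d lam]; rewrite ?expn_gt0 //; exact: linnik.
Qed.

Lemma sum_rev_ord (k : nat) : (\sum_(j < k) (k - j.+1)).*2 = k * k.-1.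
Proof.
elim: k => [|k IH]; first by rewrite big_ord0.
rewrite big_ord_recl /= doubleD.
rewrite (eq_bigr (fun j : 'I_k => k - j.+1)) // IH; case: k {IH} => // k.
by rewrite /= -mul2n; lia.
Qed.

Lemma ltn_exp2W (k : nat) : k <= 2 ^ k.
Proof. by apply/ltnW/ltn_expl. Qed.

Lemma fact_le (n : nat) : n`! <= n ^ n.
Proof.
elim: n => // n IH; rewrite factS expnS leq_mul2l /=.
by apply: leq_trans IH _; apply: leq_exp2rW.
Qed.

Lemma five_sq_le (k : nat) : 8 <= k -> 5 * k ^ 2 <= 2 ^ k.+1.
Proof.
elim: k => // k IH; rewrite leq_eqVlt => /predU1P[<-//|k8].
have {}IH := IH k8; rewrite expnS; apply: leq_trans (_ : 2 * (5 * k ^ 2) <= _);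
  last first.
  by rewrite leq_mul2l.
rewrite -!mulnn; nia.
Qed.

(** The spacing modulus 2^(4 k) is chosen so that the first term can be absorbed by induction on
    [r]: when k + s is at least k^2, shrinking the range by 2^(4 k) gains more than the factor 2^(8
    k^2 + 2 k (k + s)) loses. *)
Lemma vinogradov_step (k s rho r : nat) :
  8 <= k -> 0 < s -> k + s <= 5 * k ^ 2 -> rho <= r -> r <= rho * k -> 4 * k <= r ->
  vinogradov k (k + s) (2 ^ r) <=
  2 * (2 ^ (8 * k ^ 2 + 2 * k * (k + s)) * vinogradov k (k + s) (2 ^ (r - 4 * k)) +
       2 ^ (2 * (k + s) * k.+1 + 2 * s * rho + r * k +
            rho * \sum_(j < k) (k - j.+1) + 5 * k ^ 3) * vinogradov k s (2 ^ (r - rho))).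
Proof.
move=> k8 s0 n5 rr rk hr; have k0 : 0 < k by apply: leq_trans k8.
have E1 : 2 ^ r = 2 ^ (4 * k) * 2 ^ (r - 4 * k) by rewrite -expnD subnKC.
have E2 : 2 ^ r = 2 ^ rho * 2 ^ (r - rho) by rewrite -expnD subnKC.
have XM : 2 ^ r <= 2 ^ (rho * k) by rewrite leq_exp2l.
apply: leq_trans (vinogradov_step_aux k0 s0 E1 E2 XM) _.
rewrite leq_mul2l; apply/orP; right; apply: leq_add.
  rewrite leq_mul2r; apply/orP; right.
  have : k ^ (k + s) <= 2 ^ (k * (k + s)) by rewrite expnM; exact/leq_exp2rW/ltn_exp2W.
  move=> h; apply: (@leq_trans (((2 ^ (4 * k)) ^ k * 2 ^ (k * (k + s))) ^ 2)).
    by apply: leq_exp2rW; rewrite leq_mul2l h orbT.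
  rewrite -expnM -expnD -expnM leq_exp2l // mulnDl -mulnn; lia.
rewrite (mulnA (_ ^ 2) _ (vinogradov k s _)) (mulnA ((k + s)`! ^ 2)) leq_mul2r.
apply/orP; right.
have f1 : (k + s)`! ^ 2 <= 2 ^ (2 * (k + s) * k.+1).
  apply: (@leq_trans (((2 ^ k.+1) ^ (k + s)) ^ 2)).
    apply: leq_exp2rW; apply: leq_trans (fact_le _) _; apply: leq_exp2rW.
    exact: leq_trans n5 (five_sq_le k8).
  by rewrite -!expnM leq_exp2l //; lia.
have f2 : (k * 2 ^ (k * k + k.-1 * (4 * k))) ^ k <= 2 ^ (5 * k ^ 3).
  apply: (@leq_trans ((2 ^ k * 2 ^ (k * k + k.-1 * (4 * k))) ^ k)).
    by apply: leq_exp2rW; rewrite leq_mul2r ltn_exp2W orbT.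
  rewrite -expnD -expnM leq_exp2l //.
  case: k k8 {n5 rk hr k0 E1 E2 XM f1} => // k _; rewrite /= !expnS expn0.
  nia.
have -> : ((2 ^ rho) ^ s) ^ 2 = 2 ^ (2 * s * rho).
  by rewrite -!expnM; congr (_ ^ _); lia.
have -> : (2 ^ r) ^ k = 2 ^ (r * k) by rewrite expnM.
move: f1 f2; set E := k * k + _; set c := 5 * k ^ 3 => f1 f2.
rewrite -!addnA (expnD 2 (2 * (k + s) * k.+1)) (expnD 2 (2 * s * rho)) (expnD 2 (r * k)).
rewrite (expnD 2 (rho * _)).
by do 4! (apply: leq_mul => //).
Qed.

(** * Iteration of the recursive inequality *)

Section Pow2.
Context {R : realType}.
Local Open Scope ring_scope.

Definition pow2 (x : R) : R := 2 `^ x.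

Lemma pow2D x y : pow2 (x + y) = pow2 x * pow2 y.
Proof. by rewrite /pow2 powRD // pnatr_eq0 implybT. Qed.

Lemma pow2_nat (n : nat) : pow2 n%:R = (2 ^ n)%N%:R.
Proof. by rewrite /pow2 powR_mulrn ?natrX // ler0n. Qed.

Lemma pow2_gt0 x : 0 < pow2 x.
Proof. by rewrite powR_gt0. Qed.

Lemma le_pow2 x y : x <= y -> pow2 x <= pow2 y.
Proof. by move=> xy; rewrite /pow2 ler_powR // ler1n. Qed.

Lemma pow2_1 : pow2 1 = 2.
Proof. by rewrite -[X in pow2 X]/(1%:R) pow2_nat. Qed.

(* The exponent saved over the trivial bound after l steps of the iteration,
   out of a maximum of k (k + 1) / 2. *)
Definition saving (k l : nat) : R :=
  k%:R * (k%:R + 1) / 2 * (1 - (1 - k%:R^-1) ^+ l).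

(** The recurrence dictated by the second term of [vinogradov_step] with rho = r / k: the [k]
    separated variables gain (k + 1) / 2, and the passage to the range 2^(r - rho) keeps the
    fraction 1 - 1 / k of the previous saving. *)
Lemma savingS k l : (0 < k)%N ->
  saving k l.+1 = (k%:R + 1) / 2 + saving k l * (1 - k%:R^-1).
Proof.
move=> k0; have k1 : k%:R != 0 :> R by rewrite pnatr_eq0 -lt0n.
by rewrite /saving exprS; set x := _ ^+ l; field.
Qed.

Lemma saving_bounds k l : (0 < k)%N -> 0 <= saving k l <= k%:R * (k%:R + 1) / 2.
Proof.
move=> k0; have k1 : (1 : R) <= k%:R by rewrite ler1n.
have i0 : 0 <= 1 - (k%:R : R)^-1 by rewrite subr_ge0 invf_le1 // (lt_le_trans ltr01).
have i1 : 1 - (k%:R : R)^-1 <= 1 by rewrite gerBl invr_ge0 ler0n.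
have := exprn_ge0 l i0; have := exprn_ile1 l i0 i1.
rewrite /saving; set x := _ ^+ l => x1 x0.
have K0 : 0 <= (k%:R : R) * (k%:R + 1) / 2 by nra.
by apply/andP; split; nra.
Qed.

(** Induction on [l], and for each [l] strong induction on [r]: tuples with few classes keep the
    number of variables and lower [r], the others lower [l]. Starting from k^2 variables makes the
    first kind absorbable at every step. For r < 4 k the trivial bound fits into the term in k^3. *)
Theorem vinogradov_mean_value (k l r : nat) : (8 <= k)%N -> (l <= 4 * k)%N ->
  (vinogradov k (k ^ 2 + k * l) (2 ^ r))%:R <=
  pow2 (18 * k%:R ^+ 3 * (l%:R + 1) +
        (2 * (k%:R ^+ 2 + k%:R * l%:R) - saving k l) * r%:R).
Proof.
move=> k8; have k0 : (0 < k)%N by apply: leq_trans k8.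
have kR : (8 : R) <= k%:R by rewrite ler_nat.
set K : R := k%:R in kR *.
elim: l r => [|l IHl] r lk.
  have -> : saving k 0 = 0 by rewrite /saving expr0 subrr mulr0.
  rewrite muln0 addn0 mulr0n subr0.
  apply: le_trans (_ : pow2 ((r * (2 * k ^ 2))%N%:R) <= _); last first.
    apply: le_pow2; rewrite natrM natrM natrX -/K.
    by have := exprn_ge0 3 (le_trans (ler0n R 8) kR); lra.
  by rewrite pow2_nat ler_nat expnM vinogradov_trivial.
have sb := saving_bounds l k0; have sb' := saving_bounds l.+1 k0.
have sS := savingS l k0.
set g := saving k l in sb sS *; set g' := saving k l.+1 in sb' sS *.
rewrite -/K in sb sb' sS.
have K0 : 0 < K by lra.
have lR : (l%:R : R) + 1 <= 4 * K by rewrite natr1 -[4]/(4%:R) -natrM ler_nat.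
pose s := (k ^ 2 + k * l)%N.
have nE : (k ^ 2 + k * l.+1 = k + s)%N by rewrite /s mulnS addnCA.
have sR : s%:R = K ^+ 2 + K * l%:R :> R by rewrite /s natrD natrX natrM.
have l0 : 0 <= l%:R :> R by [].
rewrite nE -[l.+1%:R]natr1.
have K2 : 8 * K <= K ^+ 2 by rewrite expr2 ler_wpM2r // ltW.
have K3 : 8 * K ^+ 2 <= K ^+ 3 by rewrite [K ^+ 3]exprS ler_wpM2r // exprn_ge0 // ltW.
have Kl : 0 <= K * l%:R by rewrite mulr_ge0 // ltW.
have K2l : 8 * (K * l%:R) <= K ^+ 2 * l%:R by rewrite mulrA ler_wpM2r.
have K3l : 8 * (K ^+ 2 * l%:R) <= K ^+ 3 * l%:R by rewrite mulrA ler_wpM2r.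
elim/ltn_ind: r => r IHr.
have [rk|rk] := ltnP r (4 * k).
  apply: le_trans (_ : pow2 ((r * (2 * (k + s)))%N%:R) <= _).
    by rewrite pow2_nat ler_nat expnM vinogradov_trivial.
  apply: le_pow2; rewrite !natrM natrD sR -/K.
  have rR : (r%:R : R) <= 4 * K by rewrite -[4]/(4%:R) -natrM ler_nat ltnW.
  have r0 : 0 <= r%:R :> R by [].
  have e : g' * r%:R <= 18 * K ^+ 3 * (l%:R + 1 + 1).
    apply: (@le_trans _ _ (K * (K + 1) / 2 * (4 * K))).
      by apply: ler_pM => //; case/andP: sb'.
    by lra.
  by lra.
(* The least [rho] with 2^r <= 2^(rho k), as [linnik] demands. Rounding up costs at most T + g <=
   K^2 in the exponent, see [M1]. *)
pose rho := ((r + k.-1) %/ k)%N.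
have r1 : (r <= rho * k)%N.
  have := ltn_ceil (r + k.-1) k0; rewrite -/rho mulSn.
  by move: (rho * k)%N => u; clear - k0; lia.
have r2 : (rho * k <= r + k.-1)%N by exact: leq_divM.
have r0 : (0 < r)%N by apply: leq_trans rk; rewrite muln_gt0.
have r3 : (rho <= r)%N.
  rewrite -(leq_pmul2r k0); apply: leq_trans r2 _.
  by rewrite -[X in (_ <= _ * X)%N](prednK k0) mulnS leq_add2l leq_pmull.
have s0 : (0 < s)%N by rewrite /s addn_gt0 expn_gt0 k0.
have n5 : (k + s <= 5 * k ^ 2)%N.
  have -> : (k + s = k * (k + l.+1))%N by rewrite /s -mulnn mulnDr mulnS addnCA.
  by rewrite -mulnn mulnCA leq_mul2l mulSn leq_add2l lk orbT.
have := vinogradov_step k8 s0 n5 r3 r1 rk.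
rewrite -(ler_nat R) => /le_trans; apply.
have rlt : (r - 4 * k < r)%N by rewrite ltn_subrL muln_gt0 k0 r0.
have IH1 := IHr (r - 4 * k)%N rlt.
have IH2 := IHl (r - rho)%N (ltnW lk).
rewrite natrM natrD !natrM -!pow2_nat.
set a : R := (_ + 2 * k * _)%N%:R; set b : R := (_ + 5 * _)%N%:R.
set A := 18 * _ * _ + _.
(* The 2 in the exponent pays for the sum of two terms and for the outer factor 2. *)
suff [e1 e2] : pow2 a * (vinogradov k (k + s) (2 ^ (r - 4 * k)))%:R <= pow2 (A - 2) /\
   pow2 b * (vinogradov k s (2 ^ (r - rho)))%:R <= pow2 (A - 2).
  apply: le_trans (_ : 2 * (pow2 (A - 2) + pow2 (A - 2)) <= _).
    by rewrite ler_pM2l // lerD.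
  have -> : 2 * (pow2 (A - 2) + pow2 (A - 2)) = pow2 (1 + (1 + (A - 2))).
    by rewrite !pow2D pow2_1; ring.
  by apply: le_pow2; lra.
have rkR : (r - 4 * k)%:R = r%:R - 4 * K :> R by rewrite natrB // natrM.
have rrR : (r - rho)%:R = r%:R - rho%:R :> R by rewrite natrB.
split.
  apply: le_trans (ler_wpM2l (ltW (pow2_gt0 _)) IH1) _.
  rewrite -pow2D; apply: le_pow2; rewrite rkR /A /a natrD !natrM natrD ?natrX sR -/K.
  have g4 : g' * (4 * K) <= K * (K + 1) / 2 * (4 * K).
    by apply: ler_wpM2r; [lra | case/andP: sb'].
  by lra.
apply: le_trans (ler_wpM2l (ltW (pow2_gt0 _)) IH2) _.
rewrite -pow2D; apply: le_pow2; rewrite rrR /A /b !natrD !natrM natrD ?natrX sR -/K.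
have -> : k.+1%:R = K + 1 :> R by rewrite -natr1.
rewrite -/g.
set T : R := (\sum_(j < k) _)%:R.
have TR : T = K * (K - 1) / 2.
  have := congr1 (fun m => m%:R : R) (sum_rev_ord k).
  by rewrite -mul2n !natrM -/T -subn1 natrB // -/K => e; lra.
have rhoR : rho%:R <= r%:R / K + 1.
  rewrite -(ler_pM2r K0) mulrDl divfK ?gt_eqF // mul1r -natrM -natrD ler_nat.
  by apply: leq_trans r2 _; rewrite leq_add2l leq_pred.
have M0 : 0 <= T + g by rewrite TR; case/andP: sb => ? _; nra.
have M1 : T + g <= K ^+ 2 by rewrite TR; case/andP: sb => _ ?; rewrite expr2; nra.
have := ler_wpM2r M0 rhoR.
have -> : (r%:R / K + 1) * (T + g) = r%:R * ((K - 1) / 2) + r%:R * g / K + (T + g).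
  by rewrite TR; field; rewrite gt_eqF.
have f1 : K ^+ 2 * (l%:R + 1) <= K ^+ 2 * (4 * K) by rewrite ler_wpM2l // exprn_ge0 // ltW.
have f2 : K * (l%:R + 1) <= K * (4 * K) by rewrite ler_wpM2l // ltW.
rewrite sS => f3.
by lra.
Qed.

End Pow2.

(** * A bilinear exponential sum *)

Local Open Scope ring_scope.

(* Chebyshev's sum inequality gives the induction step. *)
Lemma power_mean (C : numDomainType) (I : finType) (b : I -> C) (n : nat) :
  (forall i, 0 <= b i) ->
  (\sum_i b i) ^+ n.+1 <= #|I|%:R ^+ n * \sum_i b i ^+ n.+1.
Proof.
move=> b0; elim: n => [|n IH]; first by rewrite expr0 mul1r expr1.
rewrite exprSr; apply: le_trans (ler_wpM2r (sumr_ge0 _ (fun i _ => b0 i)) IH) _.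
rewrite exprSr -!mulrA ler_wpM2l ?exprn_ge0 ?ler0n //.
rewrite -subr_ge0 -(pmulrn_lge0 _ (isT : (0 < 2)%N)).
have -> : (#|I|%:R * (\sum_i b i ^+ n.+2) - (\sum_i b i ^+ n.+1) * \sum_i b i) *+ 2 =
   \sum_i \sum_j (b i ^+ n.+1 - b j ^+ n.+1) * (b i - b j).
  have E : #|I|%:R * (\sum_i b i ^+ n.+2) = \sum_(i : I) \sum_j b j ^+ n.+2.
    by rewrite sumr_const mulr_natl.
  have E' : #|I|%:R * (\sum_i b i ^+ n.+2) = \sum_i \sum_(j : I) b i ^+ n.+2.
    by rewrite E exchange_big.
  have F : (\sum_i b i ^+ n.+1) * (\sum_i b i) = \sum_i \sum_j b i ^+ n.+1 * b j.
    by rewrite mulr_suml; apply: eq_bigr => i _; rewrite mulr_sumr.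
  have F' : (\sum_i b i ^+ n.+1) * (\sum_i b i) = \sum_i \sum_j b j ^+ n.+1 * b i.
    by rewrite F exchange_big.
  rewrite mulr2n {1}E {1}F E' F' -!sumrB -big_split; apply: eq_bigr => i _ /=.
  rewrite -!sumrB -big_split; apply: eq_bigr => j _ /=.
  by rewrite !(exprSr _ n.+1); ring.
apply: sumr_ge0 => i _; apply: sumr_ge0 => j _.
rewrite subrXX mulrC mulrA -expr2 mulr_ge0 //.
  by rewrite real_exprn_even_ge0 // rpredB // ger0_real.
by apply: sumr_ge0 => l _; rewrite mulr_ge0 // exprn_ge0.
Qed.

Section Bilinear.
Context {C : numClosedFieldType} {A : comNzRingType}.
Variable psi : A -> C.
Hypotheses (psiD : forall x y, psi (x + y) = psi x * psi y)
  (psi1 : forall x, `|psi x| = 1).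

Lemma psi0 : psi 0 = 1.
Proof.
have nz : psi 0 != 0 by rewrite -normr_eq0 psi1 oner_eq0.
by apply: (mulfI nz); rewrite -psiD addr0 mulr1.
Qed.

Lemma psiN x : psi (- x) = (psi x)^*.
Proof.
have nz : psi x != 0 by rewrite -normr_eq0 psi1 oner_eq0.
by apply: (mulfI nz); rewrite -psiD subrr psi0 -normCK psi1 expr1n.
Qed.

Lemma psi_sum (I : finType) (F : I -> A) : psi (\sum_i F i) = \prod_i psi (F i).
Proof. exact: (big_morph psi psiD psi0). Qed.

Lemma norm_sum_pow (Y : finType) (p : Y -> A) (s : nat) :
  `|\sum_y psi (p y)| ^+ (2 * s) =
  \sum_(u : {ffun 'I_s -> Y}) \sum_(v : {ffun 'I_s -> Y})
    psi (\sum_i p (u i) - \sum_i p (v i)).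
Proof.
have E : (\sum_y psi (p y)) ^+ s = \sum_(u : {ffun 'I_s -> Y}) psi (\sum_i p (u i)).
  rewrite -[in LHS](card_ord s) -prodr_const bigA_distr_bigA.
  by apply: eq_bigr => u _; rewrite psi_sum.
rewrite exprM normCK exprMn -rmorphXn E rmorph_sum mulr_suml.
by apply: eq_bigr => u _; rewrite mulr_sumr; apply: eq_bigr => v _; rewrite psiD psiN.
Qed.

Variables (k s X : nat) (a : 'I_k -> A).
Variables (L : 'I_k -> nat) (o : 'I_k -> int) (M : nat).

Let T := {ffun 'I_s -> 'I_X}.
Definition power_diff (uv : T * T) : {ffun 'I_k -> int} :=
  \sum_i powers k (uv.1 i)%:Z - \sum_i powers k (uv.2 i)%:Z.

Hypothesis boxP : forall uv j, 0 <= power_diff uv j + o j < (L j)%:Z.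
Hypothesis LM : forall j, (L j <= M.+1)%N.

(** The offset [o] moves the values of [power_diff] to natural numbers below [L j]; the common bound
    [M] places the whole box inside one finite type of functions. *)
Let Box := {ffun 'I_k -> 'I_M.+1}.
Let inbox : pred Box := family (fun j => [pred v : 'I_M.+1 | (v < L j)%N]).
Let dec (l : Box) : {ffun 'I_k -> int} := [ffun j => (l j)%:Z - o j].
Let enc (uv : T * T) : Box := [ffun j => inord `|(power_diff uv j + o j)%R|%N].

Let val_enc uv j : (enc uv j : nat)%:Z = power_diff uv j + o j.
Proof.
have /andP[h0 h1] := boxP uv j.
rewrite ffunE inordK ?gez0_abs //.
by rewrite -ltz_nat gez0_abs //; apply: lt_le_trans h1 _; rewrite lez_nat LM.
Qed.

Let enc_in uv : inbox (enc uv).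
Proof.
apply/familyP => j; rewrite inE -ltz_nat val_enc.
by have /andP[] := boxP uv j.
Qed.

Let encK uv : dec (enc uv) = power_diff uv.
Proof. by apply/ffunP => j; rewrite ffunE val_enc addrK. Qed.

(** A point of the box is the value of [power_diff] for at most [vinogradov k s X] pairs, because a
    shifted system has no more solutions than the homogeneous one. *)
Lemma sum_box (F : {ffun 'I_k -> int} -> C) : (forall l, 0 <= F l) ->
  \sum_uv F (power_diff uv) <= (vinogradov k s X)%:R * \sum_(l | inbox l) F (dec l).
Proof.
move=> F0; rewrite (partition_big enc inbox) => [|uv _] /=; last exact: enc_in.
rewrite mulr_sumr; apply: ler_sum => l _.
rewrite (eq_bigr (fun=> F (dec l))) => [|uv /eqP <-]; last by rewrite encK.
rewrite sumr_const -[_ *+ _]mulr_natl ler_wpM2r // ler_nat.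
pose f (x : T) : {ffun 'I_k -> int} := \sum_i powers k (x i)%:Z.
apply: (@leq_trans (cross predT f predT (fun x => f x + dec l))).
  rewrite cross_pair -sum1_card big_mkcond; apply: leq_sum => uv _.
  apply: (@leq_trans (enc uv == l)); first by case: ifP => // h;
    rewrite (h : (enc uv == l) = true).
  case: (enc uv =P l) => // e.
  have -> : f uv.1 = f uv.2 + dec l by rewrite -e encK /power_diff [RHS]addrC subrK.
  by rewrite eqxx.
apply: cross_max => //; apply: energy_le => x y _ _; exact: addIr.
Qed.

(** The phase as a symmetric bilinear form in two vectors of power sums; at [powers k x] and
    [powers k y] it is the polynomial in the product of x and y. *)
Definition twist (lam mu : {ffun 'I_k -> int}) : A :=
  \sum_j a j * ((lam j)%:~R * (mu j)%:~R).

Lemma twist_diff lam (uv : T * T) :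
  \sum_i twist lam (powers k (uv.1 i)%:Z) - \sum_i twist lam (powers k (uv.2 i)%:Z) =
  twist lam (power_diff uv).
Proof.
have E (u : T) : \sum_i twist lam (powers k (u i)%:Z) =
   twist lam (\sum_i powers k (u i)%:Z).
  rewrite exchange_big; apply: eq_bigr => j _ /=.
  by rewrite sum_ffunE rmorph_sum /= !mulr_sumr.
rewrite !E -sumrB; apply: eq_bigr => j _.
by rewrite -mulrBr -mulrBr !ffunE intrB.
Qed.

Lemma twistC lam mu : twist lam mu = twist mu lam.
Proof. by apply: eq_bigr => j _; rewrite [_%:~R * _]mulrC. Qed.

Let c (lam : {ffun 'I_k -> int}) : C := `|\sum_(x < X) psi (twist lam (powers k x%:Z))|.

Let c_expand lam : c lam ^+ (2 * s) = \sum_uv psi (twist lam (power_diff uv)).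
Proof.
rewrite /c norm_sum_pow pair_bigA /=; apply: eq_bigr => uv _.
by rewrite twist_diff.
Qed.

Definition box_sum (j : 'I_k) : C :=
  \sum_(m < L j) `|\sum_(l < L j) psi (a j * ((l%:Z - o j)%:~R * (m%:Z - o j)%:~R))|.

Let sum_narrow j (F : nat -> C) :
  \sum_(v : 'I_M.+1 | (v < L j)%N) F v = \sum_(v < L j) F v.
Proof. by rewrite (big_ord_widen _ F (LM j)). Qed.

Let box_prod :
  \sum_(m | inbox m) `|\sum_(l | inbox l) psi (twist (dec m) (dec l))| = \prod_j box_sum j.
Proof.
pose g j (m l : nat) : C := psi (a j * ((l%:Z - o j)%:~R * (m%:Z - o j)%:~R)).
have E (m : Box) : \sum_(l | inbox l) psi (twist (dec m) (dec l)) =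
   \prod_j \sum_(l < L j) g j (m j) l.
  under [RHS]eq_bigr => j _ do rewrite -(sum_narrow _ (fun l => g j (m j) l)).
  rewrite bigA_distr_big_dep; apply: eq_bigr => l _.
  rewrite psi_sum; apply: eq_bigr => j _.
  by rewrite /g !ffunE [X in a j * X]mulrC.
transitivity (\sum_(m | inbox m) \prod_j `|\sum_(l < L j) g j (m j) l|).
  by apply: eq_bigr => m _; rewrite (E m) normr_prod.
transitivity (\prod_j \sum_(m : 'I_M.+1 | (m < L j)%N) `|\sum_(l < L j) g j m l|).
  by rewrite bigA_distr_big_dep.
apply: eq_bigr => j _.
by rewrite (sum_narrow _ (fun m => `|\sum_(l < L j) g j m l|)).
Qed.

(** The 2 s-th power of the sum over y depends on its variables only through [power_diff], and
    Hoelder's inequality over x followed by an exchange of sums isolates it ([step1]). The second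
    application, over the X^(2 s) pairs [uv], treats the sum over x in the same way. In [step3] each
    of the two power differences is replaced by a free point of the box, at the price of one mean
    value each; the phase then separates into coordinates. *)
Theorem bilinear : (0 < s)%N ->
  `|\sum_(x < X) \sum_(y < X) psi (\sum_j a j * (x * y)%:R ^+ j.+1)| ^+ ((2 * s) * (2 * s))
  <= X%:R ^+ (2 * s * (4 * s - 2)) * (vinogradov k s X)%:R ^+ 2 * \prod_j box_sum j.
Proof.
move=> s0.
have [n nE] : exists n, (2 * s = n.+1)%N by exists (2 * s).-1;
  rewrite prednK // muln_gt0.
have tw (x y : 'I_X) : \sum_j a j * (x * y)%:R ^+ j.+1 =
    twist (powers k x%:Z) (powers k y%:Z).
  by apply: eq_bigr => j _; rewrite !ffunE natrM exprMn !rmorphXn /=.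
have c0 l : 0 <= c l by exact: normr_ge0.
have step1 : `|\sum_(x < X) \sum_(y < X) psi (\sum_j a j * (x * y)%:R ^+ j.+1)| ^+ (2 * s)
    <= X%:R ^+ n * \sum_uv c (power_diff uv).
  apply: (@le_trans _ _ ((\sum_(x < X) c (powers k x%:Z)) ^+ (2 * s))).
    apply: lerXn2r; rewrite ?nnegrE ?sumr_ge0 //.
    apply: le_trans (ler_norm_sum _ _ _) _; apply: ler_sum => x _.
    by rewrite /c; under eq_bigr => y _ do rewrite tw.
  rewrite {1}nE; apply: le_trans (power_mean _ (fun i => c0 _)) _.
  rewrite card_ord ler_wpM2l ?exprn_ge0 // -nE.
  under eq_bigr => x _ do rewrite c_expand.
  rewrite exchange_big /=.
  apply: le_trans (real_ler_norm _) _.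
    have -> : \sum_uv \sum_(x < X) psi (twist (powers k x%:Z) (power_diff uv)) =
       \sum_(x < X) c (powers k x%:Z) ^+ (2 * s).
      by rewrite exchange_big; apply: eq_bigr => x _; rewrite c_expand.
    by apply: ger0_real; apply: sumr_ge0 => x _; rewrite exprn_ge0.
  apply: le_trans (ler_norm_sum _ _ _) _; apply: ler_sum => uv _.
  by rewrite /c; under eq_bigr => x _ do rewrite twistC.
have step3 : \sum_uv c (power_diff uv) ^+ (2 * s) <=
    (vinogradov k s X)%:R ^+ 2 * \prod_j box_sum j.
  apply: le_trans (sum_box (F := fun l => c l ^+ (2 * s)) _) _.
    by move=> l; rewrite exprn_ge0.
  rewrite expr2 -mulrA ler_wpM2l // -box_prod.
  under eq_bigr => l _ do rewrite c_expand.
  apply: le_trans (real_ler_norm _) _.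
    under eq_bigr => l _ do rewrite -c_expand.
    by apply: ger0_real; apply: sumr_ge0 => x _; rewrite exprn_ge0.
  rewrite exchange_big /=.
  apply: le_trans (ler_norm_sum _ _ _) _.
  have := @sum_box (fun mu => `|\sum_(l | inbox l) psi (twist mu (dec l))|)
    (fun _ => normr_ge0 _).
  apply: le_trans; apply: ler_sum => uv _.
  by under eq_bigr => l _ do rewrite twistC.
rewrite exprM.
apply: (@le_trans _ _ ((X%:R ^+ n * \sum_uv c (power_diff uv)) ^+ (2 * s))).
  by apply: lerXn2r; rewrite ?nnegrE ?exprn_ge0 ?mulr_ge0 ?exprn_ge0 ?sumr_ge0.
rewrite exprMn.
have -> : (2 * s * (4 * s - 2) = n * (2 * s) + 2 * s * n)%N by nia.
rewrite -exprM exprD -[leRHS]mulrA -[leRHS]mulrA ler_wpM2l ?exprn_ge0 //.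
rewrite {1}nE; apply: le_trans (power_mean _ (fun i => c0 _)) _.
rewrite -nE card_prod card_ffun !card_ord natrM natrX -exprD addnn -mul2n -exprM.
by rewrite ler_wpM2l ?exprn_ge0.
Qed.

End Bilinear.

(** * Expansion in powers of the index *)

Lemma bin_trinomial (z k i : nat) : (k + i <= z)%N ->
  ('C(z, k + i) * 'C(k + i, k) = 'C(z, k) * 'C(z - k, i))%N.
Proof.
move=> kz; have kz' : (k <= z)%N by apply: leq_trans kz; exact: leq_addr.
have iz : (i <= z - k)%N by rewrite leq_subRL.
have h1 := bin_fact kz; have h2 := bin_fact (leq_addr i k).
have h3 := bin_fact kz'; have h4 := bin_fact iz.
rewrite addKn in h2; rewrite -subnDA in h4.
apply/eqP; rewrite -(eqn_pmul2r (fact_gt0 k)) -(eqn_pmul2r (fact_gt0 i)).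
rewrite -(eqn_pmul2r (fact_gt0 (z - (k + i)))); apply/eqP.
transitivity z`!.
  by rewrite -h1 -h2; ring.
by rewrite -h3 -h4; ring.
Qed.

Section OddParts.
Context {A : comUnitRingType}.
Hypothesis unit_odd : forall y : A, 1 + 2 * y \is a GRing.unit.

Definition eqmod2 (x y : A) := exists z, x = y + 2 * z.

Lemma eqmod2_refl x : eqmod2 x x.
Proof. by exists 0; rewrite mulr0 addr0. Qed.

Lemma eqmod2_trans x y z : eqmod2 x y -> eqmod2 y z -> eqmod2 x z.
Proof. by move=> [u ->] [v ->]; exists (v + u); ring. Qed.

Lemma eqmod2D x y x' y' : eqmod2 x y -> eqmod2 x' y' -> eqmod2 (x + x') (y + y').
Proof. by move=> [u ->] [v ->]; exists (u + v); ring. Qed.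

Lemma eqmod2N x y : eqmod2 x y -> eqmod2 (- x) y.
Proof. by move=> [u ->]; exists (- u - y); ring. Qed.

Lemma eqmod2M x y x' y' : eqmod2 x y -> eqmod2 x' y' -> eqmod2 (x * x') (y * y').
Proof. by move=> [u ->] [v ->]; exists (u * y' + v * y + 2 * u * v); ring. Qed.

Lemma eqmod2X x y n : eqmod2 x y -> eqmod2 (x ^+ n) (y ^+ n).
Proof.
by move=> h; elim: n => [|n IH]; [exact: eqmod2_refl | rewrite !exprS; exact: eqmod2M].
Qed.

Lemma eqmod2_sum (I : finType) (F G : I -> A) :
  (forall i, eqmod2 (F i) (G i)) -> eqmod2 (\sum_i F i) (\sum_i G i).
Proof.
move=> h; apply: (big_ind2 eqmod2) => //; first exact: eqmod2_refl.
by move=> *; exact: eqmod2D.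
Qed.

Lemma eqmod2_nat (n : nat) : eqmod2 n%:R (odd n)%:R.
Proof.
exists (n./2)%:R; rewrite -natrM -natrD mul2n; congr (_%:R).
by rewrite odd_double_half.
Qed.

Lemma odd_unit x : eqmod2 x 1 -> x \is a GRing.unit.
Proof. by case=> y ->. Qed.

Lemma eqmod2V x : eqmod2 x 1 -> eqmod2 x^-1 1.
Proof.
move=> h; have ux := odd_unit h; case: h => y e.
exists (- (y * x^-1)); apply: (mulIr ux); rewrite mulVr //.
by rewrite mulrDl mul1r mulrN mulNr -!mulrA mulVr // e; ring.
Qed.

Section Expansion.
Variables (e a0 b q : A).
Hypotheses (e1 : eqmod2 e 1) (a1 : eqmod2 a0 1) (b1 : eqmod2 b 0) (q0 : eqmod2 q 0).

Let den z := a0 * (1 + q) ^+ z - b.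

Lemma G_odd z : eqmod2 ((1 + q) ^+ z) 1.
Proof.
rewrite -[X in eqmod2 _ X](expr1n _ z); apply: eqmod2X.
by rewrite -[X in eqmod2 _ X]addr0; apply: eqmod2D => //; exact: eqmod2_refl.
Qed.

Lemma den_odd z : eqmod2 (den z) 1.
Proof.
rewrite -[X in eqmod2 _ X]addr0; apply: eqmod2D; last exact: eqmod2N.
by rewrite -[X in eqmod2 _ X]mulr1; apply: eqmod2M => //; exact: G_odd.
Qed.

(** The recurrence comes from multiplying the sum of C(z, j) q^j eps_j by [den z] and comparing with
    [e] coefficient by coefficient in the basis C(z, n) q^n. *)
Let rhs (j : nat) (eps : nat -> A) : A :=
  if j is 0 then e else - (a0 * \sum_(k < j) 'C(j, k)%:R * (1 + q) ^+ k * eps k).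

Lemma eps_exists : exists eps : nat -> A, forall j, den j * eps j = rhs j eps.
Proof.
pose F j (f : nat -> A) := (den j)^-1 * rhs j f.
(* Course-of-values recursion: [l n] is the list of the first [n] values. *)
pose fix l n := if n is m.+1 then rcons (l m) (F m (nth 0 (l m))) else [::].
have sl n : size (l n) = n by elim: n => //= n IH; rewrite size_rcons IH.
have nl n i : (i < n)%N -> nth 0 (l n) i = nth 0 (l i.+1) i.
  elim: n => // n IH; rewrite ltnS leq_eqVlt => /predU1P[->//|ltin].
  by rewrite [l n.+1]/= nth_rcons sl ltin IH.
exists (fun j => nth 0 (l j.+1) j) => j.
rewrite /= nth_rcons sl ltnn eqxx /F mulrA mulrV ?mul1r; last exact/odd_unit/den_odd.
case: j => // j; rewrite /rhs; congr (- (a0 * _)).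
by apply: eq_bigr => k _; rewrite nl.
Qed.

(** Modulo 2 all denominators and powers are 1, and for j > 0 the recurrence reduces to the sum of
    C(j, k) over k < j, which is 2^j - 1 and hence odd. *)
Lemma eps_odd (eps : nat -> A) : (forall j, den j * eps j = rhs j eps) ->
  forall j, eqmod2 (eps j) 1.
Proof.
move=> h; elim/ltn_ind => j IH.
have -> : eps j = (den j)^-1 * rhs j eps.
  by rewrite -h mulrA mulVr ?mul1r //; exact/odd_unit/den_odd.
rewrite -[X in eqmod2 _ X]mulr1; apply: eqmod2M; first exact/eqmod2V/den_odd.
case: j IH {h} => // j IH; rewrite /rhs; apply: eqmod2N.
rewrite -[X in eqmod2 _ X]mulr1; apply: eqmod2M => //.
apply: (@eqmod2_trans _ (\sum_(k < j.+1) 'C(j.+1, k)%:R)).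
  apply: eqmod2_sum => k; rewrite -[X in eqmod2 _ X]mulr1; apply: eqmod2M;
    last exact: IH.
  by rewrite -[X in eqmod2 _ X]mulr1; apply: eqmod2M;
    [exact: eqmod2_refl | exact: G_odd].
rewrite -natr_sum.
have : (2 ^ j.+1 = \sum_(i < j.+2) 'C(j.+1, i))%N.
  rewrite -[2%N]/(1 + 1)%N expnDn; apply: eq_bigr => i _.
  by rewrite !exp1n !muln1.
rewrite big_ord_recr /= binn => s2.
have o : odd (\sum_(i < j.+1) 'C(j.+1, i)).
  by have := congr1 odd s2; rewrite oddX oddD /= addbT => /esym /negbFE.
by apply: eqmod2_trans (eqmod2_nat _) _; rewrite o; exact: eqmod2_refl.
Qed.

Lemma bin_shift (z k : nat) : (k <= z)%N ->
  'C(z, k)%:R * q ^+ k * (1 + q) ^+ (z - k) =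
  \sum_(n < z.+1) 'C(z, n)%:R * 'C(n, k)%:R * q ^+ n.
Proof.
move=> kz; rewrite -(big_mkord predT (fun n => 'C(z, n)%:R * 'C(n, k)%:R * q ^+ n)).
rewrite (@big_cat_nat _ _ _ k) //=; last exact: leqW.
rewrite big_nat_cond big1 ?add0r => [|n /andP[/andP[_ nk] _]]; last first.
  by rewrite [X in _ * X%:R]bin_small // mulr0 mul0r.
rewrite -[X in \sum_(X <= _ < _) _]add0n big_addn subSn // exprDn big_mkord mulr_sumr.
apply: eq_bigr => i _; rewrite expr1n mul1r addnC -natrM bin_trinomial; last first.
  by have := ltn_ord i; rewrite ltnS leq_subRL.
by rewrite natrM exprD -mulr_natr; ring.
Qed.

(** After multiplication by [den z], the power (1 + q)^z is split as (1 + q)^k (1 + q)^(z - k) in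
    the k-th term, and [bin_shift] rewrites the second factor. By [inner], the result collapses to
    [e] plus [b] times the series, and the latter cancels against the [b] in [den z]. *)
Lemma newton_expansion (eps : nat -> A) : (forall j, den j * eps j = rhs j eps) ->
  forall z, e / den z = \sum_(j < z.+1) 'C(z, j)%:R * q ^+ j * eps j.
Proof.
move=> h z; have uz := odd_unit (den_odd z).
apply: (mulIr uz); rewrite divrK //.
have inner n : a0 * \sum_(k < n.+1) 'C(n, k)%:R * (1 + q) ^+ k * eps k =
    b * eps n + (if n is 0%N then e else 0).
  rewrite big_ord_recr /= binn mul1r mulrDr; have := h n; rewrite /den.
  case: n => [|n] /=.
    have S0 (F : 'I_0 -> A) : \sum_i F i = 0 by apply: big1 => -[].
    by rewrite S0 => <-; rewrite expr0; ring.
  set s := \sum_(k < _) _ => e'.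
  have -> : a0 * s = - ((a0 * (1 + q) ^+ n.+1 - b) * eps n.+1) by rewrite e' opprK.
  by ring.
have -> : (\sum_(j < z.+1) 'C(z, j)%:R * q ^+ j * eps j) * den z =
   \sum_(n < z.+1) 'C(z, n)%:R * q ^+ n *
      (a0 * \sum_(k < n.+1) 'C(n, k)%:R * (1 + q) ^+ k * eps k)
   - b * \sum_(j < z.+1) 'C(z, j)%:R * q ^+ j * eps j.
  rewrite {1}/den mulrBr [X in _ - X]mulrC; congr (_ - _).
  rewrite mulr_suml.
  transitivity (\sum_(k < z.+1) \sum_(n < z.+1)
      a0 * (1 + q) ^+ k * eps k * ('C(z, n)%:R * 'C(n, k)%:R * q ^+ n)).
    apply: eq_bigr => k _; rewrite -mulr_sumr -bin_shift; last by rewrite -ltnS.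
    have -> : (1 + q) ^+ z = (1 + q) ^+ k * (1 + q) ^+ (z - k).
      by rewrite -exprD subnKC // -ltnS.
    by ring.
  rewrite exchange_big; apply: eq_bigr => n _ /=.
  rewrite mulr_sumr mulr_sumr (big_ord_widen z.+1 (fun k => 'C(z, n)%:R * q ^+ n *
      (a0 * ('C(n, k)%:R * (1 + q) ^+ k * eps k)))) // [RHS]big_mkcond /=.
  apply: eq_bigr => k _; case: ltnP => [_|nk]; first by ring.
  by rewrite [X in _ * (_ * X%:R * _)]bin_small //; ring.
under eq_bigr => n _ do rewrite inner mulrDr.
rewrite big_split /=.
have -> : \sum_(n < z.+1) 'C(z, n)%:R * q ^+ n * (if (n : nat) is 0%N then e else 0) = e.
  by rewrite big_ord_recl /= bin0 expr0 !mul1r big1 ?addr0 // => i _; rewrite mulr0.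
rewrite addrAC mulr_sumr.
rewrite [X in X - _ + _](_ : _ = \sum_(j < z.+1) b * ('C(z, j)%:R * q ^+ j * eps j)).
  by rewrite subrr add0r.
by apply: eq_bigr => j _; ring.
Qed.

End Expansion.
End OddParts.

Section Monomial.
Context {A : comUnitRingType}.
Hypothesis unit_odd : forall y : A, 1 + 2 * y \is a GRing.unit.

Definition falling (j : nat) : {poly A} := \prod_(i < j) ('X - (i%:R)%:P).

Lemma falling_nat (j z : nat) : (falling j).[z%:R] = (z ^_ j)%:R.
Proof.
elim: j => [|j IH]; first by rewrite /falling big_ord0 hornerC.
rewrite /falling big_ord_recr hornerM -/(falling j) IH ffactnSr natrM.
rewrite hornerXsubC; have [jz|zj] := leqP j z; first by rewrite natrB.
by rewrite ffact_small // !mul0r.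
Qed.

Lemma size_falling j : size (falling j) = j.+1.
Proof.
elim: j => [|j IH]; first by rewrite /falling big_ord0 size_poly1.
by rewrite /falling big_ord_recr -/(falling j) size_monicM ?size_XsubC ?IH ?addn2 //;
  [exact: monic_prod_XsubC | exact: monic_neq0 (monicXsubC _)].
Qed.

Lemma falling_lead j : (falling j)`_j = 1.
Proof.
have /monicP := monic_prod_XsubC (index_enum 'I_j) predT (fun i => (i : nat)%:R : A).
by rewrite lead_coefE -/(falling j) size_falling.
Qed.

Definition fact_odd (j : nat) := (j`! %/ 2 ^ logn 2 j`!)%N.

Lemma fact_oddK j : (fact_odd j * 2 ^ logn 2 j`!)%N = j`!.
Proof. by rewrite divnK // pfactor_dvdnn. Qed.

Lemma odd_fact_odd j : odd (fact_odd j).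
Proof.
have := pfactor_coprime (isT : prime 2) (fact_gt0 j) => -[m].
rewrite coprime2n => om e.
by rewrite /fact_odd {1}e mulnK // expn_gt0.
Qed.

Lemma bin_pow2 (z j kap : nat) : (logn 2 j`! <= kap * j)%N ->
  'C(z, j)%:R * (2 ^+ kap) ^+ j =
  (z ^_ j)%:R * (2 ^+ (kap * j - logn 2 j`!) / (fact_odd j)%:R) :> A.
Proof.
move=> vj; have uo : (fact_odd j)%:R \is a @GRing.unit A.
  have := eqmod2_nat (A := A) (fact_odd j); rewrite odd_fact_odd; exact: odd_unit.
apply: (mulIr uo); rewrite mulrA divrK //.
have E : (z ^_ j)%:R = 'C(z, j)%:R * ((fact_odd j)%:R * 2 ^+ logn 2 j`!) :> A.
  by rewrite -bin_ffact natrM; congr (_ * _);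
    rewrite -[in LHS](fact_oddK j) natrM natrX.
by rewrite -exprM -{1}(subnK vj) exprD E; ring.
Qed.

Variables (kap D : nat) (e a0 b w : A).
Hypotheses (e1 : eqmod2 e 1) (a1 : eqmod2 a0 1) (b1 : eqmod2 b 0) (w1 : eqmod2 w 1).
Hypotheses (kap0 : (0 < kap)%N) (vkap : forall j, (j <= D)%N -> (logn 2 j`! < kap)%N).
Hypothesis nil : (2 : A) ^+ (kap * D.+1) = 0.

Let q : A := 2 ^+ kap * w.

(** The passage from falling factorials to monomials is unitriangular. For j > i the valuation of j!
    is less than kap <= kap (j - i), so [cc j] is divisible by a higher power of 2 than [cc i], and
    the terms of higher degree leave the cofactor odd. The hypothesis [nil] cuts Newton's series off
    at degree [D]. *)
Lemma monomial_expansion : exists coef : nat -> A,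
  (forall i, (i <= D)%N -> exists2 u, u \is a GRing.unit &
     coef i = 2 ^+ (kap * i - logn 2 i`!) * u) /\
  (forall z, e / (a0 * (1 + q) ^+ z - b) = \sum_(i < D.+1) coef i * z%:R ^+ i).
Proof.
have q0 : eqmod2 q 0.
  by exists (2 ^+ kap.-1 * w); rewrite /q -{1}(prednK kap0) exprS; ring.
have [eps epsE] := eps_exists unit_odd e a1 b1 q0.
have eps1 := eps_odd unit_odd e1 a1 b1 q0 epsE.
have expan := newton_expansion unit_odd a1 b1 q0 epsE.
have vle j : (j <= D)%N -> (logn 2 j`! <= kap * j)%N.
  case: j => [|j] jD; first by rewrite fact0 logn1.
  by apply: leq_trans (ltnW (vkap jD)) _; rewrite leq_pmulr.
pose U j := w ^+ j * eps j / (fact_odd j)%:R.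
have U1 j : eqmod2 (U j) 1.
  rewrite /U -[X in eqmod2 _ X]mulr1; apply: eqmod2M; last first.
    apply: eqmod2V => //; have := eqmod2_nat (A := A) (fact_odd j).
    by rewrite odd_fact_odd.
  rewrite -[X in eqmod2 _ X]mulr1; apply: eqmod2M => //.
  by rewrite -[X in eqmod2 _ X](expr1n _ j); exact: eqmod2X.
pose cc j := 2 ^+ (kap * j - logn 2 j`!) * U j.
pose P : {poly A} := \sum_(j < D.+1) cc j *: falling j.
exists (fun i => P`_i); split; last first.
  move=> z; rewrite expan.
  have -> : \sum_(i < D.+1) P`_i * z%:R ^+ i = P.[z%:R].
    rewrite (@horner_coef_wide _ D.+1) //.
    apply: leq_trans (size_sum _ _ _) _; apply/bigmax_leqP => j _.
    by apply: leq_trans (size_scale_leq _ _) _; rewrite size_falling.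
  rewrite /P horner_sum.
  pose F j := 'C(z, j)%:R * q ^+ j * eps j.
  have Fz j : (D < j)%N -> F j = 0.
    move=> Dj; rewrite /F /q exprMn -exprM.
    have -> : (kap * j = kap * D.+1 + kap * (j - D.+1))%N by rewrite -mulnDr subnKC.
    by rewrite exprD nil; ring.
  transitivity (\sum_(j < D.+1) F j).
    pose m := maxn z.+1 D.+1.
    transitivity (\sum_(j < m) F j).
      rewrite (big_ord_widen m F (leq_maxl _ _)) big_mkcond; apply: eq_bigr => j _.
      by case: ltnP => // zj; rewrite /F bin_small // !mul0r.
    rewrite [RHS](big_ord_widen m F (leq_maxr _ _)) [RHS]big_mkcond;
      apply: eq_bigr => j _.
    by case: ltnP => // zj; rewrite Fz.
  apply: eq_bigr => j _; rewrite hornerZ falling_nat /F /q exprMn.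
  have jD : (j <= D)%N by rewrite -ltnS.
  have -> : 'C(z, j)%:R * ((2 ^+ kap) ^+ j * w ^+ j) * eps j =
    ('C(z, j)%:R * (2 ^+ kap) ^+ j) * (w ^+ j * eps j) :> A by ring.
  by rewrite bin_pow2 ?vle // /cc /U; ring.
move=> i iD.
suff : exists y, P`_i = 2 ^+ (kap * i - logn 2 i`!) * (U i + 2 * y).
  case=> y Py; exists (U i + 2 * y) => //.
  by apply: odd_unit => //; apply: eqmod2_trans (U1 i); exists y.
have step j : (j <= D)%N -> exists y, cc j * (falling j)`_i =
    2 ^+ (kap * i - logn 2 i`!) * ((if j == i then U i else 0) + 2 * y).
  move=> jD; case: (ltngtP j i) => [ji|ij|->].
  - by exists 0; rewrite nth_default ?size_falling //; ring.
  - have vj := vkap jD.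
    exists (2 ^+ (kap * j - logn 2 j`! - (kap * i - logn 2 i`!).+1) * U j * (falling j)`_i).
    have le : ((kap * i - logn 2 i`!).+1 <= kap * j - logn 2 j`!)%N.
      have : (kap * i + kap <= kap * j)%N by rewrite -mulnSr leq_mul2l ij orbT.
      by move: (kap * i)%N (kap * j)%N vj => u v; lia.
    rewrite /cc -{1}(subnKC le) exprD exprS; ring.
  - by exists 0; rewrite falling_lead /cc; ring.
have sumP (m : nat) : (m <= D.+1)%N -> exists y,
   \sum_(j < m) cc j * (falling j)`_i =
   2 ^+ (kap * i - logn 2 i`!) * ((if (i < m)%N then U i else 0) + 2 * y).
  elim: m => [_|m IH mD]; first by exists 0; rewrite big_ord0 ltn0; ring.
  have [y ye] := IH (ltnW mD); have [x xe] := step m mD.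
  exists (y + x); rewrite big_ord_recr /= ye xe ltnS.
  by case: (ltngtP i m) => im; ring.
have [y ye] := sumP D.+1 (leqnn _).
exists y; rewrite /P coef_sum; under eq_bigr => j _ do rewrite coefZ.
by rewrite ye ltnS iD.
Qed.

End Monomial.

(** * Additive characters modulo a power of two *)

Section Z2t.
Variable t : nat.
Hypothesis t0 : (0 < t)%N.
Let A := 'Z_(2 ^ t).

Lemma gt1_2t : (1 < 2 ^ t)%N.
Proof. by rewrite -{1}(expn0 2) ltn_exp2l. Qed.

Lemma Z2t_nat_eq0 (n : nat) : (n%:R == 0 :> A) = (2 ^ t %| n)%N.
Proof. by rewrite -val_eqE /= val_Zp_nat ?gt1_2t. Qed.

Lemma Z2t_int_eq0 (z : int) : (z%:~R == 0 :> A) = (2 ^ t %| `|z|)%N.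
Proof. by case: z => n;
  rewrite ?NegzE ?abszN ?mulrNz ?oppr_eq0 -pmulrn Z2t_nat_eq0. Qed.

Lemma Z2t_pow0 m : (t <= m)%N -> (2 : A) ^+ m = 0.
Proof. by move=> tm; apply/eqP; rewrite -natrX Z2t_nat_eq0 dvdn_exp2l. Qed.

Lemma Z2t_unit (y : A) : 1 + 2 * y \is a GRing.unit.
Proof.
rewrite -[y]natr_Zp -natrM -[1]/(1%:R) -natrD unitZpE ?gt1_2t //.
by apply: coprimeXl; rewrite coprime2n oddD oddM.
Qed.

Lemma ltn_Z2t (x : A) : (x < 2 ^ t)%N.
Proof. by rewrite -[X in (_ < X)%N](Zp_cast gt1_2t) ltn_ord. Qed.

Section Character.
Context {C : numClosedFieldType}.
Variables (om : C) (h : nat).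
Hypothesis omP : (2 ^ t).-primitive_root om.

Definition chr (x : A) : C := om ^+ (h * x).

Lemma chrD x y : chr (x + y) = chr x * chr y.
Proof.
rewrite /chr -exprD -mulnDr.
rewrite -(expr_mod _ (prim_expr_order omP)) -[RHS](expr_mod _ (prim_expr_order omP)).
congr (_ ^+ _).
have -> : nat_of_ord (x + y) = ((x + y) %% (Zp_trunc (2 ^ t)).+2)%N by [].
move: (nat_of_ord x) (nat_of_ord y) => nx ny.
by rewrite Zp_cast ?gt1_2t // modnMmr.
Qed.

Lemma norm_om : `|om| = 1.
Proof.
have := congr1 (fun z => `|z|) (prim_expr_order omP); rewrite normrX normr1.
move=> e; apply/eqP; rewrite -(@pexpr_eq1 _ _ (2 ^ t)) ?expn_gt0 //.
by rewrite e.
Qed.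

Lemma norm_chr x : `|chr x| = 1.
Proof. by rewrite /chr normrX norm_om expr1n. Qed.

Lemma chr_eq1 x : (chr x == 1) = (h%:R * x == 0).
Proof. by rewrite -(prim_order_dvd omP) -Z2t_nat_eq0 natrM natr_Zp. Qed.

Lemma chr_mulrn x n : chr (x *+ n) = chr x ^+ n.
Proof.
elim: n => [|n IH]; first by rewrite mulr0n expr0 /chr muln0.
by rewrite mulrS exprS chrD IH.
Qed.

End Character.
End Z2t.

Lemma geometric_root (C : idomainType) (w : C) (L : nat) : w ^+ L = 1 ->
  \sum_(l < L) w ^+ l = if w == 1 then L%:R else 0.
Proof.
move=> wL; case: eqP => [->|/eqP w1].
  by under eq_bigr do rewrite expr1n; rewrite sumr_const card_ord.
by have := subrX1 w L; rewrite wL subrr => /esym/eqP;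
  rewrite mulf_eq0 subr_eq0 (negbTE w1) => /eqP.
Qed.

(** * Linear sums for the coefficients of the expansion *)

Section Block.
Variable t : nat.
Hypothesis t0 : (0 < t)%N.
Let A := 'Z_(2 ^ t).
Context {C : numClosedFieldType}.
Variables (om : C) (h : nat).
Hypothesis omP : (2 ^ t).-primitive_root om.
Hypothesis h0 : (0 < h)%N.
Variables (kap D e s : nat) (coef : nat -> A).
Hypotheses (s0 : (0 < s)%N) (se : (s < 2 ^ e.-1)%N) (e0 : (0 < e)%N)
  (kap0 : (0 < kap)%N) (tD : (t < kap * D.+1)%N) (Dt : (kap * D <= t)%N).
Hypothesis coefP : forall i, (i <= D)%N -> exists2 u, u \is a GRing.unit &
     coef i = 2 ^+ (kap * i - logn 2 i`!) * u.
Hypothesis ve : forall i, (i <= D)%N -> (logn 2 i`! <= e)%N.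

Let X := (2 ^ kap)%N.
Let a (j : 'I_D) : A := coef j.+1.
(** A sum of [s] powers of degree j + 1 of integers below [X] is less than 2^(ll j - 1), thanks to
    [se]; so a difference of two such sums lies in an interval of length [L j] centred at 0. That
    [L j] is a power of 2 is what makes the linear sums complete. *)
Let ll (j : 'I_D) : nat := (kap * j.+1 + e)%N.
Let L (j : 'I_D) : nat := (2 ^ ll j)%N.
Let o (j : 'I_D) : int := (2 ^ (ll j).-1)%N%:Z.
Let psi : A -> C := chr om h.

(* Only the coordinates with 2 (j + 1) > D give complete sums. *)
Definition gain (j : 'I_D) : nat :=
  (if D.+1 <= 2 * j.+1 then kap * (D - j.+1) - logn 2 h else 0)%N.

Let L2 j : (L j)%:Z = o j *+ 2.
Proof.
rewrite /o /L; have : (0 < ll j)%N by rewrite addn_gt0 e0 orbT.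
by move: (ll j) => [//|m] _; rewrite -mulr_natl expnS PoszM.
Qed.

Lemma box_sum_triv j : box_sum psi a L o j <= ((L j) ^ 2)%:R.
Proof.
apply: (@le_trans _ _ (\sum_(m < L j) (L j)%:R)).
  apply: ler_sum => m _; apply: le_trans (ler_norm_sum _ _ _) _.
  rewrite (eq_bigr (fun=> 1)) => [|l _]; last by rewrite /psi norm_chr.
  by rewrite sumr_const card_ord.
by rewrite sumr_const card_ord -[_ *+ _]mulr_natr -natrM mulnn.
Qed.

(** When 2 (j + 1) > D, the product of [a j] and [L j] is 0 modulo 2^t, so the inner sum covers
    whole periods and equals 0 or [L j]. It is nonzero only if 2^tau divides [m - o j], which leaves
    at most a proportion 2^(- tau) of the [m]. *)
Lemma box_sum_gain j : box_sum psi a L o j <= (2 ^ (2 * ll j - gain j))%:R.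
Proof.
rewrite /gain; case: ifP => jD; last first.
  by rewrite subn0 mulnC expnM; exact: box_sum_triv.
set v := logn 2 h.
have [u uu au] := coefP (ltn_ord j).
have vj := ve (ltn_ord j).
set c := (kap * j.+1 - logn 2 j.+1`!)%N in au.
pose tau := (t - v - kap * j.+1)%N.
have t2 : (t <= kap * j.+1 + kap * j.+1)%N.
  apply: leq_trans (ltnW tD) _.
  by rewrite addnn -mul2n mulnCA leq_mul2l jD orbT.
have Lcoef y : (y * a j) * (L j)%:R = 0.
  rewrite /a au /L natrX.
  have -> : y * (2 ^+ c * u) * 2 ^+ ll j = y * u * 2 ^+ (c + ll j) :> A.
    by rewrite exprD; ring.
  rewrite Z2t_pow0 ?mulr0 // /c /ll.
  by move: t2 vj; clear; move: (kap * j.+1)%N (logn 2 _) => x y'; lia.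
have inner (m : 'I_(L j)) : `|\sum_(l < L j) psi (a j * ((l%:Z - o j)%:~R * (m%:Z - o j)%:~R))| =
   if h%:R * (a j * (m%:Z - o j)%:~R) == 0 then (L j)%:R else 0.
  pose y := a j * (m%:Z - o j)%:~R.
  have E (l : 'I_(L j)) : psi (a j * ((l%:Z - o j)%:~R * (m%:Z - o j)%:~R)) =
     psi (- (y * (o j)%:~R)) * psi y ^+ l.
    rewrite /psi -chr_mulrn // -chrD //; congr chr.
    by rewrite /y intrB -mulr_natr -pmulrn; ring.
  under eq_bigr => l _ do rewrite E.
  rewrite -mulr_sumr normrM /psi norm_chr // mul1r geometric_root; last first.
    rewrite -chr_mulrn // -[_ *+ _]mulr_natr; apply/eqP; rewrite chr_eq1 //.
    by rewrite /y [a j * _]mulrC Lcoef mulr0.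
  rewrite chr_eq1 //; case: ifP => _; by rewrite ?normr_nat ?normr0.
rewrite /box_sum; under eq_bigr => m _ do rewrite inner.
rewrite -big_mkcond /= sumr_const -[_ *+ _]mulr_natr -natrM ler_nat.
have tl : (tau <= ll j)%N.
  by rewrite /tau /ll; move: t2; move: (kap * j.+1)%N => x; lia.
apply: (@leq_trans (L j * 2 ^ (ll j - tau))); last first.
  rewrite /L -expnD leq_exp2l //.
  have : (kap * (D - j.+1) - v <= tau)%N.
    rewrite /tau -subnDA addnC subnDA leq_sub2r // mulnBr leq_sub2r //.
  by move: tl; move: (ll j) tau (_ - v)%N => x y z; lia.
rewrite leq_mul2l; apply/orP; right.
apply: leq_trans (@card_residue (L j) (2 ^ tau) (2 ^ (ll j - tau)) (2 ^ (ll j).-1) _ _);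
  rewrite ?expn_gt0 -?expnD ?subnKC //.
apply: subset_leq_card; apply/fintype.subsetP => m; rewrite !unfold_in => hm.
rewrite -eqz_nat -!modz_nat eqz_mod_dvd dvdzE -/(o j).
have hm' : h%:R * (a j * (m%:Z - o j)%:~R) = 0 :> A by apply/eqP; exact: hm.
have : h%:R * (2 ^+ c * (m%:Z - o j)%:~R) == 0 :> A.
  have -> : h%:R * (2 ^+ c * (m%:Z - o j)%:~R) =
     u^-1 * (h%:R * (a j * (m%:Z - o j)%:~R)) :> A.
    by rewrite /a au; apply: (mulrI uu); rewrite [RHS]mulVKr //; ring.
  by rewrite hm' mulr0.
have -> : h%:R * (2 ^+ c * (m%:Z - o j)%:~R) = (h%:Z * ((2 ^ c)%N%:Z * (m%:Z - o j)))%:~R :> A.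
  by rewrite !intrM -!pmulrn natrX.
rewrite Z2t_int_eq0 // !abszM !absz_nat; set n := `|_|%N.
have [m' h'] := pfactor_coprime (isT : prime 2) h0; rewrite -/v => ->.
rewrite -mulnA mulnA -mulnA => hd.
have : (2 ^ (t - (v + c)) %| m' * n)%N.
  have [le|/ltnW gt] := leqP (v + c) t; last by rewrite (eqP gt : (_ - _ = 0)%N) dvd1n.
  rewrite -(dvdn_pmul2l (_ : 0 < 2 ^ (v + c)))%N ?expn_gt0 // -expnD subnKC //.
  by move: hd; congr (_ %| _)%N; rewrite expnD; ring.
rewrite Gauss_dvdr; last by rewrite coprimeXl.
apply: dvdn_trans; rewrite dvdn_exp2l // /tau /c.
by rewrite -subnDA leq_sub2l // leq_add2l leq_subr.
Qed.

Lemma box_bounds (uv : {ffun 'I_s -> 'I_X} * {ffun 'I_s -> 'I_X}) (j : 'I_D) :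
  0 <= power_diff D uv j + o j < (L j)%:Z.
Proof.
have X0 : (0 < X)%N by rewrite expn_gt0.
pose S (u : {ffun 'I_s -> 'I_X}) : int := \sum_i (u i)%:Z ^+ j.+1.
have S0 u : 0 <= S u by apply: sumr_ge0 => i _; rewrite exprn_ge0.
have S1 u : S u < o j.
  apply: (@le_lt_trans _ _ (\sum_(i < s) ((X ^ j.+1)%N%:Z))).
    apply: ler_sum => i _; rewrite -!natz -natrX ler_nat.
    by apply: leq_exp2rW; rewrite ltnW.
  rewrite sumr_const card_ord -[_ *+ _]mulr_natr natz -PoszM ltz_nat /ll.
  have -> : ((kap * j.+1 + e).-1 = kap * j.+1 + e.-1)%N by rewrite -subn1 -addnBA // subn1.
  by rewrite expnD -expnM ltn_pmul2l // expn_gt0.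
have -> : power_diff D uv j = S uv.1 - S uv.2.
  by rewrite /power_diff !ffunE !sum_powersE.
have := S0 uv.1; have := S1 uv.1; have := S0 uv.2; have := S1 uv.2.
rewrite L2; move: (S _) (S _) (o j) => x y z h1 h2 h3 h4.
by apply/andP; split; lia.
Qed.

Theorem block_bound :
  `|\sum_(x < X) \sum_(y < X) psi (\sum_(i < D.+1) coef i * (x * y)%:R ^+ i)|
     ^+ (2 * s * (2 * s)) <=
  (X ^ (2 * s * (4 * s - 2)) * vinogradov D s X ^ 2 *
    2 ^ (\sum_(j < D) (2 * ll j - gain j)))%:R.
Proof.
(* The constant coefficient contributes only a factor of modulus 1. *)
have E : \sum_(x < X) \sum_(y < X) psi (\sum_(i < D.+1) coef i * (x * y)%:R ^+ i) =
   psi (coef 0%N) * \sum_(x < X) \sum_(y < X) psi (\sum_j a j * (x * y)%:R ^+ j.+1).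
  rewrite mulr_sumr; apply: eq_bigr => x _; rewrite mulr_sumr; apply: eq_bigr => y _.
  by rewrite big_ord_recl expr0 mulr1 /psi chrD.
rewrite E normrM {1}/psi norm_chr // mul1r.
have LM j : (L j <= (2 ^ (kap * D + e)).+1)%N.
  by apply/leqW; rewrite /L leq_exp2l // leq_add2r leq_mul2l ltn_ord orbT.
have H := bilinear (psi := psi) (@chrD t t0 _ om h omP) (@norm_chr t _ om h omP) a box_bounds LM s0.
apply: (le_trans H).
rewrite !natrM !natrX ler_wpM2l ?mulr_ge0 ?exprn_ge0 //.
rewrite -natrX expn_sum natr_prod; apply: ler_prod => j _.
rewrite box_sum_gain andbT; apply: sumr_ge0 => m _; exact: normr_ge0.
Qed.

End Block.

Local Open Scope complex_scope.

Notation normc := ComplexField.Normc.normc.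

Lemma normc_ge0 (R : rcfType) (z : R[i]) : 0 <= normc z.
Proof. by case: z => a b; exact: sqrtr_ge0. Qed.

(** * Numerical bound for one block *)

Lemma gain_le (h kap D e : nat) (j : 'I_D) : (gain h kap j <= 2 * (kap * j.+1 + e))%N.
Proof.
rewrite /gain; case: ifP => // hj; apply: leq_trans (leq_subr _ _) _.
apply: (@leq_trans (kap * (2 * j.+1))); first by rewrite leq_mul2l; apply/orP; right;
  lia.
by rewrite mulnCA leq_mul2l leq_addr.
Qed.

Lemma sum_ord_double (m : nat) : (2 * \sum_(n < m) n = m * m.-1)%N.
Proof.
elim: m => [|m IH]; first by rewrite big_ord0.
rewrite big_ord_recr /= mulnDr IH; case: m {IH} => // m.
by rewrite /=; ring.
Qed.

(** With n = D - 1 - j, the nontrivial gains are kap n minus the valuation of [h], truncated at 0,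
    for 2 n < D; the sum of these n is about D^2 / 8. *)
Lemma sum_gain (kap D h : nat) :
  (kap * (D * D.-2) <= 8 * (\sum_(j < D) gain h kap j + logn 2 h * D))%N.
Proof.
pose v := logn 2 h.
have h1 : (kap * (\sum_(n < D | n < uphalf D) n) <= \sum_(j < D) gain h kap j + v * D)%N.
  rewrite big_mkcond big_distrr /=.
  have -> : (v * D = \sum_(j < D) v)%N by rewrite sum_nat_const card_ord mulnC.
  rewrite -big_split /= (reindex_inj rev_ord_inj) /=; apply: leq_sum => j _.
  rewrite /gain -/v; have jD := ltn_ord j.
  case: ifP => hj; last by rewrite muln0.
  have -> : (D < 2 * j.+1)%N by lia.
  by rewrite addnC -leq_subLR.
have h2 : (\sum_(n < D | n < uphalf D) n = \sum_(n < uphalf D) n)%N.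
  by rewrite (big_ord_widen D (fun n => n)) // uphalf_half; lia.
have h3 := sum_ord_double (uphalf D); rewrite h2 in h1.
have h4 : (D * D.-2 <= 4 * (uphalf D * (uphalf D).-1))%N.
  have e : (uphalf D * 2 >= D)%N by rewrite uphalf_half; lia.
  by move: (uphalf D) e => m e; nia.
apply: leq_trans (_ : kap * (8 * \sum_(n < uphalf D) n) <= _)%N.
  by rewrite leq_mul2l -[8%N]/(4 * 2)%N -mulnA h3 h4 orbT.
by rewrite mulnCA leq_mul2l h1 orbT.
Qed.

(** The terms in K d^4 agree on both sides, and the multiples of K d^2 coming from the number of
    variables cancel. What remains of order K d^2 is 1/16 from the defect of the mean value, -1/8
    from the gains, 1/128 from the valuation of [h] and, as d >= 8, at most 5/128 from the terms in
    K d: in all -1/64. *)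
Lemma block_exponent (R : realFieldType) (K d v G ga : R) :
  8 <= d -> 0 <= K ->
  K * (d * (d + 1) - 2 * ga) <= K * (d * (d + 1) / 16) ->
  K * (d * (d - 2)) <= 8 * (G + v * d) ->
  128 * v * d <= K * d * d ->
  K * (200 * d ^+ 4 - 20 * d ^+ 2) +
  2 * (18 * d ^+ 3 * (4 * d + 1) + (2 * (d ^+ 2 + d * (4 * d)) - ga) * K) +
  (K * (d * (d + 1)) + 2 * d ^+ 3 - G) <=
  2 * (100 * d ^+ 4) * K + (150 * d ^+ 4 - K * d ^+ 2 / 64).
Proof.
move=> d8 K0 f1 f2 f3; have d0 : 0 <= d by lra.
have f4 : 8 * (K * d) <= K * d * d by rewrite mulrC ler_wpM2l // mulr_ge0.
have f5 : 8 * d ^+ 3 <= d ^+ 4 by rewrite [d ^+ 4]exprS ler_wpM2r // exprn_ge0.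
have f6 : 0 <= d ^+ 3 by rewrite exprn_ge0.
by lra.
Qed.

Section Real.
Context {R : realType}.

(** With x = 1 - 1 / D, the quantity 1 - x^D is 1 / D times the sum of the x^i for i < D, and each
    of these is at least x^D; hence 1 - x^D >= x^D. *)
Lemma saving_half (D : nat) : (0 < D)%N -> (1 - (D%:R : R)^-1) ^+ D <= 1 / 2.
Proof.
move=> D0; have D1 : (1 : R) <= D%:R by rewrite ler1n.
set x := 1 - _; have x0 : 0 <= x by rewrite subr_ge0 invf_le1 // (lt_le_trans ltr01).
have x1 : x <= 1 by rewrite gerBl invr_ge0 ler0n.
have E : 1 - x = (D%:R : R)^-1 by rewrite /x; ring.
have e := subrX1 x D.
have s : D%:R * x ^+ D <= \sum_(i < D) x ^+ i.
  rewrite mulr_natl -[X in _ *+ X](card_ord D) -sumr_const; apply: ler_sum => i _.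
  by apply: ler_wiXn2l => //; apply: ltnW.
have : (D%:R : R)^-1 * (D%:R * x ^+ D) <= (D%:R)^-1 * \sum_(i < D) x ^+ i.
  by rewrite ler_wpM2l // invr_ge0.
rewrite mulrA mulVf ?mul1r ?gt_eqF ?(lt_le_trans ltr01) //.
have -> : (D%:R)^-1 * (\sum_(i < D) x ^+ i) = 1 - x ^+ D.
  by rewrite -E -[RHS]opprB e; ring.
by move=> ?; lra.
Qed.

(** The number 4 D of steps makes the relative defect 2^(-4), small enough against the 1/8 of
    [sum_gain]. *)
Lemma saving_final (D : nat) : (0 < D)%N ->
  D%:R * (D%:R + 1) - 2 * saving D (4 * D) <= D%:R * (D%:R + 1) / 16 :> R.
Proof.
move=> D0; rewrite /saving mulnC exprM.
have h := saving_half D0.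
have h0 : 0 <= (1 - (D%:R : R)^-1) ^+ D.
  by rewrite exprn_ge0 // subr_ge0 invf_le1 ?ltr0n // ler1n.
have h4 : (1 - (D%:R : R)^-1) ^+ D ^+ 4 <= (1 / 2) ^+ 4 by apply: lerXn2r;
  rewrite ?nnegrE //; lra.
have d0 : 0 <= (D%:R : R) * (D%:R + 1) by rewrite mulr_ge0 ?addr_ge0.
move: h4; set y := _ ^+ 4; have -> : (1 / 2 : R) ^+ 4 = 1 / 16 by field.
by move=> h4; nra.
Qed.

Lemma norm_normc (z : R[i]) : `|z| = (normc z)%:C.
Proof. by []. Qed.

Lemma pow2X (x : R) n : pow2 x ^+ n = pow2 (n%:R * x).
Proof.
elim: n => [|n IH]; first by rewrite expr0 mul0r -[X in pow2 X]/(0%:R) pow2_nat.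
by rewrite exprS IH -pow2D -natr1 mulrDl mul1r addrC.
Qed.

Variable t : nat.
Hypothesis t0 : (0 < t)%N.
Let A := 'Z_(2 ^ t).
Variables (om : R[i]) (h : nat).
Hypothesis omP : (2 ^ t).-primitive_root om.
Hypothesis h0 : (0 < h)%N.
Variables (kap D : nat) (coef : nat -> A).
Hypotheses (D8 : (8 <= D)%N) (kap0 : (0 < kap)%N)
  (tD : (t < kap * D.+1)%N) (Dt : (kap * D <= t)%N).
Hypothesis coefP : forall i, (i <= D)%N -> exists2 u, u \is a GRing.unit &
     coef i = 2 ^+ (kap * i - logn 2 i`!) * u.
Hypothesis vh : (128 * logn 2 h <= kap * D)%N.

Let X := (2 ^ kap)%N.

(** This is [block_bound] with s = 5 D^2, after a root of order 100 D^4: [block_exponent] provides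
    150 / 100 = 3 / 2 for the loss and 64 * 100 = 6400 in the saving. *)
Lemma block_real :
  normc (\sum_(x < X) \sum_(y < X) chr om h (\sum_(i < D.+1) coef i * (x * y)%:R ^+ i))
  <= X%:R ^+ 2 * pow2 (3 / 2 - kap%:R / (6400 * D%:R ^+ 2)).
Proof.
set S := \sum_(x < X) _.
have [s sdef] : {s | s = (5 * D ^ 2)%N} by exists (5 * D ^ 2)%N.
have [e edef] : {e | e = (D ^ 2)%N} by exists (D ^ 2)%N.
have D0 : (0 < D)%N by apply: leq_trans D8.
have s0 : (0 < s)%N by rewrite sdef muln_gt0 expn_gt0 D0.
have e0 : (0 < e)%N by rewrite edef expn_gt0 D0.
have se : (s < 2 ^ e.-1)%N.
  apply: (@leq_ltn_trans (2 ^ D.+1)); first by rewrite sdef; exact: five_sq_le.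
  by rewrite ltn_exp2l // edef -mulnn; clear -D8; nia.
have ve i : (i <= D)%N -> (logn 2 i`! <= e)%N.
  move=> iD; apply: leq_trans (logn2_fact i) _.
  by rewrite edef -mulnn leq_mul.
have := block_bound t0 omP h0 s0 se e0 kap0 tD Dt coefP ve.
rewrite -/S.
set n := (2 * s * (2 * s))%N.
rewrite norm_normc -rmorphXn -(rmorph_nat (real_complex R)) lecR.
have n0 : (0 < n)%N by rewrite !muln_gt0 s0.
move=> H;
  rewrite -(@ler_pXn2r _ n) ?nnegrE ?normc_ge0 ?mulr_ge0 ?exprn_ge0 ?(ltW (pow2_gt0 _)) //.
apply: le_trans H _.
have VM := @vinogradov_mean_value R D (4 * D) kap D8 (leqnn _).
have sE : (D ^ 2 + D * (4 * D) = s)%N by rewrite sdef -mulnn; ring.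
rewrite sE in VM; rewrite natrM natrM [X in _ * X * _]natrX.
set VE := (X in _ <= pow2 X) in VM.
apply: (@le_trans _ _ ((X ^ (2 * s * (4 * s - 2)))%N%:R * pow2 VE ^+ 2 *
   (2 ^ (\sum_(j < D) (2 * (kap * j.+1 + e) - gain h kap j)))%N%:R)).
  by rewrite ler_wpM2r // ler_wpM2l //; apply: lerXn2r;
    rewrite ?nnegrE ?(ltW (pow2_gt0 _)).
rewrite exprMn -!exprM -natrX /X -!expnM -!pow2_nat !pow2X -!pow2D; apply: le_pow2.
set G : R := (\sum_(j < D) gain h kap j)%:R.
set d : R := D%:R; set K : R := kap%:R; set v : R := (logn 2 h)%:R.
have sumE : (\sum_(j < D) (2 * (kap * j.+1 + e) - gain h kap j))%:R =
   K * (d * (d + 1)) + 2 * d ^+ 3 - G.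
  have E : (\sum_(j < D) (2 * (kap * j.+1 + e) - gain h kap j) +
     \sum_(j < D) gain h kap j = kap * (D * D.+1) + 2 * D ^ 3)%N.
    rewrite -big_split /= (eq_bigr (fun j : 'I_D => kap * (2 * j.+1) + 2 * e)%N);
      last first.
      by move=> j _; rewrite subnK ?gain_le //; ring.
    rewrite big_split /= sum_nat_const card_ord -big_distrr /= -big_distrr /=.
    have := sum_ord_double D.+1; rewrite big_ord_recl add0n /= => ->.
    by rewrite edef; ring.
  have := congr1 (fun m => m%:R : R) E; rewrite natrD -/G => /(canRL (addrK _)) ->.
  by rewrite natrD (natrM _ kap) (natrM _ D) (natrM _ 2) natrX -natr1.
rewrite sumE.
have d8 : 8 <= d by rewrite ler_nat.
have K0 : 0 <= K by [].
have f1 := ler_wpM2l K0 (saving_final D0); rewrite -/d in f1.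
have f2 : K * (d * (d - 2)) <= 8 * (G + v * d).
  rewrite -natrB; last by apply: leq_trans D8.
  by rewrite -!natrM -natrD -[8]/(8%:R) -natrM ler_nat subn2 sum_gain.
have f3 : 128 * v * d <= K * d * d.
  by rewrite -[128]/(128%:R) -!natrM ler_nat leq_mul2r vh orbT.
have d0 : d != 0 by rewrite pnatr_eq0 -lt0n.
have sR : s%:R = 5 * d ^+ 2 :> R by rewrite sdef natrM natrX.
have s4R : (4 * s - 2)%:R = 20 * d ^+ 2 - 2 :> R.
  by rewrite natrB ?natrM ?sR //; [ring | lia].
have nE : n%:R = 100 * d ^+ 4 :> R by rewrite /n !natrM sR; ring.
rewrite (natrX _ D 2) -/d.
have -> : n%:R * (3 / 2 - K / (6400 * d ^+ 2)) = 150 * d ^+ 4 - K * d ^+ 2 / 64.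
  by rewrite nE; field.
have l4 : (4 * D)%:R = 4 * d :> R by rewrite natrM.
have kE : (kap * (2 * s * (4 * s - 2)))%:R = K * (200 * d ^+ 4 - 20 * d ^+ 2) :> R.
  by rewrite !natrM sR s4R -/K; ring.
rewrite kE natrM nE /VE -/K -/d l4.
move: f1; set ga := saving D _ => f1.
exact: (block_exponent d8 K0 f1 f2 f3).
Qed.

End Real.

(** * From one block to the exponential sum *)

Lemma sum_shift_le (C : numDomainType) (f : nat -> C) (N z : nat) :
  (forall n, `|f n| <= 1) ->
  `|\sum_(n < N) f n - \sum_(n < N) f (n + z)%N| <= (2 * z)%:R.
Proof.
move=> f1; elim: z => [|z IH].
  under [X in _ - X]eq_bigr => n _ do rewrite addn0.
  by rewrite subrr normr0.
have E : \sum_(n < N) f (n + z)%N - \sum_(n < N) f (n + z.+1)%N = f z - f (N + z)%N.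
  elim: N {IH} => [|N IHN]; first by rewrite !big_ord0 subrr add0n subrr.
  rewrite !big_ord_recr /= opprD addrACA IHN addnS addSn.
  by rewrite [f z - _]addrC addrACA addNr add0r.
have -> : \sum_(n < N) f n - \sum_(n < N) f (n + z.+1)%N =
   (\sum_(n < N) f n - \sum_(n < N) f (n + z)%N) + (f z - f (N + z)%N).
  by rewrite -E addrA subrK.
apply: le_trans (ler_normD _ _) _; rewrite mulnSr natrD; apply: lerD => //.
by apply: le_trans (ler_normB _ _) _; rewrite -[2%N]/(1 + 1)%N natrD lerD.
Qed.

Section ExpSum.
Context {R : realType}.
Variable t : nat.
Hypothesis t0 : (0 < t)%N.
Let A := 'Z_(2 ^ t).
Variables (om : R[i]) (h : nat).
Hypothesis omP : (2 ^ t).-primitive_root om.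
Hypothesis h0 : (0 < h)%N.
Variables (a b c g w : A) (kap D m : nat).
Hypotheses (a1 : eqmod2 a 1) (b0 : eqmod2 b 0) (g1 : eqmod2 g 1) (w1 : eqmod2 w 1).
Hypothesis gm : g ^+ (2 ^ m) = 1 + 2 ^+ kap * w.
Hypotheses (D8 : (8 <= D)%N) (kap0 : (0 < kap)%N) (kD : (D ^ 2 < kap)%N)
  (tD : (t < kap * D.+1)%N) (Dt : (kap * D <= t)%N).
Hypothesis vh : (128 * logn 2 h <= kap * D)%N.

Let X := (2 ^ kap)%N.
Let u (n : nat) : A := a / (g ^+ n - b) + c.
Let B : R := pow2 (3 / 2 - kap%:R / (6400 * D%:R ^+ 2)).

(** Since g^(n + 2^m z) = g^n (1 + q)^z, [monomial_expansion] applies with [a0] equal to g^n. The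
    coefficients vary with [n], but the bound uses only their valuations. *)
Lemma block_at (n : nat) :
  `|\sum_(x < X) \sum_(y < X) chr om h (u (n + 2 ^ m * (x * y)))| <= (X%:R ^+ 2 * B)%:C.
Proof.
have vk j : (j <= D)%N -> (logn 2 j`! < kap)%N.
  move=> jD; apply: leq_ltn_trans (logn2_fact j) _; apply: leq_ltn_trans kD.
  by rewrite -mulnn leq_mul.
have nil : (2 : A) ^+ (kap * D.+1) = 0 by apply: Z2t_pow0 => //; exact: ltnW.
have gn : eqmod2 (g ^+ n) 1.
  by rewrite -[X in eqmod2 _ X](expr1n _ n); exact: eqmod2X.
have [coef [coefP expan]] :=
  monomial_expansion (@Z2t_unit t t0) a1 gn b0 w1 kap0 vk nil.
have := block_real t0 omP h0 D8 kap0 tD Dt coefP vh.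
rewrite -/X -/B -lecR -norm_normc; apply: le_trans.
rewrite le_eqVlt; apply/orP; left; apply/eqP.
have E (x y : 'I_X) : chr om h (u (n + 2 ^ m * (x * y))) =
   chr om h c * chr om h (\sum_(i < D.+1) coef i * (x * y)%:R ^+ i).
  rewrite -expan /u exprD exprM gm chrD //; exact: mulrC.
under eq_bigr => x _ do under eq_bigr => y _ do rewrite E.
under eq_bigr => x _ do rewrite -mulr_sumr.
by rewrite -mulr_sumr normrM norm_chr // mul1r.
Qed.

Theorem exp_sum (L N : nat) :
  `|\sum_(n < N) chr om h (u (L + n))| <=
  (N%:R * B + (2 * (2 ^ m * X ^ 2))%:R)%:C.
Proof.
set S := \sum_(n < N) _.
have X0 : 0 < (X ^ 2)%:R :> R[i] by rewrite ltr0n !expn_gt0.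
rewrite -(ler_pM2l X0).
have E : (X ^ 2)%:R * `|S| = `|\sum_(x < X) \sum_(y < X) S|.
  rewrite !sumr_const !card_ord -mulrnA mulnn -[S *+ _]mulr_natl normrM.
  by rewrite normr_nat.
pose T (z : nat) : R[i] := \sum_(n < N) chr om h (u (L + n + z)).
have shift z : `|S - T z| <= (2 * z)%:R.
  have := @sum_shift_le _ (fun n => chr om h (u (L + n))) N z.
  rewrite /S /T; under [X in _ - X]eq_bigr => n _ do rewrite addnA.
  by apply=> n; rewrite norm_chr.
rewrite E.
have -> : \sum_(x < X) \sum_(y < X) S =
   \sum_(n < N) \sum_(x < X) \sum_(y < X) chr om h (u (L + n + 2 ^ m * (x * y))) +
   \sum_(x < X) \sum_(y < X) (S - T (2 ^ m * (x * y))%N).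
  have -> : \sum_(n < N) \sum_(x < X) \sum_(y < X) chr om h (u (L + n + 2 ^ m * (x * y))) =
     \sum_(x < X) \sum_(y < X) T (2 ^ m * (x * y))%N.
    by rewrite exchange_big; apply: eq_bigr => x _; rewrite exchange_big.
  rewrite -big_split; apply: eq_bigr => x _; rewrite -big_split; apply: eq_bigr => y _.
  by rewrite /= addrC subrK.
apply: le_trans (ler_normD _ _) _.
rewrite rmorphD mulrDr; apply: lerD.
  apply: le_trans (ler_norm_sum _ _ _) _.
  apply: (@le_trans _ _ (\sum_(n < N) (X%:R ^+ 2 * B)%:C)).
    by apply: ler_sum => n _; exact: block_at.
  rewrite sumr_const card_ord -[_ *+ _]mulr_natl.
  rewrite -(rmorph_nat (real_complex R) N) -(rmorph_nat (real_complex R) (X ^ 2)).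
  by rewrite -!rmorphM natrX /= mulrCA.
apply: le_trans (ler_norm_sum _ _ _) _.
apply: (@le_trans _ _ (\sum_(x < X) \sum_(y < X) (2 * (2 ^ m * X ^ 2))%:R)).
  apply: ler_sum => x _; apply: le_trans (ler_norm_sum _ _ _) _.
  apply: ler_sum => y _; apply: le_trans (shift _) _.
  rewrite ler_nat leq_mul2l /= leq_mul2l -mulnn; apply/orP; right.
  by apply: leq_mul; apply: ltnW.
rewrite !sumr_const !card_ord -mulrnA mulnn rmorph_nat.
by rewrite -[_ *+ (X ^ 2)]mulr_natl.
Qed.

End ExpSum.

(** * Roots of unity and smoothing *)

Lemma normc_norm_le (R : realType) (z : R[i]) (x : R) : (normc z <= x) = (`|z| <= x%:C).
Proof. by rewrite -lecR norm_normc. Qed.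

Section RootOfUnity.
Context {R : realType}.
Variable M : nat.
Hypothesis M0 : (0 < M)%N.

Definition angle : R := pi *+ 2 / M%:R.
Definition unit_root : R[i] := cos angle +i* sin angle.
Local Notation om := unit_root.

Lemma unit_rootX n : om ^+ n = cos (n%:R * angle) +i* sin (n%:R * angle).
Proof.
elim: n => [|n IH]; first by rewrite expr0 mul0r cos0 sin0.
rewrite exprS IH -natr1 mulrDl mul1r [_ + angle]addrC cosD sinD /unit_root.
by apply/eqP; rewrite eq_complex /=; apply/andP; split; apply/eqP; ring.
Qed.

Lemma unit_rootM : om ^+ M = 1.
Proof.
rewrite unit_rootX /angle mulrC divfK ?pnatr_eq0 -?lt0n //.
by rewrite cos2pi; have := sinD2pi (0 : R); rewrite add0r sin0 => ->.
Qed.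

Lemma norm_unit_root n : `|om ^+ n| = 1.
Proof.
have := congr1 (fun z => `|z|) unit_rootM; rewrite normrX normr1 => e.
have o1 : `|om| = 1 by apply/eqP; rewrite -(@pexpr_eq1 _ _ M) // e.
by rewrite normrX o1 expr1n.
Qed.

Definition dist (h : nat) : nat := minn h (M - h).

(* Doubling the angle until it reaches [pi/2, pi], where 1 - z has real part at
   least 1. *)
Lemma unit_root_half h : (0 < h)%N -> (2 * h <= M)%N ->
  (2 * h)%:R <= M%:R * normc (1 - om ^+ h).
Proof.
have [n] := ubnP (M - h); elim: n h => // n IH h hn h0 hM.
have [h4|h4] := leqP M (4 * h); last first.
  have := IH (2 * h)%N _ _ _.
  have -> : 1 - om ^+ (2 * h) = (1 - om ^+ h) * (1 + om ^+ h).
    by rewrite mulnC exprM; ring.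
  move=> /(_ ltac:(lia) ltac:(lia) ltac:(lia)).
  have : normc (1 + om ^+ h) <= 2.
    rewrite normc_norm_le; apply: le_trans (ler_normD _ _) _.
    by rewrite normr1 norm_unit_root rmorph_nat; exact: lexx.
  rewrite ComplexField.Normc.normcM !natrM; have := normc_ge0 (1 - om ^+ h).
  have : 0 <= M%:R :> R by [].
  move: (normc _) (normc _) => y x M1 x0 y2 H.
  have : M%:R * (x * y) <= M%:R * (x * 2) by rewrite ler_wpM2l // ler_wpM2l.
  by lra.
have MR : 0 < M%:R :> R by rewrite ltr0n.
have : cos (h%:R * angle) <= 0 :> R.
  have -> : h%:R * angle = (h%:R * angle - pi / 2) + pi / 2 :> R by ring.
  rewrite cosDpihalf oppr_le0; apply: sin_ge0_pi.
  have p0 := pi_gt0 R.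
  have e : h%:R * angle = pi * ((2 * h)%:R / M%:R) :> R.
    by rewrite /angle natrM mulr_natr; ring.
  rewrite e.
  have le1 : (2 * h)%:R / M%:R <= 1 :> R by rewrite ler_pdivrMr // mul1r ler_nat.
  have ge1 : 1 / 2 <= (2 * h)%:R / M%:R :> R.
    rewrite ler_pdivlMr // natrM.
    by move: h4; rewrite -(ler_nat R) natrM; lra.
  by apply/andP; split; nra.
move=> c0; apply: (@le_trans _ _ (M%:R * 1)); first by rewrite mulr1 ler_nat.
rewrite ler_wpM2l // unit_rootX.
rewrite /ComplexField.Normc.normc /= -[X in X <= _](sqrtr1).
rewrite ler_sqrt; last by rewrite addr_ge0 ?sqr_ge0.
by rewrite -[X in X <= _]addr0 lerD ?sqr_ge0 // expr_ge1 //; nra.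
Qed.

Lemma unit_root_dist h : (0 < h < M)%N ->
  (2 * dist h)%:R <= M%:R * normc (1 - om ^+ h).
Proof.
move=> /andP[h0 hM]; rewrite /dist.
have [h2|h2] := leqP (2 * h) M.
  by rewrite (minn_idPl _); [exact: unit_root_half | lia].
rewrite (minn_idPr _); last by lia.
have -> : normc (1 - om ^+ h) = normc (1 - om ^+ (M - h)).
  apply: (@complexI R);
    rewrite -!norm_normc -[LHS]mul1r -[X in X * _](norm_unit_root (M - h)).
  rewrite -normrM mulrBr mulr1 -exprD subnK; last exact: ltnW.
  by rewrite unit_rootM distrC.
by apply: unit_root_half; lia.
Qed.

(** An order [m] smaller than [M] would contradict [unit_root_dist], which keeps om^m away from
    1. *)
Lemma unit_root_prim : M.-primitive_root om.
Proof.
have [m mP mM] := prim_order_exists M0 unit_rootM.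
have : (m <= M)%N by exact: dvdn_leq.
rewrite leq_eqVlt => /predU1P[<- //|ltmM].
have m0 := prim_order_gt0 mP.
have := @unit_root_dist m; rewrite m0 ltmM => /(_ isT).
rewrite (prim_expr_order mP) subrr ComplexField.Normc.normc0 mulr0 lern0 muln_eq0 /=.
by rewrite /dist /minn; case: ifP => _; lia.
Qed.

Lemma geometric_norm h L : (0 < h < M)%N ->
  (dist h)%:R * normc (\sum_(l < L) om ^+ (h * l)) <= M%:R.
Proof.
move=> hM; have := unit_root_dist hM.
have := subrX1 (om ^+ h) L; under eq_bigr => l _ do rewrite -exprM.
move/(congr1 (@ComplexField.Normc.normc R)); rewrite ComplexField.Normc.normcM.
set g := normc (\sum_(l < L) _).
have -> : normc (om ^+ h - 1) = normc (1 - om ^+ h).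
  by apply: (@complexI R); rewrite -!norm_normc distrC.
have : normc (om ^+ h ^+ L - 1) <= 2.
  rewrite normc_norm_le -exprM; apply: le_trans (ler_normB _ _) _.
  by rewrite normr1 norm_unit_root rmorph_nat; exact: lexx.
have g0 : 0 <= g by exact: normc_ge0.
move: (normc _) (normc _) => y x x2 xe H; rewrite natrM in H; rewrite xe in x2.
have : 2 * (dist h)%:R * g <= M%:R * y * g by rewrite ler_wpM2r.
have : M%:R * (y * g) <= M%:R * 2 by rewrite ler_wpM2l.
by lra.
Qed.

End RootOfUnity.

Lemma sum_inv_sq_tail (R : realFieldType) (H n : nat) : (0 < H)%N -> (H <= n)%N ->
  \sum_(k < n.+1 | (H < k)%N) (k%:R ^+ 2)^-1 <= H%:R^-1 - n%:R^-1 :> R.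
Proof.
move=> H0; elim: n => [|n IH]; first by rewrite leqn0 => /eqP e; rewrite e in H0.
rewrite leq_eqVlt => /predU1P[->|Hn].
  rewrite subrr big1 // => i ni; have := ltn_ord i; lia.
rewrite big_mkcond big_ord_recr /= -big_mkcond /= Hn.
have n0 : (0 < n)%N by exact: (leq_trans H0 Hn).
have n1 : 0 < n%:R :> R by rewrite ltr0n.
have : ((n.+1)%:R ^+ 2)^-1 <= n%:R^-1 - (n.+1)%:R^-1 :> R.
  have -> : n%:R^-1 - (n.+1)%:R^-1 = (n%:R * (n.+1)%:R)^-1 :> R.
    by rewrite -natr1; field; rewrite !gt_eqF //; lra.
  rewrite lef_pV2 ?posrE ?exprn_gt0 ?mulr_gt0 ?ltr0n // expr2 ler_wpM2r //.
  by rewrite ler_nat.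
move=> b; have := lerD (IH Hn) b; rewrite addrA subrK.
exact.
Qed.

(** * Counting points in arcs by a smoothed indicator function *)

Section Smoothing.
Context {R : realType}.
Variables (t w : nat).
Hypothesis t0 : (0 < t)%N.
Hypothesis wt : (w <= t)%N.
Let M := (2 ^ t)%N.
(** [W] is the length of the smoothing window, a proportion 2^(- w) of the circle; [H] is the height
    above which frequencies are estimated trivially. *)
Let W := (2 ^ (t - w))%N.
Let H := (2 ^ (2 * w))%N.
Let om : R[i] := unit_root M.
Variables (p : nat -> nat) (N : nat) (B : R).
Let S (h : nat) : R[i] := \sum_(n < N) om ^+ (h * p n).
Hypothesis SB : forall h, (0 < h < M)%N -> (logn 2 h <= 2 * w)%N -> normc (S h) <= B.

Let M0 : (0 < M)%N. Proof. by rewrite expn_gt0. Qed.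
Let omP := unit_root_prim M0 : M.-primitive_root om.

Lemma orthogonality (x y : nat) :
  \sum_(h < M) om ^+ (h * x) * (om ^- (h * y)) = (M * (x == y %[mod M]))%:R.
Proof.
have ou : om \is a GRing.unit.
  by rewrite unitfE -normr_eq0 (norm_om omP) oner_eq0.
have E (h : 'I_M) : om ^+ (h * x) * (om ^- (h * y)) = (om ^+ x / om ^+ y) ^+ h.
  by rewrite expr_div_n -!exprM ![(_ * h)%N]mulnC.
under eq_bigr => h _ do rewrite E.
rewrite geometric_root; last first.
  by rewrite expr_div_n -!exprM ![(_ * M)%N]mulnC !exprM (unit_rootM M0) !expr1n divr1.
rewrite -subr_eq0 -(inj_eq (mulIr (unitrX y ou))) mulrBl divrK ?unitrX // mul1r mul0r.
by rewrite subr_eq0 (eq_prim_root_expr omP); case: eqP; rewrite ?muln1 ?muln0.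
Qed.

Let B0 : 0 <= B.
Proof.
apply: le_trans (SB (h := 1) _ _); rewrite ?normc_ge0 //.
by rewrite gt1_2t.
Qed.

Let SN h : normc (S h) <= N%:R.
Proof.
rewrite normc_norm_le; apply: le_trans (ler_norm_sum _ _ _) _.
under eq_bigr => n _ do rewrite norm_unit_root //.
by rewrite sumr_const card_ord rmorph_nat.
Qed.

Let P (L h : nat) : R[i] := \sum_(l < L) om ^+ (h * l).

Let normP L h : normc (P L h) <= L%:R.
Proof.
rewrite normc_norm_le; apply: le_trans (ler_norm_sum _ _ _) _.
under eq_bigr => n _ do rewrite norm_unit_root //.
by rewrite sumr_const card_ord rmorph_nat.
Qed.

Let T (k : nat) : R :=
  if (k <= H)%N then B * W%:R * M%:R else N%:R * M%:R ^+ 2 / k%:R ^+ 2.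

Let T0 k : 0 <= T k.
Proof.
rewrite /T; case: ifP => _; first by rewrite !mulr_ge0.
by rewrite divr_ge0 ?mulr_ge0 ?exprn_ge0.
Qed.

Let dist_gt0 h : (0 < h < M)%N -> (0 < dist M h)%N.
Proof. by rewrite /dist /minn; case: ifP => _; lia. Qed.

(** At a distance at most [H] from 0 modulo [M], the valuation of [h] is at most 2 w, because
    2^(logn 2 h) divides both [h] and [M - h]; so [SB] applies, with the trivial bound [W] for one
    geometric sum. At larger distances the decay comes from the two geometric sums, each at most M
    divided by the distance. *)
Lemma term_bound h L : (0 < h < M)%N ->
  normc (S h) * normc (P W h) * normc (P L h) <= T (dist M h).
Proof.
move=> hM; have d0 := dist_gt0 hM.
have dR : 1 <= (dist M h)%:R :> R by rewrite ler1n.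
have gP L' := @geometric_norm R M M0 h L' hM.
have p0 := normc_ge0 (P W h); have q0 := normc_ge0 (P L h).
have s0 := normc_ge0 (S h).
have W0 : 0 <= W%:R :> R by [].
have N0 : 0 <= N%:R :> R by [].
have g1 := gP W; have g2 := gP L.
rewrite -/om -/(P _ h) in g1 g2.
rewrite /T; case: ifP => dH.
  have SBh : normc (S h) <= B.
    apply: SB => //; have h0 : (0 < h)%N by case/andP: hM.
    have d1 : (2 ^ logn 2 h %| h)%N by exact: pfactor_dvdnn.
    have vt : (logn 2 h <= t)%N.
      rewrite -(leq_exp2l (m := 2)) //; apply: leq_trans (dvdn_leq h0 d1) _.
      by case/andP: hM => _ /ltnW.
    have d2 : (2 ^ logn 2 h %| M - h)%N by rewrite dvdn_subr ?dvdn_exp2l //;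
      case/andP: hM => _ /ltnW.
    rewrite -(leq_exp2l (m := 2)) //; apply: leq_trans _ dH.
    by apply: dvdn_leq d0 _; rewrite /dist /minn; case: ifP.
  have Q : normc (P L h) <= M%:R.
    by apply: le_trans g2; rewrite -[X in X <= _]mul1r ler_wpM2r.
  by rewrite ler_pM ?mulr_ge0 // ler_pM // normP.
rewrite ler_pdivlMr ?exprn_gt0 ?(lt_le_trans ltr01) //.
rewrite (_ : _ * (dist M h)%:R ^+ 2 = normc (S h) * (((dist M h)%:R * normc (P W h)) *
  ((dist M h)%:R * normc (P L h)))); last by ring.
rewrite ler_pM ?SN ?mulr_ge0 // ?(le_trans ler01) //.
by rewrite expr2 ler_pM // mulr_ge0 // (le_trans ler01).
Qed.

Lemma sum_T : (H <= M)%N ->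
  \sum_(h < M | (0 < h)%N) T (dist M h) <=
  2 * (2 * H%:R * (B * W%:R * M%:R) + N%:R * M%:R ^+ 2 / H%:R).
Proof.
move=> HM.
have bound : \sum_(h < M | (0 < h)%N) T h <= 2 * H%:R * (B * W%:R * M%:R) + N%:R * M%:R ^+ 2 / H%:R.
  rewrite (bigID (fun h : 'I_M => (h <= H)%N)) /=; apply: lerD.
    apply: (@le_trans _ _ (\sum_(h < M | (0 < h)%N && (h <= H)%N) B * W%:R * M%:R)).
      by apply: ler_sum => h /andP[_ hH]; rewrite /T hH.
    rewrite sumr_const -[_ *+ _]mulr_natl ler_wpM2r ?mulr_ge0 // -natrM ler_nat.
    apply: leq_trans (subset_leq_card _) (leq_trans (card_ord_lt M H.+1) _).
      by apply/fintype.subsetP => h; rewrite !unfold_in => /andP[].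
    by rewrite mul2n -addnn -addn1 leq_add2l expn_gt0.
  apply: (@le_trans _ _ (\sum_(h < M.+1 | (H < h)%N) N%:R * M%:R ^+ 2 * (h%:R ^+ 2)^-1)).
    rewrite [leRHS]big_mkcond big_ord_recr /= -[leLHS]addr0; apply: lerD; last first.
      by case: ifP => // _; rewrite mulr_ge0 ?invr_ge0 ?mulr_ge0 ?exprn_ge0.
    rewrite -big_mkcond le_eqVlt; apply/orP; left; apply/eqP; apply: eq_big => h.
      by rewrite -ltnNge; case: (ltnP H h) => h1;
        rewrite ?andbF // andbT (leq_ltn_trans _ h1).
    by move=> /andP[_ /negbTE hH]; rewrite /T hH.
  rewrite -mulr_sumr ler_wpM2l ?mulr_ge0 ?exprn_ge0 //.
  apply: le_trans (sum_inv_sq_tail _ _ HM) _; rewrite ?expn_gt0 //.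
  by rewrite gerBl invr_ge0.
have le h : (0 < h < M)%N -> T (dist M h) <= T h + T (M - h)%N.
  by rewrite /dist /minn; case: ifP => _ _; rewrite ?lerDl ?lerDr T0.
apply: le_trans (_ : \sum_(h < M | (0 < h)%N) (T h + T (M - h)%N) <= _).
  by apply: ler_sum => h h0; apply: le; rewrite h0 ltn_ord.
rewrite big_split /= mulrDl mul1r; apply: lerD => //; apply: le_trans bound.
rewrite -(big_geq_mkord 1 M predT T) -(big_geq_mkord 1 M predT (fun h => T (M - h)%N)).
rewrite [leRHS]big_nat_rev /= le_eqVlt; apply/orP; left; apply/eqP.
by apply: eq_big_nat => h _; rewrite add1n subSS.
Qed.

Let om_inv k : om ^- k = (om ^+ k)^*.
Proof. by rewrite invC_norm norm_unit_root // expr1n invr1 mul1r. Qed.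

(** A point of an arc of [l] points, moved by any of the [W] shifts, stays in the arc of l + W
    points: the right-hand side is [W] times a trapezoidal majorant of the indicator function. *)
Lemma window_le (A l x : nat) :
  (W * [exists j : 'I_l, x == A + j %[mod M]] <=
   \sum_(i < W) \sum_(j < l + W) (x + i == A + j %[mod M]))%N.
Proof.
case: existsP => [[j0 /eqP xj]|_]; last by rewrite muln0.
rewrite muln1 -[W in X in (X <= _)%N](card_ord W) -sum1_card; apply: leq_sum => i _.
have ji : (j0 + i < l + W)%N by have := ltn_ord j0; have := ltn_ord i; lia.
rewrite (bigD1 (Ordinal ji)) //= addnA -modnDml xj modnDml eqxx.
exact: leq_addr.
Qed.

(** Frequency 0 gives N (l + W) / M, that is the main term and N / 2^w; the frequencies above [H]
    give 2 N M / (W H) = 2 N / 2^w, and those up to [H] the term in [B]. *)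
Theorem smooth_count (A l : nat) : (2 * w <= t)%N ->
  (\sum_(n < N) [exists j : 'I_l, p n == A + j %[mod M]])%:R <=
  N%:R * l%:R / M%:R + 3 * N%:R / (2 ^ w)%:R + 4 * (2 ^ (2 * w))%:R * B :> R.
Proof.
move=> w2t; set cnt := (\sum_(n < N) _)%N.
have HM : (H <= M)%N by rewrite leq_exp2l.
have step1 : (M * (W * cnt) <= M * \sum_(n < N) \sum_(i < W) \sum_(j < l + W)
    (p n + i == A + j %[mod M]))%N.
  by rewrite leq_mul2l big_distrr leq_sum ?orbT // => n _; exact: window_le.
pose Q h := \sum_(j < l + W) om ^- (h * (A + j)).
have step2 : (M * \sum_(n < N) \sum_(i < W) \sum_(j < l + W)
    (p n + i == A + j %[mod M]))%:R = \sum_(h < M) S h * P W h * Q h.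
  rewrite big_distrr natr_sum /=.
  transitivity (\sum_(n < N) \sum_(h < M) om ^+ (h * p n) * P W h * Q h).
    apply: eq_bigr => n _; rewrite big_distrr natr_sum /=.
    transitivity (\sum_(i < W) \sum_(h < M) om ^+ (h * p n) * om ^+ (h * i) * Q h).
      apply: eq_bigr => i _; rewrite big_distrr natr_sum /=.
      rewrite (eq_bigr _ (fun j _ => esym (orthogonality _ _))) exchange_big /=.
      apply: eq_bigr => h _; rewrite mulr_sumr; apply: eq_bigr => j _.
      by rewrite mulnDr exprD.
    rewrite exchange_big; apply: eq_bigr => h _ /=.
    by rewrite -mulr_suml -mulr_sumr.
  rewrite exchange_big; apply: eq_bigr => h _ /=.
  by rewrite -!mulr_suml.
have QP h : `|Q h| = `|P (l + W) h|.
  rewrite /Q; under eq_bigr => j _ do rewrite mulnDr exprD invfM !om_inv.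
  by rewrite -mulr_sumr normrM norm_conjC norm_unit_root // mul1r -rmorph_sum norm_conjC.
have step3 : (M * (W * cnt))%:R <=
    \sum_(h < M) normc (S h) * normc (P W h) * normc (P (l + W) h).
  rewrite -lecR rmorph_nat;
    apply: le_trans (_ : (M * \sum_(n < N) \sum_(i < W) \sum_(j < l + W)
    (p n + i == A + j %[mod M]))%:R <= _).
    by rewrite ler_nat.
  rewrite -[leLHS]normr_nat step2; apply: le_trans (ler_norm_sum _ _ _) _.
  rewrite rmorph_sum; apply: ler_sum => h _.
  by rewrite !normrM QP !rmorphM /= -!norm_normc.
have M1 : (0 < M)%N by [].
have step4 : (M * (W * cnt))%:R <= N%:R * W%:R * (l%:R + W%:R) +
    2 * (2 * H%:R * (B * W%:R * M%:R) + N%:R * M%:R ^+ 2 / H%:R) :> R.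
  apply: le_trans step3 _; rewrite (bigID (fun h : 'I_M => (0 < h)%N)) /= addrC.
  apply: lerD; last first.
    apply: le_trans (sum_T HM); apply: ler_sum => h h0.
    by apply: term_bound; rewrite h0 ltn_ord.
  rewrite (big_pred1 (Ordinal M1)) => [|h]; last by rewrite -leqNgt leqn0.
  by rewrite -natrD !ler_pM ?mulr_ge0 ?normc_ge0.
have W1 : 0 < W%:R :> R by rewrite ltr0n expn_gt0.
have MR : 0 < M%:R :> R by rewrite ltr0n.
have w1 : 0 < (2 ^ w)%:R :> R by rewrite ltr0n expn_gt0.
have MW : M%:R = W%:R * (2 ^ w)%:R :> R by rewrite -natrM -expnD subnK.
have HR : H%:R = (2 ^ w)%:R ^+ 2 :> R by rewrite -natrX -expnM mulnC.
rewrite -(ler_pM2l (mulr_gt0 MR W1)).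
apply: le_trans (_ : (M * (W * cnt))%:R <= _); first by rewrite !natrM mulrA.
apply: le_trans step4 _; rewrite -/H HR MW.
move: (2 ^ w)%:R w1 (W%:R) W1 => x x0 y y0.
rewrite le_eqVlt; apply/orP; left; apply/eqP; field.
by rewrite !gt_eqF.
Qed.

End Smoothing.

(** * Discrepancy *)

Local Close Scope complex_scope.
Local Open Scope classical_set_scope.
Local Open Scope ring_scope.

Section Discrepancy.
Context {R : realType}.

(** Membership is described only up to the end points, whatever the kind of interval. This is enough
    for [discrepancy_le], which covers the interval and its complement by arcs containing the end
    points. *)
Lemma interval_endpoints (J : interval R) : [set` J] `<=` `[0, 1[ ->
  exists a b : R, [/\ 0 <= a, a <= b, b <= 1,
    fine (lebesgue_measure [set` J]) = b - a &
    (forall x, x \in J -> a <= x <= b) /\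
    (forall x, 0 <= x < 1 -> x \notin J -> (x <= a) || (b <= x))].
Proof.
move=> J01.
have [[x0 x0J]|J0] := pselect (exists x, x \in J); last first.
  exists 0, 0; split=> //.
    have -> : [set` J] = set0 by rewrite -subset0 => x xJ; apply: J0; exists x.
    by rewrite measure0 subrr.
  split=> [x xJ|x _ _]; first by case: J0; exists x.
  exact: le_total.
have sub x : x \in J -> 0 <= x < 1.
  by move=> xJ; have := J01 x xJ; rewrite /= in_itv /=.
have /andP[x00 x01] := sub _ x0J.
case: J J01 x0J sub => [[bl a|[]] [br b|[]]] J01 x0J sub.
- have ax : a <= x0 by move: x0J; rewrite in_itv /= => /andP[/lteifW].
  have xb : x0 <= b by move: x0J; rewrite in_itv /= => /andP[_ /lteifW].
  have a0 : 0 <= a.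
    rewrite leNgt; apply/negP => a0.
    have : a / 2 \in Interval (BSide bl a) (BSide br b).
      rewrite in_itv /=; apply/andP; split; apply: lteifS; lra.
    by move/sub; lra.
  have b1 : b <= 1.
    rewrite leNgt; apply/negP => b1.
    have : (1 + b) / 2 \in Interval (BSide bl a) (BSide br b).
      rewrite in_itv /=; apply/andP; split; apply: lteifS; lra.
    by move/sub; lra.
  have ab := le_trans ax xb.
  exists a, b; split=> //.
    rewrite lebesgue_measure_itv /= lte_fin; case: ltP => [ltab|leba] //=.
    by have -> : a = b by [apply/le_anti; rewrite ab]; rewrite subrr.
  split=> [x|x _]; first by rewrite in_itv /= => /andP[/lteifW -> /lteifW ->].
  rewrite in_itv /= negb_and -!lteifNE => /orP[] /lteifW ->; rewrite ?orbT //.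
- by move: x0J; rewrite in_itv /= andbF.
- have ax : a <= x0 by move: x0J; rewrite in_itv /= andbT => /lteifW.
  have : x0 + 1 \in Interval (BSide bl a) +oo%O.
    by rewrite in_itv /= andbT; apply: lteifS; lra.
  by move/sub; lra.
- have xb : x0 <= b by move: x0J; rewrite in_itv /= => /lteifW.
  have : x0 - 2 \in Interval -oo%O (BSide br b).
    by rewrite in_itv /=; apply: lteifS; lra.
  by move/sub; lra.
- by move: x0J; rewrite in_itv.
- by have /sub : x0 + 1 \in Interval -oo%O +oo%O by []; lra.
all: by move: x0J; rewrite in_itv.
Qed.

Lemma count_inE (x : nat -> R) (L N : nat) (J : interval R) :
  count_in x L N J = (\sum_(n < N) (x (L + n)%N \in J))%N.
Proof.
rewrite /count_in -sum1_count -[X in index_iota X _]add0n big_addn addKn big_mkord.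
by rewrite big_mkcond; apply: eq_bigr => n _; rewrite addnC; case: ifP.
Qed.

Lemma discrepancy_ub (x : nat -> R) (L N : nat) (y : R) :
  (forall J : interval R, [set` J] `<=` `[0, 1[ ->
     `|(count_in x L N J)%:R / N%:R - fine (lebesgue_measure [set` J])| <= y) ->
  discrepancy x L N <= y.
Proof.
move=> h; apply: ge_sup => [|z [J J01 <-]]; last exact: h.
exists `|(count_in x L N `]0, 0[)%:R / N%:R - fine (lebesgue_measure [set` `]0 : R, 0[])|.
by exists `]0, 0[ => //=; rewrite set_itv_ge ?bnd_simp ?ltxx.
Qed.

Lemma discrepancy_le1 (x : nat -> R) (L N : nat) : (0 < N)%N -> discrepancy x L N <= 1.
Proof.
move=> N0; apply: discrepancy_ub => J J01.
have [a [b [a0 ab b1 -> _]]] := interval_endpoints J01.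
have NR : 0 < N%:R :> R by rewrite ltr0n.
have c1 : (count_in x L N J)%:R / N%:R <= 1 :> R.
  rewrite ler_pdivrMr // mul1r ler_nat /count_in.
  by apply: leq_trans (count_size _ _) _; rewrite size_iota addKn.
have c0 : 0 <= (count_in x L N J)%:R / N%:R :> R by rewrite divr_ge0.
by rewrite ler_norml; apply/andP; split; lra.
Qed.

(** Upper bounds for the counts in arcs modulo [M] suffice: the complement of an interval is
    contained in an arc as well, and an upper bound there is a lower bound for the interval.
    Rounding adds at most 2 points to the length of an arc, whence the term 2 / M. *)
Lemma discrepancy_le (v : nat -> nat) (M L N : nat) (E : R) : (0 < N)%N ->
  (forall n, (v n < M)%N) ->
  (forall A l, (\sum_(n < N) [exists j : 'I_l, v (L + n)%N == A + j %[mod M]])%:R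
     <= N%:R * l%:R / M%:R + E) ->
  discrepancy (fun n => (v n)%:R / M%:R) L N <= 2 / M%:R + E / N%:R.
Proof.
move=> N0 vM H; apply: discrepancy_ub => J J01.
have [a [b [a0 ab b1 -> [inJ notinJ]]]] := interval_endpoints J01.
have NR : 0 < N%:R :> R by rewrite ltr0n.
have MR : 0 < M%:R :> R by rewrite ltr0n (leq_ltn_trans _ (vM 0%N)).
have aM : 0 <= a * M%:R by rewrite mulr_ge0.
have bM : 0 <= b * M%:R by rewrite mulr_ge0 // (le_trans a0).
pose al := Num.truncn (a * M%:R); pose be := Num.truncn (b * M%:R).
have /andP[al1 al2] : al%:R <= a * M%:R < al.+1%:R by exact: truncn_itv.
have /andP[be1 be2] : be%:R <= b * M%:R < be.+1%:R by exact: truncn_itv.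
have beM : (be <= M)%N.
  by rewrite -(ler_nat R); apply: le_trans be1 _;
    rewrite -[leRHS]mul1r ler_wpM2r // ltW.
have albe : (al <= be)%N by apply: le_truncn; rewrite ler_wpM2r // ltW.
set cnt := count_in _ L N J; have cntE := count_inE (fun n => (v n)%:R / M%:R) L N J.
rewrite -/cnt in cntE.
have up : cnt%:R <= N%:R * (b - a) + N%:R * 2 / M%:R + E.
  apply: le_trans (_ : N%:R * (be - al).+1%:R / M%:R + E <= _).
    apply: le_trans (H al (be - al).+1); rewrite ler_nat cntE; apply: leq_sum => n _.
    case: (boolP (_ \in J)) => // /inJ;
      rewrite ler_pdivlMr // ler_pdivrMr // => /andP[h1 h2].
    have v1 : (al <= v (L + n)%N)%N by rewrite -(ler_nat R); exact: le_trans h1.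
    have v2 : (v (L + n)%N <= be)%N by rewrite -ltnS -(ltr_nat R);
      exact: le_lt_trans be2.
    suff -> : [exists j : 'I_(be - al).+1, v (L + n)%N == al + j %[mod M]] by [].
    have jl : (v (L + n) - al < (be - al).+1)%N by rewrite ltnS leq_sub2r.
    by apply/existsP; exists (Ordinal jl); rewrite /= subnKC.
  rewrite lerD2r.
  have -> : N%:R * (b - a) + N%:R * 2 / M%:R = N%:R * (b - a + 2 / M%:R) by ring.
  rewrite -mulrA ler_wpM2l ?ler0n // ler_pdivrMr // mulrDl divfK ?gt_eqF //.
  by rewrite -natr1 natrB //; rewrite -natr1 in al2; lra.
have lo : N%:R - cnt%:R <= N%:R - N%:R * (b - a) + N%:R * 2 / M%:R + E.
  apply: le_trans (_ : N%:R * (M + al - be).+1%:R / M%:R + E <= _).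
    apply: le_trans (H be (M + al - be).+1).
    have -> : N%:R - cnt%:R = (\sum_(n < N) ((v (L + n)%N)%:R / M%:R \notin J))%:R :> R.
      apply/eqP; rewrite subr_eq -natrD eqr_nat cntE -big_split /=; apply/eqP.
      rewrite -[LHS]card_ord -sum1_card; apply: eq_bigr => n _.
      by case: (_ \in J).
    rewrite ler_nat; apply: leq_sum => n _.
    case: (boolP (_ \in J)) => //= nJ.
    have v01 : 0 <= ((v (L + n)%N)%:R / M%:R : R) < 1.
      by rewrite divr_ge0 //= ltr_pdivrMr // mul1r ltr_nat.
    have := notinJ _ v01 nJ; rewrite ler_pdivrMr // ler_pdivlMr // => h.
    suff -> : [exists j : 'I_(M + al - be).+1, v (L + n)%N == be + j %[mod M]] by [].
    case/orP: h => h.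
      have v2 : (v (L + n)%N <= al)%N by rewrite -ltnS -(ltr_nat R);
        exact: le_lt_trans al2.
      have jl : (v (L + n) + M - be < (M + al - be).+1)%N.
        by rewrite ltnS leq_sub2r // addnC leq_add2l.
      apply/existsP; exists (Ordinal jl); rewrite /= subnKC ?modnDr //.
      by apply: leq_trans beM _; exact: leq_addl.
    have v1 : (be <= v (L + n)%N)%N by rewrite -(ler_nat R); exact: le_trans h.
    have jl : (v (L + n) - be < (M + al - be).+1)%N.
      rewrite ltnS leq_sub2r //; apply: leq_trans (ltnW (vM _)) _; exact: leq_addr.
    by apply/existsP; exists (Ordinal jl); rewrite /= subnKC.
  rewrite lerD2r.
  have -> : N%:R - N%:R * (b - a) + N%:R * 2 / M%:R = N%:R * (1 - (b - a) + 2 / M%:R) by ring.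
  rewrite -mulrA ler_wpM2l ?ler0n // ler_pdivrMr // mulrDl divfK ?gt_eqF //.
  rewrite -natr1 natrB ?natrD; last by apply: leq_trans beM _; exact: leq_addr.
  by rewrite -natr1 in be2; lra.
have N1 : N%:R != 0 :> R by rewrite gt_eqF.
have e (z : R) : (z + 2 / M%:R + E / N%:R) * N%:R = N%:R * z + N%:R * 2 / M%:R + E.
  by rewrite mulrDl divfK //; ring.
have cu : cnt%:R / N%:R <= (b - a) + 2 / M%:R + E / N%:R.
  by rewrite ler_pdivrMr // e.
have cl : 1 - cnt%:R / N%:R <= (1 - (b - a)) + 2 / M%:R + E / N%:R.
  rewrite -(ler_pM2r NR) e mulrBl divfK // mul1r; apply: le_trans lo _.
  by have -> : N%:R * (1 - (b - a)) = N%:R - N%:R * (b - a) by ring.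
by rewrite ler_norml; apply/andP; split; lra.
Qed.

End Discrepancy.

(** * Powers of g and the choice of parameters *)

Lemma odd_int (w : int) : coprimez w 2 -> exists x, w = 1 + 2 * x.
Proof.
rewrite /coprimez /gcdz /= => /eqP[] /eqP h.
have o : odd `|w| by rewrite -coprimen2.
have e := odd_double_half `|w|; rewrite o in e.
have [w0|w0] := leP 0 w.
  exists (`|w|./2)%:Z; rewrite -[LHS](gez0_abs w0) -e; lia.
by exists (- 1 - (`|w|./2)%:Z); rewrite -[LHS]opprK -(ltz0_abs w0) -e; lia.
Qed.

(** An odd square is 1 modulo 8. The exponent is thus large enough for [iterated_square]. *)
Lemma odd_square_exponent (g beta : nat) (w : int) : odd g -> coprimez w 2 ->
  g%:Z ^+ 2 = 1 + w * 2%:Z ^+ beta -> (2 < beta)%N.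
Proof.
move=> og /odd_int[x ->]; have e := odd_double_half g; rewrite og in e.
set y := (g./2)%N in e.
have [z ze] : exists z : nat, (y * y.+1 = z.*2)%N.
  exists (y * y.+1)./2; rewrite -[LHS]odd_double_half oddM /= andbN //.
rewrite -e; case: beta => [|[|[|//]]] /=; rewrite ?expr0 ?expr1 !expr2 => h.
- exfalso; move: h ze; clear; rewrite -!muln2; nia.
- exfalso; move: h ze; clear; rewrite -!muln2; nia.
- exfalso; move: h ze; clear; rewrite -!muln2; nia.
Qed.

(** Squaring 1 + v 2^s gives 1 + (v + v^2 2^(s-1)) 2^(s+1), where the new cofactor is odd as soon as
    s >= 2. Hence every exponent from [beta] on is attained exactly. *)
Lemma iterated_square (g x : int) (beta : nat) : (2 <= beta)%N ->
  g ^+ 2 = 1 + (1 + 2 * x) * 2%:Z ^+ beta ->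
  forall i, exists y, g ^+ (2 ^ i.+1) = 1 + (1 + 2 * y) * 2%:Z ^+ (beta + i).
Proof.
move=> b2 gE; elim=> [|i [y yE]]; first by exists x; rewrite expn1 addn0.
have [s sE] : exists s, (beta + i = s.+2)%N by exists (beta + i - 2)%N; lia.
exists (y + 2 ^+ s * (1 + 2 * y) ^+ 2).
by rewrite expnS mulnC exprM yE addnS sE !exprS; ring.
Qed.

Lemma prim_root_card (t tau : nat) (g : 'Z_(2 ^ t)) : (0 < t)%N ->
  tau.-primitive_root g -> (tau <= 2 ^ t)%N.
Proof.
move=> t0 gP.
have inj : injective (fun i : 'I_tau => g ^+ i).
  move=> i j /eqP; rewrite (eq_prim_root_expr gP) !modn_small //.
  by move/eqP/val_inj.
have := leq_card _ inj; rewrite card_ord => /leq_trans; apply.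
by rewrite card_ord Zp_cast // gt1_2t.
Qed.

Section Final.
Context {R : realType}.

Lemma pow2E (x : R) : pow2 x = expR (x * ln 2).
Proof. by rewrite /pow2 /powR gt_eqF. Qed.

(** Let xi = kap / D^2; then [w] is the integer part of xi / c. With c = 3 * 6400 the exponential
    sum saves 3 xi / c, of which 2^(2 w) consumes 2 xi / c, leaving the same xi / c as the smoothing
    error 1 / 2^w. The errors are at most 2, 3 * 2, 4 * 4 and 4 * 2 times [P], in all 32. *)
Lemma error_total (c M N w D kap m : nat) (B E : R) : (0 < c)%N -> c%:R = 3 * 6400 :> R ->
  (0 < D)%N -> (0 < kap)%N -> (m <= kap)%N -> (2 ^ (8 * kap) <= N)%N -> (N <= M)%N ->
  (w * (c * D ^ 2) <= kap)%N -> (kap < w.+1 * (c * D ^ 2))%N ->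
  B = N%:R * pow2 (3 / 2 - kap%:R / (6400 * D%:R ^+ 2)) + (2 * (2 ^ m * (2 ^ kap) ^ 2))%:R ->
  E = 3 * N%:R / (2 ^ w)%:R + 4 * (2 ^ (2 * w))%:R * B ->
  2 / M%:R + E / N%:R <= 32 * pow2 (- (kap%:R / D%:R ^+ 2 / c%:R)).
Proof.
move=> c0 cE D0 kap0 mk NN NM wl wu BE EE.
set xi : R := kap%:R / D%:R ^+ 2; set P := pow2 _.
have d0 : 0 < D%:R ^+ 2 :> R by rewrite exprn_gt0 // ltr0n.
have N0 : (0 < N)%N by apply: leq_trans NN; rewrite expn_gt0.
have NR : 0 < N%:R :> R by rewrite ltr0n.
have P0 : 0 < P by exact: pow2_gt0.
have cR : 0 < c%:R :> R by rewrite ltr0n.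
have w1 : w%:R <= xi / c%:R.
  rewrite /xi -mulrA -invfM ler_pdivlMr ?(mulr_gt0 d0 cR) //.
  by rewrite [_ ^+ 2 * _]mulrC -natrX -!natrM ler_nat.
have w2 : xi / c%:R <= w%:R + 1.
  rewrite /xi -mulrA -invfM ler_pdivrMr ?(mulr_gt0 d0 cR) // natr1.
  by rewrite [_ ^+ 2 * _]mulrC -natrX -!natrM ler_nat ltnW.
have xik : xi <= kap%:R.
  rewrite /xi ler_pdivrMr // -natrX -natrM ler_nat leq_pmulr // expn_gt0 D0 //.
have xi0 : 0 <= xi by rewrite divr_ge0 // ltW.
have Ninv : N%:R^-1 <= pow2 (- (8 * kap%:R)) :> R.
  have -> : pow2 (- (8 * kap%:R)) = (pow2 (8 * kap%:R))^-1 :> R by rewrite !pow2E mulNr expRN.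
  rewrite lef_pV2 ?posrE ?pow2_gt0 //.
  by rewrite -natrM pow2_nat ler_nat.
have x3 : kap%:R / (6400 * D%:R ^+ 2) = 3 * (xi / c%:R).
  by rewrite /xi cE; field; rewrite gt_eqF ?ltr0n.
have xc : 0 <= xi / c%:R by rewrite divr_ge0 // ltW.
have xc1 : 3 * (xi / c%:R) <= kap%:R.
  apply: le_trans xik; rewrite mulrA ler_pdivrMr // cE.
  by rewrite [leLHS]mulrC ler_wpM2l //; lra.
rewrite x3 in BE; clear x3 cE.
have i4 : 2 / M%:R <= 2 * P.
  rewrite ler_pM2l //; apply: le_trans (_ : N%:R^-1 <= _).
    by rewrite lef_pV2 ?posrE ?ltr0n ?ler_nat // (leq_trans N0).
  by apply: le_trans Ninv _; apply: le_pow2; rewrite lerN2; lra.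
have i1 : ((2 ^ w)%:R)^-1 <= 2 * P.
  rewrite -pow2_nat pow2E -expRN -mulNr -pow2E.
  rewrite -pow2_1 -pow2D; apply: le_pow2; lra.
have i2 : (2 ^ (2 * w))%:R * pow2 (3 / 2 - 3 * (xi / c%:R)) <= 4 * P.
  have -> : (4 : R) = pow2 2 by rewrite -[2 in RHS]/(2%:R) pow2_nat.
  rewrite -pow2_nat -!pow2D natrM; apply: le_pow2.
  lra.
have i3 : (2 ^ (2 * w))%:R * (2 * (2 ^ m * (2 ^ kap) ^ 2))%:R / N%:R <= 2 * P.
  apply: le_trans (_ : (2 ^ (2 * w))%:R * (2 ^ (1 + 3 * kap))%:R * pow2 (- (8 * kap%:R)) <= _).
    rewrite ler_pM ?mulr_ge0 ?invr_ge0 // ler_wpM2l // ler_nat.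
    by rewrite -expnM -expnD -expnS leq_exp2l //; clear -mk; lia.
  rewrite -!pow2_nat -!pow2D -pow2_1 -pow2D; apply: le_pow2.
  rewrite natrD !natrM; lra.
have -> : E / N%:R = 3 * ((2 ^ w)%:R)^-1 +
   4 * ((2 ^ (2 * w))%:R * pow2 (3 / 2 - 3 * (xi / c%:R))) +
   4 * ((2 ^ (2 * w))%:R * (2 * (2 ^ m * (2 ^ kap) ^ 2))%:R / N%:R).
  rewrite EE BE; field.
  by rewrite !gt_eqF // ltr0n ?expn_gt0.
lra.
Qed.

(** From N <= 2^(16 kap) and kap D <= t one gets rho <= 16 ln 2 / D, and then rho^2 ln N <= 16^3 (ln
    2)^3 kap / D^2. The constant 4096 is 16^3, and (ln 2)^3 <= ln 2. *)
Lemma rate_le (c t N D kap : nat) :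
  (0 < c)%N -> (0 < D)%N -> (0 < kap)%N -> (0 < N)%N -> (N <= 2 ^ (16 * kap))%N -> (kap * D <= t)%N ->
  pow2 (- (kap%:R / D%:R ^+ 2 / c%:R)) <=
  N%:R `^ (- ((4096 * c%:R)^-1 * (ln (N%:R : R) / t%:R) ^+ 2)).
Proof.
move=> c0 D0 kap0 N0 NN Dt.
have NR : 0 < N%:R :> R by rewrite ltr0n.
rewrite /powR gt_eqF // pow2E ler_expR.
set l := ln N%:R; set l2 := ln 2.
have l0 : 0 <= l by rewrite ln_ge0 // ler1n.
have l20 : 0 <= l2 by rewrite ln_ge0 // ler1n.
have l21 : l2 <= 1.
  by have := @le_ln1Dx R 1 _; rewrite -[1 + 1]/(2%:R); apply; lra.
have lk : l <= 16 * kap%:R * l2.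
  apply: le_trans (_ : ln ((2 ^ (16 * kap))%:R) <= _).
    by rewrite ler_ln ?posrE ?ltr0n ?expn_gt0 // ler_nat.
  by rewrite natrX lnXn // -[_ *+ (16 * kap)]mulr_natl natrM.
have kR : 0 < kap%:R :> R by rewrite ltr0n.
have dR : 0 < D%:R :> R by rewrite ltr0n.
have tk : kap%:R * D%:R <= t%:R :> R by rewrite -natrM ler_nat.
have tR : 0 < t%:R :> R by apply: lt_le_trans tk; rewrite mulr_gt0.
have q1 : l / t%:R <= 16 * l2 / D%:R.
  rewrite ler_pdivrMr //; apply: le_trans lk _.
  have -> : 16 * kap%:R * l2 = 16 * l2 / D%:R * (kap%:R * D%:R) by field;
    rewrite gt_eqF.
  by rewrite ler_wpM2l // divr_ge0 ?mulr_ge0 // ltW.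
have q0 : 0 <= l / t%:R by rewrite divr_ge0 // ltW.
have q2 : (l / t%:R) ^+ 2 * l <= (16 * l2 / D%:R) ^+ 2 * (16 * kap%:R * l2).
  by apply: ler_pM; rewrite ?exprn_ge0 //; apply: lerXn2r;
    rewrite ?nnegrE // (le_trans q0).
have l23 : l2 ^+ 3 <= l2 by rewrite exprS -[leRHS]mulr1 ler_wpM2l // exprn_ile1.
have q3 : (16 * l2 / D%:R) ^+ 2 * (16 * kap%:R * l2) <= 4096 * (kap%:R / D%:R ^+ 2) * l2.
  have -> : (16 * l2 / D%:R) ^+ 2 * (16 * kap%:R * l2) =
     4096 * (kap%:R / D%:R ^+ 2) * l2 ^+ 3 by field; rewrite gt_eqF.
  apply: ler_wpM2l l23; apply: mulr_ge0; first by lra.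
  by apply: divr_ge0; [exact: ltW | exact/exprn_ge0/ltW].
move: (le_trans q2 q3); set z := (l / _) ^+ 2; set xi := _ / _ ^+ 2.
rewrite !mulNr lerN2 => h; have cR : 0 < c%:R :> R by rewrite ltr0n.
have -> : (4096 * c%:R)^-1 * z * l = (z * l) / 4096 / c%:R by field; rewrite gt_eqF.
have -> : xi / c%:R * l2 = xi * l2 / c%:R by field; rewrite gt_eqF.
by rewrite ler_pM2r ?invr_gt0 //; lra.
Qed.

End Final.

Section Main.
Context {R : realType}.
Variables (t : nat) (a b c g : 'Z_(2 ^ t)%N) (L N : nat).
Hypothesis t0 : (0 < t)%N.
Hypotheses (a1 : eqmod2 a 1) (b0 : eqmod2 b 0) (g1 : eqmod2 g 1).

Lemma discrepancy_main (const kap D m : nat) (x : 'Z_(2 ^ t)) :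
  (0 < const)%N -> const%:R = 3 * 6400 :> R -> (256 <= const)%N ->
  g ^+ (2 ^ m) = 1 + 2 ^+ kap * (1 + 2 * x) ->
  (m <= kap)%N -> (0 < kap)%N -> (8 <= D)%N -> (D ^ 2 < kap)%N ->
  (t < kap * D.+1)%N -> (kap * D <= t)%N ->
  (2 ^ (8 * kap) <= N)%N -> (N <= 2 ^ t)%N ->
  discrepancy (fun n => residue_point R (inversive_seq a b c g n)) L N <=
  32 * pow2 (- (kap%:R / D%:R ^+ 2 / const%:R)).
Proof.
move=> c0 cE c256 gm mk kap0 D8 kD tD Dt NN NM.
pose w := (kap %/ (const * D ^ 2))%N.
have D0 : (0 < D)%N by apply: leq_trans D8.
have cD0 : (0 < const * D ^ 2)%N by rewrite muln_gt0 c0 expn_gt0 D0.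
have wl : (w * (const * D ^ 2) <= kap)%N by exact: leq_divM.
have wu : (kap < w.+1 * (const * D ^ 2))%N by exact: ltn_ceil.
(* The frequencies that need a bound have valuation at most 2 w, so this makes 128 times their
   valuation at most [kap]. *)
have w256 : (256 * w <= kap)%N.
  apply: leq_trans wl; rewrite mulnC leq_mul2l; apply/orP; right.
  by apply: leq_trans c256 _; rewrite leq_pmulr // expn_gt0 D0.
have N0 : (0 < N)%N by apply: leq_trans NN; rewrite expn_gt0.
pose M := (2 ^ t)%N.
have M0 : (0 < M)%N by rewrite expn_gt0.
pose om : R[i] := unit_root M.
have omP : M.-primitive_root om := unit_root_prim M0.
pose B : R := N%:R * pow2 (3 / 2 - kap%:R / (6400 * D%:R ^+ 2)) +
   (2 * (2 ^ m * (2 ^ kap) ^ 2))%:R.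
pose E : R := 3 * N%:R / (2 ^ w)%:R + 4 * (2 ^ (2 * w))%:R * B.
pose v n : nat := inversive_seq a b c g n.
have vM n : (v n < M)%N by exact: ltn_Z2t.
have kt : (kap <= t)%N by apply: leq_trans Dt; rewrite leq_pmulr.
have w2k : (2 * w <= kap)%N by move: w256; clear; lia.
have w2t : (2 * w <= t)%N by exact: leq_trans w2k kt.
have wt : (w <= t)%N by apply: leq_trans w2t; rewrite leq_pmull.
have SB h : (0 < h < M)%N -> (logn 2 h <= 2 * w)%N ->
    normc (\sum_(n < N) om ^+ (h * v (L + n)%N)) <= B.
  case/andP=> h0 hM lh; rewrite normc_norm_le.
  have vh : (128 * logn 2 h <= kap * D)%N.
    apply: leq_trans (_ : kap <= _)%N; last by rewrite leq_pmulr.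
    by move: lh w256; clear; lia.
  have x1 : eqmod2 (1 + 2 * x) 1 by exists x.
  by have := exp_sum t0 omP h0 c a1 b0 g1 x1 gm D8 kap0 kD tD Dt vh L N.
have -> : (fun n => residue_point R (inversive_seq a b c g n)) = (fun n => (v n)%:R / M%:R).
  by apply: funext => n; rewrite /residue_point natrX.
apply: le_trans (discrepancy_le (E := E) N0 vM _) _.
  move=> A l; have := @smooth_count R t w t0 wt (fun n => v (L + n)%N) N B SB A l w2t.
  by rewrite /E addrA.
exact: (error_total c0 cE D0 kap0 mk NN NM wl wu (erefl B) (erefl E)).
Qed.

End Main.

Theorem theorem1p2 (R : realType) :
  exists c0 eta0 : R, [/\ 0 < c0, 0 < eta0 &
    forall (t : nat) (a b c g : 'Z_(2 ^ t)%N) (tau beta : nat) (w : int)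
           (L N : nat),
      (3 <= t)%N ->
      coprime (nat_of_ord g) 2 -> coprime (nat_of_ord a) 2 ->
      nat_of_ord b = 0 %[mod 2] ->
      tau.-primitive_root g ->
      (nat_of_ord g)%:Z ^+ 2 = 1 + w * 2%:Z ^+ beta -> coprimez w 2 ->
      (2 ^ (32 * beta) < N)%N -> (N <= tau)%N ->
      let rho : R := ln (N%:R : R) / t%:R in
      discrepancy (fun n => residue_point R (inversive_seq a b c g n)) L N
        <= c0 * N%:R `^ (- (eta0 * rho ^+ 2))].
Proof.
have [const c0 [cE c256]] : exists2 const : nat, (0 < const)%N &
    const%:R = 3 * 6400 :> R /\ (256 <= const)%N.
  exists (3 * 6400)%N; first by rewrite muln_gt0.
  by split; [rewrite natrM | ].
have cR : 0 < const%:R :> R by rewrite ltr0n.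
have one32 : (1 : R) <= 32 * 2^-1 by lra.
have p32 : (0 : R) <= 32 by lra.
exists 32, (4096 * const%:R)^-1; split.
- by lra.
- by rewrite invr_gt0; apply: mulr_gt0 cR; lra.
move=> t a b c g tau beta w L N t3 g2 a2 b2 gP gw w2 Nbeta Ntau; cbv zeta.
have t0 : (0 < t)%N by apply: leq_trans t3.
have og : odd g by rewrite -coprimen2.
have oa : odd a by rewrite -coprimen2.
have ob : ~~ odd b by rewrite -dvdn2 /dvdn b2.
have par (x : 'Z_(2 ^ t)) : eqmod2 x (odd x)%:R.
  by have := eqmod2_nat (A := 'Z_(2 ^ t)) x; rewrite natr_Zp.
have a1 : eqmod2 a 1 by have := par a; rewrite oa.
have g1 : eqmod2 g 1 by have := par g; rewrite og.
have b0 : eqmod2 b 0 by have := par b; rewrite (negbTE ob).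
have beta3 := odd_square_exponent og w2 gw.
have [x0 wE] := odd_int w2; rewrite wE in gw.
have powers := iterated_square (ltnW beta3) gw.
pose k0 := trunc_log 2 N.
have N0 : (0 < N)%N by apply: leq_ltn_trans Nbeta.
have k1 : (2 ^ k0 <= N)%N by exact: trunc_logP.
have k2 : (N < 2 ^ k0.+1)%N by exact: trunc_log_ltn.
have NM : (N <= 2 ^ t)%N := leq_trans Ntau (prim_root_card t0 gP).
have k0b : (32 * beta <= k0)%N by apply: trunc_log_max => //; exact: ltnW.
have k0t : (k0 <= t)%N by rewrite -(leq_exp2l (m := 2)) //; exact: leq_trans k1 NM.
(* The divisor 8 makes the shifts 2^m x y, which are at most 2^(3 kap), negligible against N >= 2^(8
   kap); it also yields D >= 8. *)
pose kap := (k0 %/ 8)%N.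
have kap8 : (8 * kap <= k0)%N by rewrite mulnC; exact: leq_divM.
have kap9 : (k0 < 8 * kap.+1)%N by rewrite mulnC; exact: ltn_ceil.
(* The lower bound on [N] guarantees beta <= kap, so that repeated squaring reaches the exponent
   [kap] exactly, with m = kap - beta + 1 <= kap. *)
have kb : (4 * beta <= kap)%N by move: k0b kap9; clear; lia.
have kap0 : (0 < kap)%N by move: kb beta3; clear; lia.
pose D := (t %/ kap)%N.
have Dt : (kap * D <= t)%N by rewrite mulnC; exact: leq_divM.
have tD : (t < kap * D.+1)%N by rewrite mulnC; exact: ltn_ceil.
have D8 : (8 <= D)%N by rewrite leq_divRL //; exact: leq_trans k0t.
have D0 : (0 < D)%N by apply: leq_trans D8.
have NN : (2 ^ (8 * kap) <= N)%N by apply: leq_trans k1; rewrite leq_exp2l.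
have N16 : (N <= 2 ^ (16 * kap))%N.
  apply: leq_trans (ltnW k2) _; rewrite leq_exp2l //.
  by move: kap9 kap0; clear; lia.
have rate := @rate_le R const t N D kap c0 D0 kap0 N0 N16 Dt.
apply: le_trans (_ : 32 * pow2 (- (kap%:R / D%:R ^+ 2 / const%:R)) <= _); last first.
  exact: (ler_wpM2l p32).
(* For kap <= D^2 the exponent is at least -1, so the bound is at least 16 while the discrepancy is
   at most 1. *)
have [kD|kD] := leqP kap (D ^ 2).
  apply: le_trans (discrepancy_le1 _ _ N0) _.
  apply: le_trans (_ : 32 * pow2 (- 1) <= _).
    rewrite pow2E mulN1r expRN; have := pow2E (1 : R); rewrite mul1r pow2_1 => <-.
    exact: one32.
  apply: (ler_wpM2l p32); apply: le_pow2; rewrite lerN2 ler_pdivrMr // mul1r.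
  apply: le_trans (_ : 1 <= _); last by rewrite ler1n.
  rewrite ler_pdivrMr ?exprn_gt0 ?ltr0n // mul1r -natrX ler_nat //.
have [y yE] := powers (kap - beta)%N.
have bk : (beta + (kap - beta) = kap)%N by move: kb; clear; lia.
have gm : g ^+ (2 ^ (kap - beta).+1) = 1 + 2 ^+ kap * (1 + 2 * y%:~R).
  have := congr1 (fun z : int => z%:~R : 'Z_(2 ^ t)) yE.
  rewrite bk rmorphXn /= -pmulrn natr_Zp => ->.
  by rewrite rmorphD rmorphM rmorphD rmorphM rmorphXn /= mulrC.
have mk : ((kap - beta).+1 <= kap)%N by move: kb beta3; clear; lia.
exact: (@discrepancy_main R t a b c g L N t0 a1 b0 g1 const kap D (kap - beta).+1 y%:~R
  c0 cE c256 gm mk kap0 D8 kD tD Dt NN NM).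
Qed.
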